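(* Let $M$ be a closed smooth manifold of dimension $n \ge 2$, let $g_0$ be a $C^2$-Riemannian metric on $M$, and let $\mathcal{M}$ be the space of all $C^2$-Riemannian metrics on $M$. Let $\sigma \in C^0(M)$ be any continuous function and $\kappa \in \mathbb{R}$ any constant. If $Y(M, g_0) > 0$, then the set $$\left\{ g \in [g_0] \ \middle|\ \int_M R(g)\, d\mathrm{vol}_g \le \kappa,\ R(g) \ge \sigma \text{ on } M \right\} \subset \mathcal{M}$$ is closed in $\mathcal{M}$ with respect to the $C^0$-topology. If $Y(M, g_0) \le 0$, then the set $$\left\{ g \in [g_0] \ \middle|\ \int_M R(g)\, d\mathrm{vol}_g \le \kappa \right\} \subset \mathcal{M}$$ is closed in $\mathcal{M}$ with respect to the $C^0$-topology.
   Context: Closed manifold means compact without boundary. For $g \in \mathcal{M}$, $R(g)$ denotes its scalar curvature and $d\mathrm{vol}_g$ its Riemannian volume measure. The ($C^2$-)conformal class of $g_0$ is $[g_0] := \{ g = u \cdot g_0 \in \mathcal{M} \mid u \in C^2(M),\ u > 0 \text{ on } M \}$. The $C^0$-topology on $\mathcal{M}$ is the topology of uniform convergence of metric tensors on $M$. For $n \ge 3$ the Yamabe constant of $g_0$ is $$Y(M, g_0) := \inf\left\{ \frac{\int_M R(h)\, d\mathrm{vol}_h}{\left(\int_M d\mathrm{vol}_h\right)^{\frac{n-2}{n}}} \ \middle|\ h = v^{\frac{4}{n-2}} g_0,\ v \in C^\infty(M),\ v > 0 \text{ on } M \right\}.$$ For $n = 2$, $Y(M, g_0)$ is the infimum of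 $\int_M R(h)\, d\mathrm{vol}_h$ over metrics $h = v \cdot g_0$ with $v \in C^\infty(M)$, $v > 0$, which equals $4\pi\chi(M)$ by the Gauss-Bonnet theorem. *)

(* Defs.v *)
From HB Require Import structures.
From mathcomp Require Import all_boot all_order all_algebra.
From mathcomp Require Import all_classical all_reals all_analysis.

Set Implicit Arguments.
Unset Strict Implicit.
Unset Printing Implicit Defensive.

Import Order.TTheory GRing.Theory Num.Theory.
Import numFieldNormedType.Exports.

Local Open Scope classical_set_scope.
Local Open Scope ring_scope.

Section cons_measure.
Context {R : realType} (n : nat).
Local Notation Rn := (n.-tuple (measurableTypeR R)).
Local Notation RSn := (n.+1.-tuple (measurableTypeR R)).
Variable mu : {sigma_finite_measure set Rn -> \bar R}.

Definition cons_pair (xy : measurableTypeR R * Rn) : RSn :=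
  [the RSn of xy.1 :: xy.2].

Lemma measurable_cons_pair : measurable_fun [set: measurableTypeR R * Rn] cons_pair.
Proof. exact: measurable_cons. Qed.

Definition cons_measure : set RSn -> \bar R :=
  pushforward (lebesgue_measure \x mu)%E cons_pair.

HB.instance Definition _ := Measure.copy cons_measure
  (measure_function_pushforward__canonical__measure_function_Measure
     (lebesgue_measure \x mu)%E measurable_cons_pair).

Let cons_measure_sigma_finite : sigma_finite [set: RSn] cons_measure.
Proof.
have /sigma_finiteP[F [TF ndF Foo]] := sigma_finiteT (@lebesgue_measure R).
have /sigma_finiteP[G [TG ndG Goo]] := sigma_finiteT mu.
pose u (t : RSn) : Rn := [tuple of behead t].
have mu_ : measurable_fun [set: RSn] u by exact: measurable_behead.
have mthead : measurable_fun [set: RSn] (fun t => thead t).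
  exact: (@measurable_tnth _ (measurableTypeR R) n.+1 ord0).
exists (fun k => (fun t : RSn => thead t) @^-1` F k `&` u @^-1` G k).
  apply/esym; rewrite -subTset => t _.
  have [i _ Fi] : (\bigcup_i F i) (thead t) by rewrite -TF.
  have [j _ Gj] : (\bigcup_i G i) (u t) by rewrite -TG.
  exists (maxn i j) => //; split.
  - by have /subsetPset sF := ndF _ _ (leq_maxl i j); exact: sF.
  - by have /subsetPset sG := ndG _ _ (leq_maxr i j); exact: sG.
move=> k; have [mF Fk] := Foo k; have [mG Gk] := Goo k; split.
  apply: measurableI; rewrite -[X in measurable X]setTI; [exact: mthead|exact: mu_].
rewrite /cons_measure /pushforward.
rewrite (_ : _ @^-1` _ = F k `*` G k); last first.
  apply/seteqP; split=> -[x y] /=; rewrite theadE;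
    by rewrite (_ : u _ = y)//; apply: val_inj.
by rewrite product_measure1E// lte_mul_pinfty// ge0_fin_numE.
Qed.

HB.instance Definition _ := Measure_isSigmaFinite.Build _ _ _ cons_measure
  cons_measure_sigma_finite.

End cons_measure.

Fixpoint lebesgue_tuple {R : realType} (n : nat) :
    {sigma_finite_measure set (n.-tuple (measurableTypeR R)) -> \bar R} :=
  match n with
  | 0 => [the {sigma_finite_measure set _ -> \bar R} of
           dirac [tuple of [::]] : set (0.-tuple (measurableTypeR R)) -> \bar R]
  | m.+1 => [the {sigma_finite_measure set _ -> \bar R} of
           cons_measure (lebesgue_tuple m)]
  end.

Definition row_of_tuple {R : realType} (n : nat)
    (t : n.-tuple (measurableTypeR R)) : 'rV[R]_n := \row_i tnth t i.

Section calculus.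
Context {R : realType} {n : nat}.
Implicit Types (f : 'rV[R]_n -> R) (D : set 'rV[R]_n) (G : 'rV[R]_n -> 'M[R]_n).

Definition pderiv (a : 'I_n) f : 'rV[R]_n -> R :=
  fun x => 'D_(delta_mx 0 a) f x.

(* meant for open D *)
Fixpoint Ck (k : nat) D f : Prop :=
  (forall x, D x -> {for x, continuous f}) /\
  match k with
  | 0 => True
  | m.+1 => forall a : 'I_n,
      (forall x, D x -> derivable f x (delta_mx 0 a)) /\ Ck m D (pderiv a f)
  end.

(* In the definitions below, G x is the Gram matrix at x of a metric in local
   coordinates. *)

(* christoffel G c a b is Gamma^c_{ab} *)
Definition christoffel G (c a b : 'I_n) : 'rV[R]_n -> R := fun x =>
  2^-1 * \sum_(d < n) (invmx (G x)) c d *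
    (pderiv a (fun y => G y b d) x + pderiv b (fun y => G y a d) x
     - pderiv d (fun y => G y a b) x).

(* R^d_{abc}, with the convention Rm(e_a, e_b) e_c = \sum_d R^d_{abc} e_d, where
   Rm(X, Y) Z = D_X D_Y Z - D_Y D_X Z - D_[X, Y] Z *)
Definition riemann G (d a b c : 'I_n) : 'rV[R]_n -> R := fun x =>
  pderiv a (christoffel G d b c) x - pderiv b (christoffel G d a c) x
  + \sum_(m < n) (christoffel G d a m x * christoffel G m b c x
                  - christoffel G d b m x * christoffel G m a c x).

Definition ricci G (b c : 'I_n) : 'rV[R]_n -> R := fun x =>
  \sum_(a < n) riemann G a a b c x.

(* with these conventions the round sphere has positive scalar curvature *)
Definition local_scalar G : 'rV[R]_n -> R := fun x =>
  \sum_(b < n) \sum_(c < n) (invmx (G x)) b c * ricci G b c x.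

End calculus.

Record chart (R : realType) (n : nat) (M : topologicalType) := Chart {
  dom : set M;
  cod : set 'rV[R]_n;
  coord : M -> 'rV[R]_n;
  param : 'rV[R]_n -> M;
  dom_open : open dom;
  cod_open : open cod;
  coord_cod : forall p, dom p -> cod (coord p);
  param_dom : forall x, cod x -> dom (param x);
  coordK : forall p, dom p -> param (coord p) = p;
  paramK : forall x, cod x -> coord (param x) = x;
  coord_continuous : forall p, dom p -> {for p, continuous coord};
  param_continuous : forall x, cod x -> {for x, continuous param}
}.

(* transition c c' b is the b-th component of the map from the coordinates of c
   to those of c'; it is meaningful on overlap c c'. *)
Definition transition (R : realType) (n : nat) (M : topologicalType)
    (c c' : chart R n M) (b : 'I_n) : 'rV[R]_n -> R :=
  fun x => coord c' (param c x) 0 b.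

Definition overlap (R : realType) (n : nat) (M : topologicalType)
    (c c' : chart R n M) : set 'rV[R]_n :=
  [set x | cod c x /\ dom c' (param c x)].

Record smooth_atlas (R : realType) (n : nat) (M : topologicalType) := SmoothAtlas {
  chart_index : choiceType;
  chart_at :> chart_index -> chart R n M;
  atlas_cover : forall p : M, exists i, dom (chart_at i) p;
  atlas_smooth : forall i j b k,
    Ck k (overlap (chart_at i) (chart_at j))
      (transition (chart_at i) (chart_at j) b)
}.

Section manifold.
Context {R : realType} {n : nat} {M : ptopologicalType} (A : smooth_atlas R n M).

Definition Ck_fun (k : nat) (f : M -> R) : Prop :=
  forall i, Ck k (cod (A i)) (f \o param (A i)).

Definition smooth_fun (f : M -> R) : Prop := forall k, Ck_fun k f.

(* [gram i p] is the Gram matrix of the metric at p in the coordinate frame of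
   the i-th chart; it is set to 0 outside of the chart so that metrics are equal
   as records iff they are equal as tensor fields. *)
Record C2metric := C2Metric {
  gram :> chart_index A -> M -> 'M[R]_n;
  gram_out : forall i p, ~ dom (A i) p -> gram i p = 0;
  gram_sym : forall i p, (gram i p)^T = gram i p;
  gram_pos : forall i p, dom (A i) p -> forall v : 'rV[R]_n, v != 0 ->
    0 < (v *m gram i p *m v^T) 0 0;
  gram_C2 : forall i a b, Ck 2 (cod (A i)) (fun x => gram i (param (A i) x) a b);
  gram_change : forall i j p, dom (A i) p -> dom (A j) p ->
    let J := \matrix_(a, b)
      pderiv a (transition (A i) (A j) b) (coord (A i) p) in
    gram i p = J *m gram j p *m J^T
}.

HB.instance Definition _ := gen_eqMixin C2metric.
HB.instance Definition _ := gen_choiceMixin C2metric.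

Definition local_metric (g : C2metric) (i : chart_index A) :
  'rV[R]_n -> 'M[R]_n := fun x => g i (param (A i) x).

(* The value of [local_scalar] does not depend on the chart, so that there is
   exactly one such function. *)
Definition scalar_curvature (g : C2metric) : M -> R :=
  get [set f : M -> R | forall i p, dom (A i) p ->
    f p = local_scalar (local_metric g i) (coord (A i) p)].

Definition borel := g_sigma_algebraType (@open M).

Definition is_riemannian_volume (g : C2metric)
    (mu : {measure set borel -> \bar R}) : Prop :=
  forall i (B : set borel), measurable B -> B `<=` dom (A i) ->
    mu B = (\int[lebesgue_tuple n]_(t in
              [set t | (coord (A i) @` B) (row_of_tuple t)])
            (Num.sqrt (\det (local_metric g i (row_of_tuple t))))%:E)%E.

(* By the change of variables formula, such a measure exists, and it is unique
   when M is covered by countably many charts. *)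
Definition riemannian_volume (g : C2metric) : {measure set borel -> \bar R} :=
  match pselect (exists mu, is_riemannian_volume g mu) with
  | left h => projT1 (cid h)
  | right _ => [the {measure set borel -> \bar R} of mzero]
  end.

Definition total_volume (g : C2metric) : R :=
  fine (riemannian_volume g setT).

Definition total_scalar_curvature (g : C2metric) : R :=
  \int[riemannian_volume g]_p scalar_curvature g p.

Definition conformal_by (u : M -> R) (g0 g : C2metric) : Prop :=
  forall i p, g i p = u p *: g0 i p.

Definition conformal_class (g0 : C2metric) : set C2metric :=
  [set g | exists u : M -> R,
     [/\ Ck_fun 2 u, forall p, 0 < u p & conformal_by u g0 g]].

Definition yamabe_exponent : R := if n == 2 then 1 else 4 / (n%:R - 2).

Definition yamabe_quotient (h : C2metric) : R :=
  if n == 2 then total_scalar_curvature h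
  else total_scalar_curvature h / total_volume h `^ ((n%:R - 2) / n%:R).

Definition yamabe_constant (g0 : C2metric) : \bar R :=
  ereal_inf [set (yamabe_quotient h)%:E | h in
    [set h | exists v : M -> R,
      [/\ smooth_fun v, forall p, 0 < v p &
          conformal_by (fun p => v p `^ yamabe_exponent) g0 h]]].

Definition tangent_pairs : Type :=
  (chart_index A * M * ('rV[R]_n * 'rV[R]_n))%type.

HB.instance Definition _ := Choice.on tangent_pairs.

Definition unit_pairs (h : C2metric) : set tangent_pairs :=
  [set x | let: (i, p, (v, w)) := x in
     [/\ dom (A i) p, (v *m h i p *m v^T) 0 0 = 1 &
         (w *m h i p *m w^T) 0 0 = 1]].

Definition metric_eval (h g : C2metric) : {uniform` unit_pairs h -> R} :=
  fun x : tangent_pairs => let: (i, p, (v, w)) := x in (v *m g i p *m w^T) 0 0.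

(* Topology of uniform convergence of the tensors g, measured with a background
   metric h: |g|_h p is the supremum of |g p (v, w)| over h-unit vectors v, w at
   p. On a compact manifold the topology does not depend on h. *)
Definition C0_metrics (h : C2metric) : Type := initial_topology (metric_eval h).

HB.instance Definition _ (h : C2metric) := Topological.on (C0_metrics h).

End manifold.

(* Main.v *)
(* Let [g] be the limit. In the C^0-topology the conformal factors converge
   uniformly, so [g] is conformal to the metrics in the set, and these can be
   written [g' = e^{2w} g] with [w] of class C^2 and uniformly small; taking the
   limit itself as background metric is what makes the argument work. With
   [m = n - 2] and [P = (e^{mw} - 1) / m] (or [P = w] if [m = 0]), the conformal
   change of the scalar curvature reads

     R(g') dvol_{g'} = (e^{mw} R(g) - 2 (n - 1) Delta P
                        + (n - 1) m e^{mw} |dw|^2) dvol_g.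

   The gradient term is nonnegative, and [Delta P] tested against a cutoff
   function can be integrated by parts, which leaves only the small quantity [P].
   Hence the total scalar curvature is lower semicontinuous. The pointwise bound
   passes to the limit in the same way: [e^{2w} R(g') <= R(g) - 2 (n - 1) Delta w]
   and [Delta w] tends to 0 weakly.

   The total scalar curvature takes a default value when no Riemannian volume
   exists or when the local scalar curvatures disagree between charts; both
   defects are conformally invariant, so that these cases can be treated apart
   instead of being excluded. *)
From HB Require Import structures.
Require Import Defs.
From mathcomp Require Import all_boot all_order all_algebra.
From mathcomp Require Import all_classical all_reals all_analysis.
From mathcomp Require Import measurable_realfun perm ring lra.

Set Implicit Arguments.
Unset Strict Implicit.
Unset Printing Implicit Defensive.

Import Order.TTheory GRing.Theory Num.Theory.
Import numFieldNormedType.Exports.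

Local Open Scope classical_set_scope.
Local Open Scope ring_scope.

(** * Functions of class C^k *)

(** Uniform convergence controls [w] but none of its derivatives, so each derivative of [w] in the
    curvature of [g'] must either carry a favourable sign or be moved onto a fixed function. The
    conformal law by itself has the gradient term with coefficient [- (n - 1) m]. Since
    [Delta P = e^{mw} (Delta w + m |dw|^2)], replacing [Delta w] by [Delta P] adds [2 (n - 1) m] and
    reverses that sign. The exponent [m = n - 2] is the [n] of the volume form less the [2] of the
    curvature. The cutoffs form a partition of unity subordinate to charts, so integration by parts
    happens in R^n, for functions supported in one chart, through Fubini and the fundamental theorem
    of calculus. The constants obtained depend on the limit metric and on the cutoffs only; one
    constant therefore serves all [w], and the error vanishes with the size of [w]. Conformal
    invariance of the agreement between charts rests on the coordinate invariance of [Delta w] and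
    [|dw|^2], which in turn comes from the transformation law of the contracted Christoffel
    symbols. *)

Section partial_derivatives.
Context {R : realType} {n : nat}.
Implicit Types (f g : 'rV[R]_n -> R) (D E : set 'rV[R]_n) (x v : 'rV[R]_n).

(** Restricting to the line through [x] turns a directional derivative into a derivative in one real
    variable, where the chain rule and the mean value theorem are available. *)
Lemma is_derive_line f x v d :
  is_derive x v f d <-> is_derive (0 : R) 1 (fun h : R => f (h *: v + x)) d.
Proof.
have e : 'D_v f x = 'D_1 (fun h : R => f (h *: v + x)) (0 : R).
  rewrite /derive; set g := fun _ => _; set h := fun _ => _; suff -> : g = h by [].
  rewrite {}/g {}/h.
  by apply/funext => h /=; rewrite addr0 scale0r add0r [_%:A]mulr1.
split=> -[df dE]; apply: DeriveDef.
- exact: (derivable1P f x v).1 df.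
- by rewrite -e.
- exact: (derivable1P f x v).2 df.
- by rewrite e.
Qed.

Lemma is_derive_comp1 f (phi : R -> R) x v d e :
  is_derive x v f d -> is_derive (f x) 1 phi e ->
  is_derive x v (fun y => phi (f y)) (e * d).
Proof.
move=> /is_derive_line fd pe; apply/is_derive_line.
apply: (@is_derive1_comp _ phi (fun h : R => f (h *: v + x))).
by rewrite scale0r add0r.
Qed.

Lemma is_derive_mul f g x v d e :
  is_derive x v f d -> is_derive x v g e ->
  is_derive x v (fun y => f y * g y) (d * g x + f x * e).
Proof.
move=> fd ge; have := @is_deriveM _ _ f g x v d e fd ge.
by rewrite /GRing.scale/= addrC [g x * d]mulrC.
Qed.

Lemma is_derive_sum_fun (I : Type) (r : seq I) (F : I -> 'rV[R]_n -> R)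
    (d : I -> R) x v :
  (forall i, is_derive x v (F i) (d i)) ->
  is_derive x v (fun y => \sum_(i <- r) F i y) (\sum_(i <- r) d i).
Proof.
move=> Fd; elim: r => [|i r IH].
  have -> : (fun y => \sum_(i <- [::]) F i y) = cst (0 : R).
    by apply/funext => y; rewrite big_nil.
  by rewrite big_nil; exact: is_derive_cst.
have -> : (fun y => \sum_(j <- i :: r) F j y) =
    (F i + (fun y => \sum_(j <- r) F j y)).
  by apply/funext => y; rewrite big_cons.
by rewrite big_cons; exact: is_deriveD.
Qed.

Lemma is_derive_near f g x v d : {near x, f =1 g} ->
  is_derive x v f d -> is_derive x v g d.
Proof. exact: near_eq_is_derive. Qed.

Lemma Ck_continuous k D f x : Ck k D f -> D x -> {for x, continuous f}.
Proof. by case: k => [|k] [+ _]; apply. Qed.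

Lemma Ck_continuous_on k D f : Ck k D f -> forall x, D x -> {for x, continuous f}.
Proof. by move=> fC x Dx; exact: Ck_continuous fC Dx. Qed.

Lemma Ck_is_derive k D f x a : Ck k.+1 D f -> D x ->
  is_derive x (delta_mx 0 a) f (pderiv a f x).
Proof. by move=> [_ /(_ a)[df _]] /df; exact: derivableP. Qed.

Lemma Ck_pderiv k D f a : Ck k.+1 D f -> Ck k D (pderiv a f).
Proof. by move=> [_ /(_ a)[_]]. Qed.

Lemma CkP k D f (df : 'I_n -> 'rV[R]_n -> R) : open D ->
  (forall x, D x -> {for x, continuous f}) ->
  (forall a x, D x -> is_derive x (delta_mx 0 a) f (df a x)) ->
  (forall a, Ck k D (pderiv a f)) -> Ck k.+1 D f.
Proof.
by move=> oD cf dfE H; split=> // a; split=> // x /(dfE a)[].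
Qed.

Lemma CkW k D f : Ck k.+1 D f -> Ck k D f.
Proof.
elim: k f => [|k IH] f [cf df]; split => // a.
by have [? /IH] := df a; split.
Qed.

Lemma Ck_leq j k D f : (j <= k)%N -> Ck k D f -> Ck j D f.
Proof.
elim: k => [|k IH]; first by rewrite leqn0 => /eqP ->.
by rewrite leq_eqVlt ltnS => /orP[/eqP ->//|/IH H /CkW].
Qed.

Lemma Ck_subset k D E f : E `<=` D -> Ck k D f -> Ck k E f.
Proof.
move=> ED; elim: k f => [|k IH] f [cf df]; split => //.
- by move=> x /ED/cf.
- by move=> x /ED/cf.
- by move=> a; have [df1 /IH df2] := df a; split => // x /ED/df1.
Qed.

Lemma open_near_eq D f g x : open D -> (forall y, D y -> f y = g y) -> D x ->
  {near x, f =1 g}.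
Proof.
move=> oD fg Dx; have : nbhs x D by exact: open_nbhs_nbhs.
by apply: filterS => y /fg.
Qed.

Lemma pderiv_near_eq f g x a : {near x, f =1 g} -> pderiv a f x = pderiv a g x.
Proof. exact: near_eq_derive. Qed.

Lemma eq_open_pderiv D f g x a : open D -> (forall y, D y -> f y = g y) ->
  D x -> pderiv a f x = pderiv a g x.
Proof. by move=> oD fg Dx; apply/pderiv_near_eq/(open_near_eq oD). Qed.

Lemma eq_open_continuous D f g x : open D -> (forall y, D y -> f y = g y) ->
  D x -> {for x, continuous f} -> {for x, continuous g}.
Proof.
move=> oD fg Dx cf; rewrite /prop_for /continuous_at -fg//.
apply: cvg_trans cf; apply: (@near_eq_cvg _ _ (nbhs x)).
exact: (open_near_eq oD fg Dx).
Qed.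

Lemma Ck_eq k D f g : open D -> (forall y, D y -> f y = g y) ->
  Ck k D f -> Ck k D g.
Proof.
move=> oD; elim: k f g => [|k IH] f g fg [cf df].
  by split=> // x Dx; exact: (eq_open_continuous oD fg Dx (cf x Dx)).
split=> [x Dx|a]; first exact: (eq_open_continuous oD fg Dx (cf x Dx)).
have [df1 df2] := df a; split=> [x Dx|].
  by apply: near_eq_derivable (df1 x Dx); exact: (open_near_eq oD).
apply: IH df2 => y Dy; exact: (eq_open_pderiv _ oD).
Qed.

Lemma pderivE f x a d : is_derive x (delta_mx 0 a) f d -> pderiv a f x = d.
Proof. by case. Qed.

(** The candidates [df] agree with the partial derivatives on [D] only; as [D] is open, their
    further derivatives agree there too. Most inductions on the order of differentiability go
    through this form. *)
Lemma Ck_is_deriveS k D f (df : 'I_n -> 'rV[R]_n -> R) : open D ->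
  (forall x, D x -> {for x, continuous f}) ->
  (forall a x, D x -> is_derive x (delta_mx 0 a) f (df a x)) ->
  (forall a, Ck k D (df a)) -> Ck k.+1 D f.
Proof.
move=> oD cf dfE H; apply: (CkP oD cf dfE) => a.
by apply: Ck_eq (H a) => // y Dy; rewrite (pderivE (dfE a y Dy)).
Qed.

Lemma Ck_cst k D (c : R) : open D -> Ck k D (cst c).
Proof.
move=> oD; elim: k c => [|k IH] c; first by split => // x _; exact: cst_continuous.
apply: (@Ck_is_deriveS _ _ _ (fun _ => cst 0)) => // x _.
exact: cst_continuous.
Qed.

Lemma CkD k D f g : open D -> Ck k D f -> Ck k D g ->
  Ck k D (fun x => f x + g x).
Proof.
move=> oD; elim: k f g => [|k IH] f g hf hg.
  split=> // x Dx; apply: (@continuousD _ _ _ f g);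
    [exact: Ck_continuous hf Dx|exact: Ck_continuous hg Dx].
apply: (@Ck_is_deriveS _ _ _ (fun a x => pderiv a f x + pderiv a g x)) => //.
- move=> x Dx; apply: (@continuousD _ _ _ f g);
    [exact: Ck_continuous hf Dx|exact: Ck_continuous hg Dx].
- move=> a x Dx; exact: is_deriveD (Ck_is_derive a hf Dx) (Ck_is_derive a hg Dx).
- by move=> a; apply: IH; exact: Ck_pderiv.
Qed.

Lemma CkM k D f g : open D -> Ck k D f -> Ck k D g ->
  Ck k D (fun x => f x * g x).
Proof.
move=> oD; elim: k f g => [|k IH] f g hf hg.
  split=> // x Dx; apply: (@continuousM _ _ f g);
    [exact: Ck_continuous hf Dx|exact: Ck_continuous hg Dx].
apply: (@Ck_is_deriveS _ _ _
    (fun a x => pderiv a f x * g x + f x * pderiv a g x)) => //.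
- move=> x Dx; apply: (@continuousM _ _ f g);
    [exact: Ck_continuous hf Dx|exact: Ck_continuous hg Dx].
- move=> a x Dx; exact: is_derive_mul (Ck_is_derive a hf Dx) (Ck_is_derive a hg Dx).
- by move=> a; apply: CkD => //; apply: IH;
    (exact: Ck_pderiv || exact: CkW).
Qed.

Lemma CkZ k D (c : R) f : open D -> Ck k D f -> Ck k D (fun x => c * f x).
Proof. by move=> oD; apply: CkM => //; exact: Ck_cst. Qed.

Lemma CkN k D f : open D -> Ck k D f -> Ck k D (fun x => - f x).
Proof.
move=> oD /(CkZ (-1) oD); apply: Ck_eq => // y _; by rewrite mulN1r.
Qed.

Lemma CkB k D f g : open D -> Ck k D f -> Ck k D g ->
  Ck k D (fun x => f x - g x).
Proof. by move=> oD hf hg; apply: CkD => //; exact: CkN. Qed.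

Lemma Ck_sum k D (I : Type) (r : seq I) (P : pred I) (F : I -> 'rV[R]_n -> R) :
  open D -> (forall i, Ck k D (F i)) ->
  Ck k D (fun x => \sum_(i <- r | P i) F i x).
Proof.
move=> oD HF; elim: r => [|i r IH].
  by apply: Ck_eq (Ck_cst k 0 oD) => // y _; rewrite big_nil.
case Pi: (P i).
  apply: Ck_eq (CkD oD (HF i) IH) => // y _; by rewrite big_cons Pi.
by apply: Ck_eq IH => // y _; rewrite big_cons Pi.
Qed.

Lemma Ck_prod k D (I : Type) (r : seq I) (P : pred I) (F : I -> 'rV[R]_n -> R) :
  open D -> (forall i, Ck k D (F i)) ->
  Ck k D (fun x => \prod_(i <- r | P i) F i x).
Proof.
move=> oD HF; elim: r => [|i r IH].
  by apply: Ck_eq (Ck_cst k 1 oD) => // y _; rewrite big_nil.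
case Pi: (P i).
  apply: Ck_eq (CkM oD (HF i) IH) => // y _; by rewrite big_cons Pi.
by apply: Ck_eq IH => // y _; rewrite big_cons Pi.
Qed.

Lemma CkX k D f m : open D -> Ck k D f -> Ck k D (fun x => f x ^+ m).
Proof.
move=> oD hf; elim: m => [|m IH].
  by apply: Ck_eq (Ck_cst k 1 oD).
by apply: Ck_eq (CkM oD hf IH) => // y _; rewrite exprS.
Qed.

Lemma continuous_comp1 f (phi : R -> R) x :
  {for x, continuous f} -> {for f x, continuous phi} ->
  {for x, continuous (fun y => phi (f y))}.
Proof. by move=> cf cp; apply: continuous_comp. Qed.

Lemma is_derive1_continuous (phi : R -> R) (t d : R) :
  is_derive t 1 phi d -> {for t, continuous phi}.
Proof.
by move=> [+ _] => /derivable1_diffP; exact: differentiable_continuous.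
Qed.

(** The premise on [dphi] may assume that [phi (f x)] is already of class C^j. This closes the
    induction for functions whose derivative is written in terms of themselves, such as the
    exponential and the inverse. *)
Lemma Ck_comp1 (phi dphi : R -> R) D f k : open D ->
  (forall x, D x -> is_derive (f x) 1 phi (dphi (f x))) ->
  (forall j, (j < k)%N -> Ck j D f -> Ck j D (fun x => phi (f x)) ->
     Ck j D (fun x => dphi (f x))) ->
  Ck k D f -> Ck k D (fun x => phi (f x)).
Proof.
move=> oD dphiE H hf; have cphi j : Ck j D f ->
    forall x, D x -> {for x, continuous (fun x => phi (f x))}.
  move=> hf' x Dx; apply: continuous_comp1; first exact: Ck_continuous hf' Dx.
  exact: is_derive1_continuous (dphiE x Dx).
elim: k H hf => [|k IH] H hf; first by split=> //; exact: cphi hf.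
apply: (@Ck_is_deriveS _ _ _ (fun a x => dphi (f x) * pderiv a f x)) => //.
- exact: cphi hf.
- move=> a x Dx; apply: is_derive_comp1; first exact: (Ck_is_derive a hf Dx).
  exact: dphiE.
- move=> a; apply: CkM => //; last exact: Ck_pderiv.
  have hf' := CkW hf; apply: (H k) => //.
  by apply: IH => // j jk; apply: (H j); exact: ltnW.
Qed.

Lemma Ck_expR k D f : open D -> Ck k D f -> Ck k D (fun x => expR (f x)).
Proof.
move=> oD hf; apply: (@Ck_comp1 expR expR) => //.
Qed.

Lemma is_derive1_inv (t : R) : t != 0 ->
  is_derive t 1 (fun s : R => s^-1) (- (t^-1 * t^-1)).
Proof.
move=> t0; have h : is_derive t (1 : R) (fun s : R => s) 1 by exact: is_derive_id.
have {h} := is_deriveV t0 h.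
rewrite /GRing.scale/= mulr1 => h; apply: is_derive_eq h _.
by rewrite -exprVn expr2.
Qed.

Lemma CkV k D f : open D -> (forall x, D x -> f x != 0) -> Ck k D f ->
  Ck k D (fun x => (f x)^-1).
Proof.
move=> oD f0 hf; apply: (@Ck_comp1 (fun y => y^-1) (fun y => - (y^-1 * y^-1))).
- by [].
- by move=> x /f0; exact: is_derive1_inv.
- move=> j jk hj h; apply: CkN => //; exact: CkM.
- by [].
Qed.

Lemma Ck_ln k D f : open D -> (forall x, D x -> 0 < f x) -> Ck k D f ->
  Ck k D (fun x => ln (f x)).
Proof.
move=> oD f0 hf; apply: (@Ck_comp1 (@ln R) (fun y => y^-1)) => //.
- by move=> x /f0; exact: is_derive1_ln.
- by move=> j jk hj _; apply: CkV => // x /f0 /lt0r_neq0.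
Qed.

Lemma Ck_sqrt k D f : open D -> (forall x, D x -> 0 < f x) -> Ck k D f ->
  Ck k D (fun x => Num.sqrt (f x)).
Proof.
move=> oD f0 hf; apply: Ck_eq (Ck_expR oD (CkZ (2^-1) oD (Ck_ln oD f0 hf))) => //.
move=> y Dy; have /lnK {2}<- : f y \is Num.pos by rewrite posrE f0.
have := expRM_natl 2 (2^-1 * ln (f y)).
rewrite mulrA divff ?pnatr_eq0// mul1r => ->.
by rewrite sqrtr_sqr ger0_norm// expR_ge0.
Qed.

Lemma is_derive_sqrt_comp f x v d : 0 < f x -> is_derive x v f d ->
  is_derive x v (fun y => Num.sqrt (f y)) (d / (2 * Num.sqrt (f x))).
Proof.
move=> f0 fd; have h := is_derive1_sqrt f0.
have := is_derive_comp1 fd h; by rewrite mulrC.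
Qed.

Lemma is_derive_coord x a (b : 'I_n) :
  is_derive x (delta_mx 0 a) (fun y : 'rV[R]_n => y 0 b) (a == b)%:R.
Proof.
apply/is_derive_line.
have -> : (fun h : R => (h *: delta_mx 0 a + x) 0 b : R) =
    ((fun h : R => h * (a == b)%:R) + cst (x 0 b)).
  by apply/funext => h; rewrite !mxE/= [b == a]eq_sym.
rewrite -[X in is_derive _ _ _ X]addr0; apply: is_deriveD.
have -> : (fun h : R => h * (a == b)%:R) = (a == b)%:R *: (id : R -> R).
  by apply/funext => h; rewrite mulrC.
by apply: is_derive_eq (is_deriveZ _ (is_derive_id _ _)) _; rewrite /GRing.scale/= mulr1.
Qed.

Lemma Ck_coord k D (b : 'I_n) : open D -> Ck k D (fun y : 'rV[R]_n => y 0 b).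
Proof.
case: k => [|k] oD; first by split=> // x _; exact: coord_continuous.
apply: (@Ck_is_deriveS _ _ _ (fun a => cst (a == b)%:R)) => //.
- move=> x _; exact: coord_continuous.
- by move=> a x _; exact: is_derive_coord.
- by move=> a; exact: Ck_cst.
Qed.

Lemma Ck0P D f : Ck 0 D f <-> forall x, D x -> {for x, continuous f}.
Proof. by split=> [[]|]. Qed.

End partial_derivatives.

(* Otherwise [done] unfolds these constants when it tries to match hypotheses. *)
#[global] Opaque Ck pderiv.

(** * Derivatives of determinants and inverse matrices *)

Section matrix_calculus.
Context {R : realType} {n : nat}.
Implicit Types (D : set 'rV[R]_n) (x v : 'rV[R]_n).

Lemma Ck_det k D m (F : 'rV[R]_n -> 'M[R]_m) : open D ->
  (forall i j, Ck k D (fun x => F x i j)) -> Ck k D (fun x => \det (F x)).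
Proof.
move=> oD HF; apply: Ck_sum => // s; apply: CkZ => //.
by apply: Ck_prod => // i; exact: HF.
Qed.

Lemma Ck_cofactor k D m (F : 'rV[R]_n -> 'M[R]_m) i j : open D ->
  (forall i j, Ck k D (fun x => F x i j)) ->
  Ck k D (fun x => cofactor (F x) i j).
Proof.
move=> oD HF; apply: CkZ => //; apply: Ck_det => // a b.
apply: Ck_eq (HF (lift i a) (lift j b)) => // y _; by rewrite !mxE.
Qed.

Lemma Ck_invmx k D m (F : 'rV[R]_n -> 'M[R]_m) i j : open D ->
  (forall x, D x -> F x \in unitmx) ->
  (forall i j, Ck k D (fun x => F x i j)) ->
  Ck k D (fun x => invmx (F x) i j).
Proof.
move=> oD Fu HF.
apply: (@Ck_eq _ _ _ _ (fun x => (\det (F x))^-1 * cofactor (F x) j i)) => //.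
  by move=> y /Fu Fy; rewrite /invmx Fy !mxE.
apply: CkM => //; last exact: Ck_cofactor.
apply: CkV => //; last exact: Ck_det.
by move=> x /Fu; rewrite unitmxE unitfE.
Qed.

Lemma is_derive_prod m (F : 'I_m -> 'rV[R]_n -> R) (d : 'I_m -> R) x v :
  (forall i, is_derive x v (F i) (d i)) ->
  is_derive x v (fun y => \prod_(i < m) F i y)
    (\sum_(k < m) d k * \prod_(i < m | i != k) F i x).
Proof.
elim: m F d => [|m IH] F d Fd.
  rewrite big_ord0; have -> : (fun y => \prod_(i < 0) F i y) = cst (1 : R).
    by apply/funext => y; rewrite big_ord0.
  exact: is_derive_cst.
have -> : (fun y => \prod_(i < m.+1) F i y) =
    (fun y => F ord0 y * \prod_(i < m) F (lift ord0 i) y).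
  by apply/funext => y; rewrite big_ord_recl.
have := is_derive_mul (Fd ord0) (IH (fun i => F (lift ord0 i))
  (fun i => d (lift ord0 i)) (fun i => Fd (lift ord0 i))).
move=> h; apply: is_derive_eq h _; rewrite big_ord_recl; congr (_ + _).
  by rewrite [in RHS]big_mkcond big_ord_recl/= mul1r.
rewrite big_distrr/=; apply: eq_bigr => k _.
rewrite [in RHS]big_mkcond big_ord_recl/= -big_mkcond/= mulrCA; congr (_ * (_ * _)).
Qed.

(** Jacobi's formula: the product rule differentiates one row at a time, and the determinant with
    row [k] differentiated is expanded along that row. *)
Lemma is_derive_det m (F : 'rV[R]_n -> 'M[R]_m) (dF : 'M[R]_m) x v :
  (forall i j, is_derive x v (fun y => F y i j) (dF i j)) ->
  is_derive x v (fun y => \det (F y))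
    (\sum_i \sum_j dF i j * cofactor (F x) i j).
Proof.
move=> Fd.
have h : is_derive x v (fun y => \det (F y)) (\sum_(s : {perm 'I_m})
    (-1) ^+ s * \sum_k dF k (s k) * \prod_(i < m | i != k) F x i (s i)).
  apply: is_derive_sum_fun => s.
  have := is_derive_mul (is_derive_cst ((-1) ^+ s : R) x v)
    (is_derive_prod (fun i => Fd i (s i))).
  by rewrite mul0r add0r.
apply: is_derive_eq h _.
under eq_bigr => s _ do rewrite big_distrr/=.
rewrite exchange_big/=; apply: eq_bigr => k _.
pose B : 'M[R]_m := \matrix_(i, j) if i == k then dF k j else F x i j.
transitivity (\det B).
  apply: eq_bigr => s _; rewrite [in RHS](bigD1 k)//=; congr (_ * (_ * _)).
    by rewrite mxE eqxx.
  by apply: eq_bigr => i /negbTE ik; rewrite mxE ik.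
rewrite (expand_det_row _ k); apply: eq_bigr => j _; rewrite mxE eqxx.
congr (_ * (_ * \det _)); apply/matrixP => a b; rewrite !mxE.
by rewrite eq_sym (negbTE (neq_lift _ _)).
Qed.

Lemma is_derive_det_unit m (F : 'rV[R]_n -> 'M[R]_m) (dF : 'M[R]_m) x v :
  F x \in unitmx ->
  (forall i j, is_derive x v (fun y => F y i j) (dF i j)) ->
  is_derive x v (fun y => \det (F y))
    (\det (F x) * \sum_i \sum_j dF i j * invmx (F x) j i).
Proof.
move=> Fu Fd; apply: is_derive_eq (is_derive_det Fd) _.
rewrite big_distrr/=; apply: eq_bigr => i _.
rewrite big_distrr/=; apply: eq_bigr => j _.
rewrite /invmx Fu !mxE [RHS]mulrCA; congr (_ * _); rewrite mulrA divff ?mul1r//.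
by move: Fu; rewrite unitmxE unitfE.
Qed.

Lemma is_derive_invmx D m (F : 'rV[R]_n -> 'M[R]_m) (dF : 'M[R]_m) x a i j :
  open D -> D x -> (forall x, D x -> F x \in unitmx) ->
  (forall i j, Ck 1 D (fun x => F x i j)) ->
  (forall i j, is_derive x (delta_mx 0 a) (fun y => F y i j) (dF i j)) ->
  is_derive x (delta_mx 0 a) (fun y => invmx (F y) i j)
    (- (invmx (F x) *m dF *m invmx (F x)) i j).
Proof.
move=> oD Dx Fu FC Fd.
have hI k l : is_derive x (delta_mx 0 a) (fun y => invmx (F y) k l)
    (pderiv a (fun y => invmx (F y) k l) x).
  by apply: (Ck_is_derive (k := 0) a _ Dx); exact: Ck_invmx.
pose dI : 'M[R]_m := \matrix_(k, l) pderiv a (fun y => invmx (F y) k l) x.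
(* This differentiates [F F^{-1} = 1]. The inverse is already known to be differentiable by Cramer's
   rule ([Ck_invmx]); only the value of its derivative is at stake. *)
have E : dF *m invmx (F x) + F x *m dI = 0.
  apply/matrixP => k l; rewrite !mxE -big_split/=.
  have h : is_derive x (delta_mx 0 a)
      (fun y => \sum_p F y k p * invmx (F y) p l)
      (\sum_p (dF k p * invmx (F x) p l + F x k p * dI p l)).
    apply: is_derive_sum_fun => p; rewrite mxE.
    exact: is_derive_mul (Fd k p) (hI p l).
  rewrite -(@derive_val _ _ _ _ _ _ _ h).
  rewrite (@near_eq_derive _ _ _ _ (cst ((k == l)%:R : R))) ?derive_cst//.
  apply: (open_near_eq oD) Dx => y Dy; have := mulmxV (Fu _ Dy).
  by move=> /matrixP/(_ k l); rewrite !mxE.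
have EI : dI = - (invmx (F x) *m dF *m invmx (F x)).
  move/eqP: E; rewrite addrC addr_eq0 => /eqP/(congr1 (mulmx (invmx (F x)))).
  by rewrite mulmxA mulVmx ?Fu// mul1mx mulmxN mulmxA.
by apply: is_derive_eq (hI i j) _; move/matrixP: EI => /(_ i j); rewrite !mxE.
Qed.

End matrix_calculus.

(** * Index calculus at a single point *)

Section tensor_algebra.
Context {R : realType} {n : nat}.
Implicit Types (X Y : 'I_n -> 'I_n -> 'I_n -> R).

Lemma sum_delta (F : 'I_n -> R) b : \sum_a (a == b)%:R * F a = F b.
Proof.
rewrite (bigD1 b)//= eqxx mul1r big1 ?addr0// => a /negbTE ->.
by rewrite mul0r.
Qed.

Lemma sum_delta' (F : 'I_n -> R) b : \sum_a (b == a)%:R * F a = F b.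
Proof. by rewrite -[RHS]sum_delta; apply: eq_bigr => a _; rewrite eq_sym. Qed.

Variables (g h : 'I_n -> 'I_n -> R) (dg : 'I_n -> 'I_n -> 'I_n -> R).
Variables (w : 'I_n -> R).
Hypotheses (hs : forall a b, h a b = h b a) (gs : forall a b, g a b = g b a).
Hypothesis hg : forall a c, \sum_b h a b * g b c = (a == c)%:R.
Hypothesis dgs : forall c a b, dg c a b = dg c b a.

(** Here [g] stands for the metric at a point, [h] for its inverse, [dg c a b] for the derivative of
    [g a b] in direction [c], and [w] for the differential of the conformal exponent. All are plain
    arrays of numbers, so that symmetries hold without side conditions; at a point of a chart [chr]
    is convertible to [christoffel]. *)
Definition chr (c a b : 'I_n) : R :=
  2^-1 * \sum_d h c d * (dg a b d + dg b a d - dg d a b).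

Definition raise (c : 'I_n) : R := \sum_d h c d * w d.

(* the difference of the Christoffel symbols of e^{2w} g and g *)
Definition cdiff (c a b : 'I_n) : R :=
  (c == a)%:R * w b + (c == b)%:R * w a - g a b * raise c.

Definition ctr X (m : 'I_n) : R := \sum_b \sum_c h b c * X m b c.

Lemma chrC c a b : chr c a b = chr c b a.
Proof.
rewrite /chr; congr (_ * _); apply: eq_bigr => d _.
by rewrite [dg d a b]dgs [dg a b d + _]addrC.
Qed.

Lemma cdiffC c a b : cdiff c a b = cdiff c b a.
Proof. by rewrite /cdiff gs [(c == a)%:R * _ + _]addrC. Qed.

Lemma trace_metric : \sum_b \sum_c h b c * g b c = n%:R.
Proof.
under eq_bigr => b _ do (under eq_bigr => c _ do rewrite gs); under eq_bigr do rewrite hg eqxx.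
by rewrite sumr_const card_ord.
Qed.

Lemma lower_raise m : \sum_a g a m * raise a = w m.
Proof.
under eq_bigr => a _ do rewrite /raise big_distrr/=.
rewrite exchange_big/=; rewrite -[RHS]sum_delta; apply: eq_bigr => d _.
rewrite -hg big_distrl/=; apply: eq_bigr => a _; by rewrite mulrA [h d a]hs mulrC [_ * h _ _]mulrC mulrC.
Qed.

Lemma trace_cdiff m : \sum_a cdiff a a m = n%:R * w m.
Proof.
rewrite /cdiff !big_split/= sumrN lower_raise sum_delta addrK.
under eq_bigr do rewrite eqxx mul1r.
by rewrite sumr_const card_ord mulr_natl.
Qed.

Lemma ctr_cdiff m : ctr cdiff m = (2 - n%:R) * raise m.
Proof.
rewrite /ctr /cdiff.
under eq_bigr => b _ do (under eq_bigr => c _ do rewrite mulrBr mulrDr;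
  rewrite sumrB big_split/=).
rewrite sumrB big_split/= mulrBl mulr2n mulrDl mul1r; congr (_ + _ - _).
- rewrite exchange_big/=; apply: eq_bigr => c _.
  under eq_bigr => b _ do rewrite mulrCA.
  by rewrite sum_delta'.
- apply: eq_bigr => b _; under eq_bigr => c _ do rewrite mulrCA.
  by rewrite sum_delta' hs.
- rewrite -trace_metric big_distrl/=; apply: eq_bigr => b _.
  by rewrite big_distrl/=; apply: eq_bigr => c _; rewrite mulrA.
Qed.

Lemma contract_trace X Y :
  \sum_b \sum_c h b c * (\sum_a \sum_m X a a m * Y m b c) =
  \sum_m (\sum_a X a a m) * ctr Y m.
Proof.
rewrite /ctr.
transitivity (\sum_b \sum_c \sum_m (\sum_a X a a m) * (h b c * Y m b c)).
  apply: eq_bigr => b _; apply: eq_bigr => c _.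
  rewrite exchange_big/= big_distrr/=; apply: eq_bigr => m _.
  by rewrite -big_distrl/= mulrCA.
under eq_bigr => b _ do rewrite exchange_big/=.
rewrite exchange_big/=; apply: eq_bigr => m _.
rewrite big_distrr/=; apply: eq_bigr => b _; by rewrite big_distrr.
Qed.

(** The last two terms of [cdiff] contribute the pairing of [raise] with the trace of [Y], once with
    each sign. They cancel by the symmetry of [Y], and the first term alone remains. *)
Lemma contract_cdiff Y : (forall m a c, Y m a c = Y m c a) ->
  \sum_b \sum_c h b c * (\sum_a \sum_m cdiff a b m * Y m a c) =
  \sum_m w m * ctr Y m.
Proof.
move=> Ys.
have E b c : \sum_a \sum_m cdiff a b m * Y m a c =
    \sum_m w m * Y m b c + w b * (\sum_a Y a a c)
    - \sum_a \sum_m g b m * raise a * Y m a c.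
  rewrite /cdiff.
  under eq_bigr => a _ do (under eq_bigr => m _ do rewrite mulrBl mulrDl;
    rewrite sumrB big_split/=).
  rewrite sumrB big_split/=; congr (_ + _ - _).
    rewrite exchange_big/=; apply: eq_bigr => m _.
    under eq_bigr => a _ do rewrite -mulrA.
    by rewrite sum_delta.
  rewrite big_distrr/=; apply: eq_bigr => a _.
  under eq_bigr => m _ do rewrite -mulrA.
  by rewrite sum_delta'.
under eq_bigr => b _ do (under eq_bigr => c _ do rewrite E mulrBr mulrDr;
  rewrite sumrB big_split/=).
rewrite sumrB big_split/=.
have -> : \sum_b \sum_c h b c * (\sum_m w m * Y m b c) = \sum_m w m * ctr Y m.
  transitivity (\sum_b \sum_c \sum_m w m * (h b c * Y m b c)).
    apply: eq_bigr => b _; apply: eq_bigr => c _.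
    by rewrite big_distrr/=; apply: eq_bigr => m _; rewrite mulrCA.
  under eq_bigr => b _ do rewrite exchange_big/=.
  rewrite exchange_big/=; apply: eq_bigr => m _.
  rewrite big_distrr/=; apply: eq_bigr => b _; by rewrite big_distrr.
have -> : \sum_b \sum_c h b c * (w b * (\sum_a Y a a c)) =
    \sum_c raise c * (\sum_a Y a a c).
  rewrite exchange_big/=; apply: eq_bigr => c _.
  rewrite /raise big_distrl/=; apply: eq_bigr => b _; by rewrite mulrA [h c b]hs.
have -> : \sum_b \sum_c h b c * (\sum_a \sum_m g b m * raise a * Y m a c) =
    \sum_a raise a * (\sum_c Y c a c).
  transitivity (\sum_c \sum_a \sum_m (\sum_b h b c * g b m) * (raise a * Y m a c)).
    rewrite exchange_big/=; apply: eq_bigr => c _.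
    under eq_bigr => b _ do rewrite big_distrr/=.
    rewrite exchange_big/=; apply: eq_bigr => a _.
    under eq_bigr => b _ do rewrite big_distrr/=.
    rewrite exchange_big/=; apply: eq_bigr => m _.
    rewrite big_distrl/=; apply: eq_bigr => b _; by rewrite !mulrA.
  rewrite exchange_big/=; apply: eq_bigr => a _.
  rewrite big_distrr/=; apply: eq_bigr => c _.
  under eq_bigr => m _ do (under eq_bigr => b _ do rewrite hs; rewrite hg).
  by rewrite sum_delta'.
rewrite -addrA; apply/eqP; rewrite -subr_eq0 addrAC subrr add0r subr_eq0; apply/eqP.
apply: eq_bigr => c _; congr (_ * _); apply: eq_bigr => a _; exact: Ys.
Qed.

Lemma contract_chr_cdiff :
  \sum_b \sum_c h b c * (\sum_a \sum_m chr a b m * cdiff m a c) =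
  \sum_m w m * ctr chr m.
Proof.
rewrite -(contract_cdiff chrC) exchange_big/=; apply: eq_bigr => b _.
apply: eq_bigr => c _; rewrite hs; congr (_ * _).
rewrite exchange_big/=; apply: eq_bigr => a _; apply: eq_bigr => m _.
by rewrite cdiffC chrC mulrC.
Qed.

Lemma trace_chr m : \sum_a chr a a m = 2^-1 * \sum_a \sum_b h a b * dg m a b.
Proof.
rewrite /chr -big_distrr/=; congr (_ * _).
under eq_bigr => a _ do (under eq_bigr => d _ do rewrite mulrBr mulrDr;
  rewrite sumrB big_split/=).
rewrite sumrB big_split/= [X in X + _ - _]exchange_big/= addrAC.
rewrite [X in X - _](_ : _ = \sum_a \sum_b h a b * dg b a m) ?subrr ?add0r//.
apply: eq_bigr => a _; apply: eq_bigr => d _.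
by rewrite hs; congr (_ * _); rewrite dgs.
Qed.

(** The first sum is [- d_a h^{ab}] and the trace of [chr] is the derivative of [log (sqrt |g|)].
    Hence this is the classical identity [h^{ac} Gamma^b_{ac} = - |g|^{-1/2} d_a (|g|^{1/2}
    h^{ab})], which puts the Laplacian in divergence form. *)
Lemma ctr_chr b : ctr chr b = \sum_a \sum_c \sum_d h a c * dg a c d * h d b
  - \sum_d h b d * (\sum_a chr a a d).
Proof.
under [X in _ - X]eq_bigr => d _ do rewrite trace_chr.
have -> : ctr chr b = 2^-1 * (\sum_a \sum_c \sum_d h a c * dg a c d * h d b)
   + 2^-1 * (\sum_a \sum_c \sum_d h a c * dg c a d * h d b)
   - \sum_d h b d * (2^-1 * \sum_a \sum_c h a c * dg d a c).
  rewrite -mulrDr -big_split/=.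
  have -> : \sum_d h b d * (2^-1 * \sum_a \sum_c h a c * dg d a c) =
     2^-1 * \sum_a \sum_c \sum_d h a c * dg d a c * h b d.
    transitivity (\sum_d 2^-1 * \sum_a \sum_c h a c * dg d a c * h b d).
      apply: eq_bigr => d _; rewrite mulrCA; congr (_ * _).
      rewrite mulrC big_distrl/=; apply: eq_bigr => a _; by rewrite big_distrl.
    rewrite -big_distrr/=; congr (_ * _); rewrite exchange_big/=.
    by apply: eq_bigr => a _; rewrite exchange_big.
  rewrite -mulrBr -sumrB /ctr big_distrr/=; apply: eq_bigr => a _.
  rewrite -big_split -sumrB big_distrr/=; apply: eq_bigr => c _.
  rewrite -big_split -sumrB /chr mulrCA; congr (_ * _).
  rewrite big_distrr/=; apply: eq_bigr => d _.
  by rewrite (hs d b); ring.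
rewrite [X in _ + 2^-1 * X]exchange_big/=.
rewrite [X in _ + 2^-1 * X](_ : _ = \sum_a \sum_c \sum_d h a c * dg a c d * h d b).
  by congr (_ - _); rewrite -mulrDl -[RHS]mul1r; congr (_ * _); field.
by apply: eq_bigr => a _; apply: eq_bigr => c _; apply: eq_bigr => d _; rewrite hs.
Qed.

End tensor_algebra.

(** * Local Riemannian geometry *)

Section positive_definite.
Context {R : realType}.

Lemma posdef_unit m (A : 'M[R]_m) :
  (forall v : 'rV[R]_m, v != 0 -> 0 < (v *m A *m v^T) 0 0) -> A \in unitmx.
Proof.
move=> Apos; rewrite -row_free_unit -kermx_eq0; apply/eqP/row_matrixP => i.
rewrite row0; apply/eqP/negPn/negP => /Apos.
have -> : row i (kermx A) *m A = 0.
  by apply/sub_kermxP; exact: row_sub.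
by rewrite mul0mx mxE ltxx.
Qed.

(** The segment from the identity to [A] consists of positive definite, hence invertible, matrices.
    The determinant along it is a polynomial in the parameter, equal to 1 at the start, so the
    intermediate value theorem excludes a nonpositive value at the end. *)
Lemma posdef_det_gt0 m (A : 'M[R]_m) :
  (forall v : 'rV[R]_m, v != 0 -> 0 < (v *m A *m v^T) 0 0) -> 0 < \det A.
Proof.
move=> Apos; rewrite ltNge; apply/negP => dA.
pose B : 'M[{poly R}]_m := 'X *: map_mx polyC A + (1 - 'X) *: 1%:M.
have BE t : (\det B).[t] = \det (t *: A + (1 - t) *: 1%:M).
  rewrite -horner_evalE -det_map_mx; congr (\det _); apply/matrixP => i j.
  rewrite !mxE /= horner_evalE !hornerE/=; congr (_ + _ * _).
  by case: eqP => _; rewrite ?hornerE.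
have [t /andP[t0 t1]] : exists2 t, 0 <= t <= 1 & root (- \det B) t.
  apply: poly_ivt => //; rewrite !hornerN !BE scale0r add0r subr0 scale1r.
  by rewrite det1 scale1r subrr scale0r addr0 oppr_le0 ler01 oppr_ge0.
rewrite /root hornerN BE oppr_eq0 => /eqP d0.
have /posdef_unit : forall v : 'rV[R]_m, v != 0 ->
    0 < (v *m (t *: A + (1 - t) *: 1%:M) *m v^T) 0 0.
  move=> v v0; rewrite mulmxDr mulmxDl mxE -!scalemxAr mulmx1 -!scalemxAl.
  rewrite mxE [X in _ + X]mxE.
  have vv : 0 < (v *m v^T) 0 0.
    rewrite mxE; have [j vj] : exists j, v 0 j != 0.
      apply/existsP; apply: contraNT v0 => /existsPn v0; apply/eqP/rowP => j.
      by rewrite mxE; apply/eqP; have := v0 j; rewrite negbK.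
    rewrite (bigD1 j)//= ltr_wpDr//.
      by apply: sumr_ge0 => k _; rewrite mxE -expr2 sqr_ge0.
    by rewrite mxE -expr2 lt_def sqr_ge0 sqrf_eq0 vj.
  have vA := Apos _ v0; have [->|t0'] := eqVneq t 0.
    by rewrite mul0r add0r subr0 mul1r.
  by rewrite ltr_pwDl ?mulr_gt0 ?mulr_ge0 ?subr_ge0 ?(ltW vv)// lt_def t0' t0.
by rewrite unitmxE d0 unitr0.
Qed.

End positive_definite.

(** * The Laplacian of a local metric and its divergence form *)

Section local_geometry.
Context {R : realType} {n : nat}.
Implicit Types (D : set 'rV[R]_n) (G : 'rV[R]_n -> 'M[R]_n).
Implicit Types (f w : 'rV[R]_n -> R) (x : 'rV[R]_n).

(** The conditions are relative to an open set, so that the same results apply to whole chart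
    domains and to overlaps of two charts. *)
Record local_C2metric D G : Prop := LocalC2Metric {
  lm_open : open D;
  lm_sym : forall x, D x -> (G x)^T = G x;
  lm_pos : forall x, D x -> forall v : 'rV[R]_n, v != 0 ->
    0 < (v *m G x *m v^T) 0 0;
  lm_C2 : forall a b, Ck 2 D (fun x => G x a b)
}.

Definition local_laplacian G f x : R :=
  \sum_a \sum_b invmx (G x) a b *
    (pderiv a (pderiv b f) x - \sum_c christoffel G c a b x * pderiv c f x).

Definition local_grad2 G f x : R :=
  \sum_a \sum_b invmx (G x) a b * (pderiv a f x * pderiv b f x).

Definition inv_at G x (a b : 'I_n) : R := invmx (G x) a b.
Definition dmet G x (c a b : 'I_n) : R := pderiv c (fun y => G y a b) x.
Definition grad_at f x (a : 'I_n) : R := pderiv a f x.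

Section fixed_metric.
Variables (D : set 'rV[R]_n) (G : 'rV[R]_n -> 'M[R]_n).
Hypothesis HG : local_C2metric D G.
Let oD : open D := lm_open HG.

Lemma lm_unit x : D x -> G x \in unitmx.
Proof. by move=> Dx; apply/posdef_unit/(lm_pos HG). Qed.

Lemma lm_det_gt0 x : D x -> 0 < \det (G x).
Proof. by move=> Dx; apply/posdef_det_gt0/(lm_pos HG). Qed.

Lemma lm_symE x a b : D x -> G x a b = G x b a.
Proof. by move=> Dx; rewrite -[in LHS](lm_sym HG Dx) mxE. Qed.

Lemma inv_at_sym x a b : D x -> inv_at G x a b = inv_at G x b a.
Proof.
by move=> Dx; rewrite /inv_at -[in LHS](lm_sym HG Dx) -trmx_inv mxE.
Qed.

Lemma inv_at_mul x a c : D x -> \sum_b inv_at G x a b * G x b c = (a == c)%:R.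
Proof.
by move=> Dx; have /matrixP/(_ a c) := mulVmx (lm_unit Dx); rewrite !mxE.
Qed.

Lemma Ck_inv_at k a b : (k <= 2)%N -> Ck k D (fun x => inv_at G x a b).
Proof.
move=> k2; apply: Ck_invmx => //; first exact: lm_unit.
by move=> i j; apply: Ck_leq (lm_C2 HG i j).
Qed.

Lemma dmetC x c a b : D x -> dmet G x c a b = dmet G x c b a.
Proof.
move=> Dx; apply: (eq_open_pderiv _ oD _ Dx) => y Dy; exact: lm_symE.
Qed.

Lemma Ck_dmet k c a b : (k <= 1)%N -> Ck k D (fun x => dmet G x c a b).
Proof. by move=> k1; apply: (@Ck_leq _ _ k 1) => //; apply/Ck_pderiv/(lm_C2 HG). Qed.

Lemma Ck_christoffel k c a b : (k <= 1)%N -> Ck k D (christoffel G c a b).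
Proof.
move=> k1; apply: CkZ => //; apply: Ck_sum => // d; apply: CkM => //.
  by apply: Ck_inv_at; exact: leqW.
by apply: CkB => //; [apply: CkD => //|]; exact: Ck_dmet.
Qed.

Lemma is_derive_met x c a b : D x ->
  is_derive x (delta_mx 0 c) (fun y => G y a b) (dmet G x c a b).
Proof. by move=> Dx; apply: Ck_is_derive (lm_C2 HG a b) Dx. Qed.

Lemma is_derive_inv_at x c a b : D x ->
  is_derive x (delta_mx 0 c) (fun y => inv_at G y a b)
    (- \sum_d \sum_e inv_at G x a d * dmet G x c d e * inv_at G x e b).
Proof.
move=> Dx; have C1 i j : Ck 1 D (fun x => G x i j) by apply/CkW/(lm_C2 HG).
pose dF : 'M[R]_n := \matrix_(i, j) dmet G x c i j.
have := @is_derive_invmx _ _ D n G dF x c a b oD Dx lm_unit C1.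
move=> H; apply: is_derive_eq (H _) _.
  by move=> i j; rewrite mxE; exact: is_derive_met.
rewrite mxE; congr (- _); rewrite exchange_big/=; apply: eq_bigr => e _.
rewrite mxE big_distrl/=; apply: eq_bigr => d _; by rewrite mxE.
Qed.

Section fixed_function.
Variable f : 'rV[R]_n -> R.
Hypothesis fC : Ck 2 D f.

Definition hess_tr x : R := \sum_a \sum_b inv_at G x a b * pderiv a (pderiv b f) x.
Definition up x (a : 'I_n) : R := raise (inv_at G x) (grad_at f x) a.
Definition ctr_christoffel x (a : 'I_n) : R :=
  ctr (inv_at G x) (chr (inv_at G x) (dmet G x)) a.
(** By [trace_chr] and Jacobi's formula, this is the logarithmic derivative of [sqrt (det G)] in
    direction [a]. *)
Definition log_density x (a : 'I_n) : R :=
  \sum_c chr (inv_at G x) (dmet G x) c c a.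

Lemma local_laplacianE x :
  local_laplacian G f x = hess_tr x - \sum_m grad_at f x m * ctr_christoffel x m.
Proof.
rewrite /local_laplacian /hess_tr.
under eq_bigr => a _ do (under eq_bigr => b _ do rewrite mulrBr; rewrite sumrB).
rewrite sumrB; congr (_ - _).
transitivity (\sum_a \sum_b \sum_c grad_at f x c * (inv_at G x a b * christoffel G c a b x)).
  apply: eq_bigr => a _; apply: eq_bigr => b _.
  rewrite big_distrr/=; apply: eq_bigr => c _; rewrite /grad_at /inv_at; ring.
under eq_bigr => a _ do rewrite exchange_big/=.
rewrite exchange_big/=; apply: eq_bigr => c _.
rewrite big_distrr/=; apply: eq_bigr => a _; by rewrite big_distrr.
Qed.

Lemma local_grad2E x : local_grad2 G f x = \sum_m grad_at f x m * up x m.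
Proof.
apply: eq_bigr => a _; rewrite big_distrr/=; apply: eq_bigr => b _.
by rewrite mulrCA.
Qed.

Lemma Ck_grad_at k a : (k <= 1)%N -> Ck k D (fun x => grad_at f x a).
Proof. by move=> k1; apply: (@Ck_leq _ _ k 1) => //; apply: Ck_pderiv. Qed.

Lemma Ck_up k a : (k <= 1)%N -> Ck k D (fun x => up x a).
Proof.
move=> k1; apply: Ck_sum => // d; apply: CkM => //; last exact: Ck_grad_at.
by apply: Ck_inv_at; exact: leqW.
Qed.

Lemma is_derive_grad_at x a b : D x ->
  is_derive x (delta_mx 0 a) (fun y => grad_at f y b) (pderiv a (pderiv b f) x).
Proof. by move=> Dx; apply: (Ck_is_derive (k := 0) a _ Dx); exact: Ck_grad_at. Qed.

Lemma is_derive_up x a b : D x ->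
  is_derive x (delta_mx 0 a) (fun y => up y b) (pderiv a (fun y => up y b) x).
Proof. by move=> Dx; apply: (Ck_is_derive (k := 0) a _ Dx); exact: Ck_up. Qed.

(** The derivative of the inverse metric is [- h dg h], and [ctr_chr] trades it for contracted
    Christoffel symbols and [log_density]. The [log_density] term is the one that the factor
    [sqrt (det G)] compensates in [laplacian_divergence]. *)
Lemma up_divergence x : D x -> \sum_a pderiv a (fun y => up y a) x =
  hess_tr x - \sum_m grad_at f x m * ctr_christoffel x m
  - \sum_m up x m * log_density x m.
Proof.
move=> Dx.
have hs a b := inv_at_sym a b Dx.
have E a : pderiv a (fun y => up y a) x = \sum_b (
    (- \sum_d \sum_e inv_at G x a d * dmet G x a d e * inv_at G x e b) * grad_at f x b
    + inv_at G x a b * pderiv a (pderiv b f) x).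
  apply: pderivE; apply: is_derive_sum_fun => b.
  by apply: is_derive_mul; [exact: is_derive_inv_at|exact: is_derive_grad_at].
under eq_bigr do rewrite E big_split/=.
rewrite big_split/= addrC -addrA; congr (_ + _).
rewrite exchange_big/= -opprD -big_split/=.
have -> : \sum_i (grad_at f x i * ctr_christoffel x i + up x i * log_density x i)
   = \sum_i grad_at f x i * (ctr_christoffel x i +
        \sum_d inv_at G x i d * log_density x d).
  rewrite big_split/=.
  have -> : \sum_i up x i * log_density x i =
      \sum_i grad_at f x i * \sum_d inv_at G x i d * log_density x d.
    rewrite /up /raise.
    under eq_bigr do rewrite big_distrl/=.
    rewrite exchange_big/=; apply: eq_bigr => i _.
    rewrite big_distrr/=; apply: eq_bigr => d _; by rewrite hs; ring.
  by rewrite -big_split/=; apply: eq_bigr => i _; rewrite mulrDr.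
rewrite -sumrN; apply: eq_bigr => b _.
rewrite /ctr_christoffel (ctr_chr hs (fun c a b => dmetC c a b Dx)) subrK.
by rewrite -big_distrl/= -mulrN [RHS]mulrC; congr (_ * _); rewrite sumrN.
Qed.

(* Delta f = |g|^{-1/2} d_a (|g|^{1/2} g^{ab} d_b f) *)
Lemma laplacian_divergence x : D x ->
  Num.sqrt (\det (G x)) * local_laplacian G f x =
  \sum_a pderiv a (fun y => Num.sqrt (\det (G y)) * up y a) x.
Proof.
move=> Dx; set s := Num.sqrt (\det (G x)).
have s0 : 0 < s by rewrite sqrtr_gt0 lm_det_gt0.
have sE a : is_derive x (delta_mx 0 a) (fun y => Num.sqrt (\det (G y)))
    (s * log_density x a).
  pose dF : 'M[R]_n := \matrix_(i, j) dmet G x a i j.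
  have Fd i j : is_derive x (delta_mx 0 a) (fun y => G y i j) (dF i j).
    by rewrite mxE; exact: is_derive_met.
  have := is_derive_sqrt_comp (lm_det_gt0 Dx) (is_derive_det_unit (lm_unit Dx) Fd).
  move=> H; apply: is_derive_eq H _; rewrite -/s.
  rewrite /log_density (trace_chr (fun a b => inv_at_sym a b Dx)); last first.
    by move=> c ? ?; exact: dmetC.
  rewrite -[\det (G x)](sqr_sqrtr (ltW (lm_det_gt0 Dx))) -/s.
  rewrite exchange_big/=.
  have -> : \sum_j \sum_i dF i j * invmx (G x) j i =
      \sum_i \sum_b inv_at G x i b * dmet G x a i b.
    apply: eq_bigr => i _; apply: eq_bigr => j _.
    by rewrite mxE mulrC (dmetC _ _ _ Dx).
  by field; rewrite gt_eqF.
have E a : pderiv a (fun y => Num.sqrt (\det (G y)) * up y a) x =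
    s * log_density x a * up x a + s * pderiv a (fun y => up y a) x.
  by apply: pderivE; apply: is_derive_mul => //; exact: is_derive_up.
under eq_bigr do rewrite E.
rewrite big_split/= -big_distrr/= up_divergence// -local_laplacianE.
rewrite mulrBr [X in _ + (_ - X)](_ : _ = \sum_a s * log_density x a * up x a).
  by rewrite addrC subrK.
by rewrite big_distrr/=; apply: eq_bigr => a _; rewrite -mulrA [up _ _ * _]mulrC.
Qed.

End fixed_function.
End fixed_metric.
End local_geometry.

(** * Conformal change of the scalar curvature *)

Section conformal_change.
Context {R : realType} {n : nat}.
Variables (D : set 'rV[R]_n) (G G' : 'rV[R]_n -> 'M[R]_n) (w : 'rV[R]_n -> R).
Hypotheses (HG : local_C2metric D G) (wC : Ck 2 D w).
Hypothesis G'E : forall y, D y -> G' y = expR (2 * w y) *: G y.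
Let oD : open D := lm_open HG.

Let S (c a b : 'I_n) : 'rV[R]_n -> R := fun y =>
  cdiff (fun a b => G y a b) (inv_at G y) (grad_at w y) c a b.

Lemma invmx_conformal y : D y -> invmx (G' y) = expR (- (2 * w y)) *: invmx (G y).
Proof.
move=> Dy; rewrite G'E// expRN; have e0 : expR (2 * w y) != 0 by rewrite gt_eqF ?expR_gt0.
have Gu := lm_unit HG Dy.
by rewrite invmxZ// unitmxZ// unitfE.
Qed.

(** The factor [e^{2w}] of the metric cancels against the [e^{-2w}] of its inverse. Only the
    derivatives of the factor survive, and they assemble into [cdiff]. *)
Lemma christoffel_conformal c a b y : D y ->
  christoffel G' c a b y = christoffel G c a b y + S c a b y.
Proof.
move=> Dy.
have dG' i j k : pderiv i (fun z => G' z j k) y =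
    expR (2 * w y) * (2 * grad_at w y i * G y j k + dmet G y i j k).
  rewrite (@eq_open_pderiv _ _ D _ (fun z => expR (2 * w z) * G z j k))//; last first.
    by move=> z Dz; rewrite G'E// mxE.
  apply: pderivE.
  have h2 : is_derive y (delta_mx 0 i) (fun z => 2 * w z) (2 * grad_at w y i).
    have := is_derive_mul (is_derive_cst (2 : R) y (delta_mx 0 i)) (Ck_is_derive i wC Dy).
    by rewrite mul0r add0r.
  have h := is_derive_mul (is_derive_comp1 h2 (is_derive_expR _)) (is_derive_met HG i j k Dy).
  apply: is_derive_eq h _; ring.
have e0 : expR (2 * w y) != 0 by rewrite gt_eqF ?expR_gt0.
rewrite {1}/christoffel invmx_conformal//.
transitivity (2^-1 * \sum_d (inv_at G y c d * (dmet G y a b d + dmet G y b a d - dmet G y d a b)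
   + 2 * (inv_at G y c d * G y d b * grad_at w y a + inv_at G y c d * G y d a * grad_at w y b
      - inv_at G y c d * grad_at w y d * G y a b))).
  congr (_ * _); apply: eq_bigr => d _; rewrite !dG' mxE expRN /inv_at.
  rewrite [G y d b](lm_symE HG _ _ Dy) [G y d a](lm_symE HG _ _ Dy).
  have alg (e q p1 p2 p3 gb ga gab u v t : R) : e != 0 ->
      e^-1 * q * (e * (2 * u * gb + p1) + e * (2 * v * ga + p2) - e * (2 * t * gab + p3))
      = q * (p1 + p2 - p3) + 2 * (q * gb * u + q * ga * v - q * t * gab) by move=> ?; field.
  by apply: alg.
rewrite big_split/= mulrDr; congr (_ + _).
rewrite -big_distrr/= mulrA mulVf ?pnatr_eq0// mul1r sumrB big_split/=.
rewrite -!big_distrl/= !(inv_at_mul HG)// /S /cdiff /raise.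
ring.
Qed.

Let SC c a b : Ck 1 D (S c a b).
Proof.
apply: CkB => //.
  by apply: CkD => //; apply: CkZ => //; exact: Ck_grad_at.
apply: CkM => //; last exact: Ck_up.
by apply/CkW/(lm_C2 HG).
Qed.

Let dS e c a b x : D x -> pderiv e (S c a b) x =
  (c == a)%:R * pderiv e (pderiv b w) x + (c == b)%:R * pderiv e (pderiv a w) x
  - (dmet G x e a b * up G w x c + G x a b * pderiv e (fun y => up G w y c) x).
Proof.
move=> Dx; apply: pderivE.
have dg i j : is_derive x (delta_mx 0 e) (fun y => (i == j :> 'I_n)%:R * grad_at w y b)
    ((i == j)%:R * pderiv e (pderiv b w) x).
  have := is_derive_mul (is_derive_cst ((i == j)%:R : R) x (delta_mx 0 e)) (is_derive_grad_at wC e b Dx).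
  by rewrite mul0r add0r.
have dg' i j : is_derive x (delta_mx 0 e) (fun y => (i == j :> 'I_n)%:R * grad_at w y a)
    ((i == j)%:R * pderiv e (pderiv a w) x).
  have := is_derive_mul (is_derive_cst ((i == j)%:R : R) x (delta_mx 0 e)) (is_derive_grad_at wC e a Dx).
  by rewrite mul0r add0r.
exact: (is_deriveB (is_deriveD (dg c a) (dg' c b))
  (is_derive_mul (is_derive_met HG e a b Dx) (is_derive_up HG wC e c Dx))).
Qed.

(** Curvature of a connection modified by a tensor. The derivatives of [S] stay plain partial
    derivatives, so the Christoffel cross terms that a covariant derivative would absorb are
    explicit; they combine only after contraction. *)
Let SG d a b c x : D x -> riemann G' d a b c x = riemann G d a b c x +
  (pderiv a (S d b c) x - pderiv b (S d a c) x) +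
  \sum_m (S d a m x * christoffel G m b c x + christoffel G d a m x * S m b c x
    + S d a m x * S m b c x - (S d b m x * christoffel G m a c x
    + christoffel G d b m x * S m a c x + S d b m x * S m a c x)).
Proof.
move=> Dx; rewrite /riemann.
have dG' e i j k : pderiv e (christoffel G' i j k) x =
    pderiv e (christoffel G i j k) x + pderiv e (S i j k) x.
  rewrite (@eq_open_pderiv _ _ D _ (fun y => christoffel G i j k y + S i j k y))//; last first.
    by move=> y Dy; rewrite christoffel_conformal.
  apply: pderivE; apply: is_deriveD; last exact: Ck_is_derive (SC _ _ _) Dx.
  by apply: (Ck_is_derive (k := 0) _ _ Dx); exact: (Ck_christoffel HG).
rewrite !dG'; under eq_bigr do rewrite !christoffel_conformal//.
have alg (p p' q q' s t : R) : p + p' - (q + q') + t = p - q + s + (p' - q') + (t - s) by ring.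
rewrite [LHS](alg _ _ _ _ (\sum_(m < n) (christoffel G d a m x * christoffel G m b c x
                  - christoffel G d b m x * christoffel G m a c x))).
rewrite -sumrB; congr (_ + _); apply: eq_bigr => m _.
have alg2 (p p' q q' s s' t t' : R) : (p + p') * (q + q') - (s + s') * (t + t') -
  (p * q - s * t) = p' * q + p * q' + p' * q' - (s' * t + s * t' + s' * t') by ring.
exact: alg2.
Qed.

Lemma local_scalar_conformal x : D x ->
  local_scalar G' x = expR (- (2 * w x)) * (local_scalar G x
    - 2 * (n%:R - 1) * local_laplacian G w x
    - (n%:R - 1) * (n%:R - 2) * local_grad2 G w x).
Proof.
move=> Dx.
pose h := inv_at G x.
have hs a b := inv_at_sym HG a b Dx.
have gs a b := lm_symE HG a b Dx.
have hg a b := inv_at_mul HG a b Dx.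
have dgs c a b := dmetC HG c a b Dx.
pose W a := grad_at w x a; pose Gam c a b := chr h (dmet G x) c a b.
pose s c a b := S c a b x.
(* The whole contraction is expressed in four scalars: [H], the trace of the second derivatives of
   [w]; [Gw] and [gw], the pairings of [dw] with the contracted Christoffel symbols and with
   [log_density]; and [ww], which is [|dw|^2]. The density terms [gw] cancel at the end, and
   [H - Gw] is the Laplacian. *)
pose H := hess_tr G w x.
pose Gw := \sum_m W m * ctr h Gam m.
pose gw := \sum_m up G w x m * log_density G x m.
pose ww := \sum_m W m * up G w x m.
have divw : \sum_a pderiv a (fun y => up G w y a) x = H - Gw - gw.
  exact: (up_divergence HG wC Dx).
pose con (F : 'I_n -> 'I_n -> R) := \sum_b \sum_c h b c * F b c.
have conD F F' : con (fun b c => F b c + F' b c) = con F + con F'.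
  rewrite /con -big_split/=; apply: eq_bigr => b _; rewrite -big_split/=.
  by apply: eq_bigr => c _; rewrite mulrDr.
have conB F F' : con (fun b c => F b c - F' b c) = con F - con F'.
  rewrite /con -sumrB/=; apply: eq_bigr => b _; rewrite -sumrB/=.
  by apply: eq_bigr => c _; rewrite mulrBr.
have con_eq F F' : (forall b c, F b c = F' b c) -> con F = con F'.
  by move=> FF; apply: eq_bigr => b _; apply: eq_bigr => c _; rewrite FF.
have E1 : local_scalar G' x = expR (- (2 * w x)) * con (fun b c => ricci G' b c x).
  rewrite /local_scalar invmx_conformal// /con big_distrr/=.
  apply: eq_bigr => b _; rewrite big_distrr/=; apply: eq_bigr => c _.
  by rewrite mxE mulrA.
rewrite E1; congr (_ * _).
have E2 b c : ricci G' b c x = ricci G b c x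
    + (\sum_a pderiv a (S a b c) x - \sum_a pderiv b (S a a c) x)
    + ((\sum_a \sum_m s a a m * Gam m b c + \sum_a \sum_m Gam a a m * s m b c
    + \sum_a \sum_m s a a m * s m b c) - (\sum_a \sum_m s a b m * Gam m a c
    + \sum_a \sum_m Gam a b m * s m a c + \sum_a \sum_m s a b m * s m a c)).
  rewrite /ricci; under eq_bigr do rewrite SG//.
  rewrite 2!big_split/=; congr (_ + _ + _); first by rewrite sumrB.
  rewrite -!big_split/= -sumrB/=; apply: eq_bigr => a _.
    by rewrite -!big_split/= -sumrB/=; apply: eq_bigr => m _.
have E3 r A B P Q U P' Q' U' :
    con (fun b c => r b c + (A b c - B b c) +
      ((P b c + Q b c + U b c) - (P' b c + Q' b c + U' b c))) =
    con r + (con A - con B) + (con P + con Q + con U - (con P' + con Q' + con U')).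
  by rewrite !(conD, conB).
rewrite (con_eq _ _ E2) {}E3.
have T1 : con (fun b c => \sum_a pderiv a (S a b c) x) =
    2 * H - 2 * gw - n%:R * (H - Gw - gw).
  have e b c : \sum_a pderiv a (S a b c) x =
      pderiv b (pderiv c w) x + pderiv c (pderiv b w) x
      - (\sum_a dmet G x a b c * up G w x a
         + G x b c * (H - Gw - gw)).
    under eq_bigr do rewrite dS//.
    rewrite sumrB 2!big_split/=.
    rewrite [X in X + _ - _]sum_delta [X in _ + X - _]sum_delta; congr (_ - (_ + _)).
    by rewrite -divw big_distrr.
  have E4 A B P Q : con (fun b c => A b c + B b c - (P b c + Q b c)) =
      con A + con B - (con P + con Q) by rewrite conB !conD.
  rewrite (con_eq _ _ e) {}E4.
  transitivity (H + H - (2 * gw + n%:R * (H - Gw - gw))); last by ring.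
  have eq4 (p q u v p' q' u' v' : R) : p = p' -> q = q' -> u = u' -> v = v' ->
    p + q - (u + v) = p' + q' - (u' + v') by move=> -> -> -> ->.
  apply: eq4.
  - by [].
  - rewrite /con exchange_big/=; apply: eq_bigr => b _; apply: eq_bigr => c _.
    by rewrite /h hs.
  - rewrite /gw /log_density.
    under [in RHS]eq_bigr do rewrite (trace_chr hs dgs).
    rewrite big_distrr/= /con.
    transitivity (\sum_a \sum_b \sum_c h b c * (dmet G x a b c * up G w x a)).
      rewrite [RHS]exchange_big/=; apply: eq_bigr => b _.
      rewrite [RHS]exchange_big/=; apply: eq_bigr => c _; by rewrite big_distrr.
    apply: eq_bigr => a _.
    have half (u t : R) : 2 * (u * (2^-1 * t)) = t * u by field.
    rewrite half big_distrl/=.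
    apply: eq_bigr => b _; rewrite big_distrl/=; apply: eq_bigr => c _.
    by rewrite mulrA.
  - rewrite -(trace_metric gs hg) big_distrl/=; apply: eq_bigr => b _.
    by rewrite big_distrl/=; apply: eq_bigr => c _; rewrite mulrA.
have T2 : con (fun b c => \sum_a pderiv b (S a a c) x) = n%:R * H.
  have e b c : \sum_a pderiv b (S a a c) x = n%:R * pderiv b (pderiv c w) x.
    have d1 : is_derive x (delta_mx 0 b) (fun y => \sum_a S a a c y)
        (\sum_a pderiv b (S a a c) x).
      by apply: is_derive_sum_fun => a; exact: Ck_is_derive (SC _ _ _) Dx.
    rewrite -(pderivE d1).
    rewrite (@eq_open_pderiv _ _ D _ (fun y => n%:R * grad_at w y c))//; last first.
      move=> y Dy; exact: (trace_cdiff _ (fun a b => inv_at_sym HG a b Dy)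
        (fun a b => inv_at_mul HG a b Dy)).
    apply: pderivE.
    have := is_derive_mul (is_derive_cst (n%:R : R) x (delta_mx 0 b))
      (is_derive_grad_at wC b c Dx).
    by rewrite mul0r add0r.
  rewrite (con_eq _ _ e) /con big_distrr/=; apply: eq_bigr => b _.
  by rewrite big_distrr/=; apply: eq_bigr => c _; rewrite mulrCA.
have ts m : \sum_a s a a m = n%:R * W m by exact: trace_cdiff.
have cs m : ctr h s m = (2 - n%:R) * up G w x m by exact: ctr_cdiff.
have Gs m a c : Gam m a c = Gam m c a by exact: chrC.
have ss m a c : s m a c = s m c a by exact: cdiffC.
have Q1 : con (fun b c => \sum_a \sum_m s a a m * Gam m b c) = n%:R * Gw.
  rewrite [LHS]contract_trace big_distrr/=; apply: eq_bigr => m _.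
  by rewrite ts mulrA.
have Q2 : con (fun b c => \sum_a \sum_m Gam a a m * s m b c) = (2 - n%:R) * gw.
  rewrite [LHS]contract_trace big_distrr/=; apply: eq_bigr => m _.
  by rewrite cs mulrCA [_ * up _ _ _ _]mulrC.
have Q3 : con (fun b c => \sum_a \sum_m s a a m * s m b c) = n%:R * (2 - n%:R) * ww.
  rewrite [LHS]contract_trace big_distrr/=; apply: eq_bigr => m _.
  by rewrite cs ts; ring.
have Q4 : con (fun b c => \sum_a \sum_m s a b m * Gam m a c) = Gw.
  exact: contract_cdiff.
have Q5 : con (fun b c => \sum_a \sum_m Gam a b m * s m a c) = Gw.
  exact: contract_chr_cdiff.
have Q6 : con (fun b c => \sum_a \sum_m s a b m * s m a c) = (2 - n%:R) * ww.
  rewrite [LHS]contract_cdiff// big_distrr/=; apply: eq_bigr => m _.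
  by rewrite cs mulrCA.
transitivity (local_scalar G x
  + (2 * H - 2 * gw - n%:R * (H - Gw - gw) - n%:R * H)
  + (n%:R * Gw + (2 - n%:R) * gw + n%:R * (2 - n%:R) * ww
     - (Gw + Gw + (2 - n%:R) * ww))).
  have eq9 (p q u v p' q' u' v' t a1 a2 a3 a4 a5 a6 a7 a8 : R) : p = a1 -> q = a2 ->
      u = a3 -> v = a4 -> p' = a5 -> q' = a6 -> u' = a7 -> v' = a8 ->
    t + (p - q) + (u + v + p' - (q' + u' + v')) =
    t + (a1 - a2) + (a3 + a4 + a5 - (a6 + a7 + a8)) by do 8! move=> ->.
  exact: eq9 T1 T2 Q1 Q2 Q3 Q4 Q5 Q6.
rewrite local_laplacianE local_grad2E.
transitivity (local_scalar G x - 2 * (n%:R - 1) * (H - Gw) - (n%:R - 1) * (n%:R - 2) * ww) => //.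
ring.
Qed.

End conformal_change.

(** * Change of coordinates *)

Section chain_rule.
Context {R : realType} {n : nat}.
Implicit Types (f F : 'rV[R]_n -> R) (D : set 'rV[R]_n) (x y u v : 'rV[R]_n).

Lemma MVT_from0 (phi dphi : R -> R) (t : R) :
  (forall s : R, `|s| <= `|t| -> is_derive s 1 phi (dphi s)) ->
  exists2 c, `|c| <= `|t| & phi t - phi 0 = dphi c * t.
Proof.
move=> H; have [t0|t0] := leP 0 t.
  have [s||c] := @MVT_segment R phi dphi 0 t t0.
  - rewrite in_itv/= => /andP[s0 st]; apply: H.
    by rewrite !ger0_norm// ltW.
  - apply: derivable_within_continuous => s; rewrite in_itv/= => /andP[s0 st].
    by have [] : is_derive s 1 phi (dphi s) by apply: H; rewrite !ger0_norm.
  - rewrite in_itv/= subr0 => /andP[c0 ct] E; exists c => //.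
    by rewrite !ger0_norm.
have [s||c] := @MVT_segment R phi dphi t 0 (ltW t0).
- rewrite in_itv/= => /andP[ts s0]; apply: H.
  by rewrite !ler0_norm ?lerN2// ltW.
- apply: derivable_within_continuous => s; rewrite in_itv/= => /andP[ts s0].
  have [] // : is_derive s 1 phi (dphi s).
  by apply: H; rewrite !ler0_norm ?lerN2// ltW.
- rewrite in_itv/= => /andP[tc c0] E; exists c => //.
    by rewrite !ler0_norm ?lerN2// ltW.
  by rewrite -opprB E sub0r mulrN opprK.
Qed.

Lemma norm_row_ge u b : `|u 0 b| <= `|u|.
Proof.
rewrite [leRHS]/Num.Def.normr/= mx_normrE.
by apply: le_trans (le_bigmax _ _ (0, b)).
Qed.

Lemma norm_row_le u (e : R) : 0 <= e -> (forall b, `|u 0 b| <= e) -> `|u| <= e.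
Proof.
move=> e0 H; rewrite [leLHS]/Num.Def.normr/= mx_normrE.
by apply: bigmax_le => // -[i b] _ /=; rewrite ord1.
Qed.

Lemma is_derive_along f x v t d : is_derive (t *: v + x) v f d ->
  is_derive t 1 (fun s : R => f (s *: v + x)) d.
Proof.
move=> /is_derive_line fd.
have := @is_derive1_comp R (fun h : R => f (h *: v + (t *: v + x))) (fun s => s - t) t d 1.
rewrite mulr1 subrr => H.
have {H} := H fd.
have h : is_derive t 1 (fun s : R => s - t) 1.
  by have := is_deriveB (is_derive_id t (1 : R)) (is_derive_cst (t : R) t (1 : R)); rewrite subr0.
move=> /(_ h); congr (is_derive _ _ _ _); apply/funext => s /=.
by rewrite addrA -scalerDl subrK.
Qed.

Lemma near0_norm_lt (e : R) : 0 < e -> \forall u \near (0 : 'rV[R]_n), `|u| < e.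
Proof.
move=> e0; apply/nbhs_ballP; exists e => // u.
by rewrite -ball_normE/= sub0r normrN.
Qed.

(** The corners of a staircase path from 0 to [u], along which one coordinate changes at a time. *)
Definition row_take (k : nat) u : 'rV[R]_n := \row_b (if (b < k)%N then u 0 b else 0).

Lemma row_takeS (k : 'I_n) u : row_take k.+1 u = u 0 k *: delta_mx 0 k + row_take k u.
Proof.
apply/rowP => b; rewrite !mxE eqxx/= ltnS leq_eqVlt.
have -> : (b == k :> nat) = (b == k) by [].
by case: eqP => [->|_] /=; rewrite ?ltnn ?addr0 ?mulr1// mulr0 add0r.
Qed.

(* Hadamard-type expansion: the slopes are partial derivatives at intermediate
   points provided by the mean value theorem. *)
Lemma C1_slopes D F y : open D -> Ck 1 D F -> D y ->
  exists A : 'I_n -> 'rV[R]_n -> R,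
    (forall b, A b u @[u --> (0 : 'rV[R]_n)] --> pderiv b F y) /\
    (\forall u \near (0 : 'rV[R]_n), F (u + y) - F y = \sum_b A b u * u 0 b).
Proof.
move=> oD FC Dy.
have [r /= r0 rD] : exists2 r : R, 0 < r & forall z, `|z - y| < r -> D z.
  have /nbhs_ballP[r /= r0 rD] : nbhs y D by exact: open_nbhs_nbhs.
  exists r => // z zr; apply: rD; by rewrite -ball_normE/= distrC.
have /choice[z zP] : forall ku : 'I_n * 'rV[R]_n, exists z, `|ku.2| < r ->
    `|z - y| <= `|ku.2| /\ F (row_take ku.1.+1 ku.2 + y) - F (row_take ku.1 ku.2 + y) =
      pderiv ku.1 F z * ku.2 0 ku.1.
  move=> [k u] /=; have [ur|ur] := ltP `|u| r; last by exists y.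
  pose p s := s *: delta_mx 0 k + (row_take k u + y).
  (* The norm of row vectors is the maximum norm, so dropping or shrinking coordinates of [u] does
     not leave the ball on which [F] is controlled. *)
  have pn s : `|s| <= `|u 0 k| -> `|p s - y| <= `|u|.
    move=> su; rewrite /p addrA addrK; apply: norm_row_le => // b.
    rewrite !mxE eqxx/=; case: eqP => [->|_].
      by rewrite ltnn mulr1 addr0 (le_trans su)// norm_row_ge.
    by rewrite mulr0 add0r; case: ifP => _; rewrite ?normr0// norm_row_ge.
  have [s su|c cu E] := @MVT_from0 (fun s => F (p s)) (fun s => pderiv k F (p s)) (u 0 k).
    apply: is_derive_along; apply: Ck_is_derive FC _.
    by apply: rD; rewrite (le_lt_trans (pn _ su)).
  exists (p c) => _; split; first exact: pn.
  by rewrite -E /p scale0r add0r row_takeS -addrA.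
exists (fun b u => pderiv b F (z (b, u))); split.
  move=> b; apply: (@cvg_comp _ _ _ (fun u => z (b, u)) (pderiv b F) _ (nbhs y)).
    apply/(@cvgrPdist_le _ _ _ (nbhs (0 : 'rV[R]_n))) => e e0.
    apply: filterS2 (near0_norm_lt r0) (near0_norm_lt e0) => u ur ue.
    have [//|zy _] := zP (b, u).
    by rewrite distrC (le_trans zy)//= ltW.
  by apply: Ck_continuous (Ck_pderiv b FC) Dy.
apply: filterS (near0_norm_lt r0) => u ur.
have -> : F (u + y) - F y = F (row_take n u + y) - F (row_take 0 u + y).
  have -> : row_take n u = u by apply/rowP => b; rewrite mxE ltn_ord.
  have -> : row_take 0 u = 0 by apply/rowP => b; rewrite !mxE.
  by rewrite add0r.
rewrite -(telescope_sumr (fun k => F (row_take k u + y)) (leq0n n)) big_mkord.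
by apply: eq_bigr => k _; have [] := zP (k, u) ur.
Qed.

Lemma is_derive_cvg (m : nat) (f : 'rV[R]_m -> R) (x v : 'rV[R]_m) d :
  is_derive x v f d <->
  (h^-1 * (f (h *: v + x) - f x)) @[h --> (0 : R)^'] --> d.
Proof.
split=> [[fd <-]|H]; first exact: fd.
apply: DeriveDef; first by apply/cvg_ex; exists d.
by apply: cvg_lim => //; exact: Rhausdorff.
Qed.

(** With the slopes [A] of [C1_slopes], the difference quotient of the composite is, near 0, exactly
    the sum of [A b] times the difference quotients of the components of [T]. The slopes tend to the
    partial derivatives because the increment of [T] tends to 0. *)
Lemma is_derive_chain D F (m : nat) (T : 'rV[R]_m -> 'rV[R]_n) (x v : 'rV[R]_m) (d : 'I_n -> R) :
  open D -> Ck 1 D F -> D (T x) ->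
  (forall b, is_derive x v (fun z => T z 0 b) (d b)) ->
  is_derive x v (fun z => F (T z)) (\sum_b pderiv b F (T x) * d b).
Proof.
move=> oD FC Dx Td.
have [A [Acvg AE]] := C1_slopes oD FC Dx.
pose u h := T (h *: v + x) - T x.
have qcvg b : h^-1 * u h 0 b @[h --> (0 : R)^'] --> d b.
  have /is_derive_cvg := Td b; apply: cvg_trans.
  by apply: near_eq_cvg; near=> h; rewrite !mxE.
have ub b : u h 0 b @[h --> (0 : R)^'] --> (0 : R).
  have : h * (h^-1 * u h 0 b) @[h --> (0 : R)^'] --> 0 * d b.
    apply: cvgM (qcvg b); exact: cvg_within.
  rewrite mul0r; apply: cvg_trans; apply: near_eq_cvg; near=> h.
  by rewrite mulrA divff ?mul1r//; near: h; exact: nbhs_dnbhs_neq.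
have ucvg : u h @[h --> (0 : R)^'] --> (0 : 'rV[R]_n).
  apply/cvgrPdist_le => e e0.
  have : \forall h \near (0 : R)^', forall b, `|u h 0 b| <= e.
    apply: filter_forall => b; have /cvgrPdist_le/(_ _ e0) := ub b.
    by apply: filterS => h; rewrite sub0r normrN.
  apply: filterS => h H; rewrite sub0r normrN; apply: norm_row_le => //.
  exact: ltW.
apply/is_derive_cvg.
have : \sum_b A b (u h) * (h^-1 * u h 0 b) @[h --> (0 : R)^'] -->
    \sum_b pderiv b F (T x) * d b.
  apply: cvg_big => [|b _]; first exact: add_continuous.
  apply: cvgM (qcvg b).
  exact: (@cvg_comp _ _ _ u (A b) _ (nbhs (0 : 'rV[R]_n)) _ ucvg (Acvg b)).
apply: cvg_trans; apply: near_eq_cvg.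
move: (ucvg _ AE); rewrite nbhs_filterE => AEh.
have : \forall h \near (0 : R)^', F (u h + T x) - F (T x) = \sum_b A b (u h) * u h 0 b.
  exact: AEh.
apply: filterS => h; rewrite {1}/u subrK => ->.
by rewrite big_distrr/=; apply: eq_bigr => b _; rewrite mulrCA.
Unshelve. all: by end_near. Qed.

Lemma normB_le_half (p q s t e : R) : `|p - s| <= e / 2 -> `|q - t| <= e / 2 ->
  s = t -> `|p - q| <= e.
Proof.
move=> ps qt st; rewrite -(subrKA s) (le_trans (ler_normD _ _))// [e]splitr.
by rewrite lerD// distrC st.
Qed.

(** The second difference [Delta] is symmetric in the two directions. Two applications of the mean
    value theorem, in either order, turn it into [h ^+ 2] times a mixed partial derivative at a
    point near [x], and continuity of both mixed derivatives concludes. *)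
Lemma Schwarz D f x a b : open D -> Ck 2 D f -> D x ->
  pderiv a (pderiv b f) x = pderiv b (pderiv a f) x.
Proof.
move=> oD fC Dx.
have [r /= r0 rD] : exists2 r : R, 0 < r & forall z, `|z - x| < r -> D z.
  have /nbhs_ballP[r /= r0 rD] : nbhs x D by exact: open_nbhs_nbhs.
  exists r => // z zr; apply: rD; by rewrite -ball_normE/= distrC.
have dn (c : 'I_n) (t : R) : `|t *: delta_mx 0 c : 'rV[R]_n| <= `|t|.
  apply: norm_row_le => // k; rewrite !mxE eqxx/=; case: eqP => _.
    by rewrite mulr1.
  by rewrite mulr0 normr0.
have dn2 (c e : 'I_n) (t s h : R) : `|t| <= `|h| -> `|s| <= `|h| ->
    `|t *: delta_mx 0 c + (s *: delta_mx 0 e + x) - x| <= 2 * `|h|.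
  move=> th sh; rewrite addrA addrK (le_trans (ler_normD _ _))// mulr2n mulrDl mul1r.
  by rewrite lerD// (le_trans (dn _ _)).
pose Delta (c e : 'I_n) (h : R) := f (h *: delta_mx 0 c + (h *: delta_mx 0 e + x))
  - f (h *: delta_mx 0 c + x) - f (h *: delta_mx 0 e + x) + f x.
have key c e h : 2 * `|h| < r ->
    exists2 z, `|z - x| <= 2 * `|h| & Delta c e h = h ^+ 2 * pderiv e (pderiv c f) z.
  move=> hr.
  have [t th|t th E1] := @MVT_from0
    (fun t => f (t *: delta_mx 0 c + (h *: delta_mx 0 e + x)) - f (t *: delta_mx 0 c + x))
    (fun t => pderiv c f (t *: delta_mx 0 c + (h *: delta_mx 0 e + x))
      - pderiv c f (t *: delta_mx 0 c + x)) h.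
    apply: is_deriveB; apply: is_derive_along; apply: Ck_is_derive fC _; apply: rD.
      by rewrite (le_lt_trans (dn2 _ _ _ _ _ th _)).
    rewrite addrK (le_lt_trans (dn _ _))// (le_lt_trans th)// (le_lt_trans _ hr)//.
    by rewrite ler_peMl// ler1n.
  have [s sh|s sh E2] := @MVT_from0
    (fun s => pderiv c f (s *: delta_mx 0 e + (t *: delta_mx 0 c + x)))
    (fun s => pderiv e (pderiv c f) (s *: delta_mx 0 e + (t *: delta_mx 0 c + x))) h.
    apply: is_derive_along; apply: Ck_is_derive (Ck_pderiv c fC) _; apply: rD.
    by rewrite (le_lt_trans (dn2 _ _ _ _ _ sh th)).
  exists (s *: delta_mx 0 e + (t *: delta_mx 0 c + x)); first exact: dn2.
  move: E1 E2; rewrite !scale0r !add0r [h *: _ + (t *: _ + _)]addrCA => E1 E2.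
  rewrite expr2 -mulrA [h * pderiv _ _ _]mulrC -E2 mulrC -E1 /Delta; ring.
apply/eqP; rewrite -subr_eq0 -normr_le0; apply/ler_addgt0Pr => eps eps0; rewrite add0r.
have near_x (g : 'rV[R]_n -> R) : {for x, continuous g} ->
    exists2 d : R, 0 < d & forall z, `|z - x| < d -> `|g x - g z| <= eps / 2.
  move=> /cvgrPdist_le/(_ (eps / 2)); rewrite divr_gt0// => /(_ isT).
  move=> /nbhs_ballP[d /= d0 H]; exists d => // z zd; apply: H.
  by rewrite -ball_normE/= distrC.
have [d1 d10 H1] := near_x _ (Ck_continuous (Ck_pderiv a (Ck_pderiv b fC)) Dx).
have [d2 d20 H2] := near_x _ (Ck_continuous (Ck_pderiv b (Ck_pderiv a fC)) Dx).
pose h := Num.min r (Num.min d1 d2) / 3.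
have m0 : 0 < Num.min r (Num.min d1 d2) by rewrite !lt_min r0 d10.
have h0 : 0 < h by rewrite divr_gt0.
have hm : 2 * `|h| < Num.min r (Num.min d1 d2).
  by rewrite gtr0_norm// /h; lra.
move: (hm); rewrite !lt_min => /and3P[hr hd1 hd2].
have [z zx Ez] := key b a h hr; have [z' zx' Ez'] := key a b h hr.
have Dsym : Delta b a h = Delta a b h.
  rewrite /Delta [h *: delta_mx 0 b + (h *: delta_mx 0 a + x)]addrCA; ring.
have E : pderiv a (pderiv b f) z = pderiv b (pderiv a f) z'.
  have h2 : h ^+ 2 != 0 by rewrite expf_neq0// gt_eqF.
  exact: (mulfI h2 (etrans (esym Ez) (etrans Dsym Ez'))).
exact: normB_le_half (H1 z (le_lt_trans zx hd1)) (H2 z' (le_lt_trans zx' hd2)) E.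
Qed.

End chain_rule.

(** * Transformation law of the Laplacian and of the gradient *)

Section tensor_pullback.
Context {R : realType} {n : nat}.
Variables (h J : 'I_n -> 'I_n -> R).

Definition pushed (al be : 'I_n) : R := \sum_a \sum_b h a b * (J a al * J b be).

Definition pull3 (M : 'I_n -> 'I_n -> 'I_n -> R) (a b d : 'I_n) : R :=
  \sum_al \sum_be \sum_de J a al * J b be * J d de * M al be de.

(** The inverse metric with only its first index moved to the other chart. Moving the second one as
    well gives [pushed]. *)
Definition semi_raise (c d : 'I_n) : R := \sum_a J a c * h a d.

Lemma semi_raiseE c de : \sum_d semi_raise c d * J d de = pushed c de.
Proof.
rewrite /semi_raise /pushed.
under eq_bigr => d _ do rewrite big_distrl/=.
rewrite exchange_big/=; apply: eq_bigr => a _; apply: eq_bigr => d _; ring.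
Qed.

Lemma contract_pull2 (N : 'I_n -> 'I_n -> R) :
  \sum_a \sum_b h a b * (\sum_al \sum_be J a al * J b be * N al be) =
  \sum_al \sum_be pushed al be * N al be.
Proof.
transitivity (\sum_a \sum_b \sum_al \sum_be h a b * (J a al * J b be) * N al be).
  apply: eq_bigr => a _; apply: eq_bigr => b _.
  rewrite big_distrr/=; apply: eq_bigr => al _.
  rewrite big_distrr/=; apply: eq_bigr => be _; by rewrite !mulrA.
under eq_bigr => a _ do rewrite exchange_big/=.
rewrite exchange_big/=; apply: eq_bigr => al _.
under eq_bigr => a _ do rewrite exchange_big/=.
rewrite exchange_big/=; apply: eq_bigr => be _.
rewrite /pushed big_distrl/=; apply: eq_bigr => a _; by rewrite big_distrl.
Qed.

Lemma raise_pull3 M c a b : \sum_d semi_raise c d * pull3 M a b d =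
  \sum_al \sum_be J a al * J b be * (\sum_de pushed c de * M al be de).
Proof.
transitivity (\sum_d \sum_al \sum_be \sum_de
    J a al * J b be * (semi_raise c d * J d de * M al be de)).
  apply: eq_bigr => d _; rewrite /pull3.
  rewrite big_distrr/=; apply: eq_bigr => al _.
  rewrite big_distrr/=; apply: eq_bigr => be _.
  rewrite big_distrr/=; apply: eq_bigr => de _; ring.
rewrite exchange_big/=; apply: eq_bigr => al _.
rewrite exchange_big/=; apply: eq_bigr => be _.
rewrite exchange_big/= big_distrr/=; apply: eq_bigr => de _.
rewrite -big_distrr/= -semi_raiseE; congr (_ * _).
by rewrite big_distrl.
Qed.

Lemma contract_pull3 M c :
  \sum_a \sum_b h a b * (\sum_d semi_raise c d * pull3 M a b d) =
  \sum_al \sum_be pushed al be * (\sum_de pushed c de * M al be de).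
Proof.
rewrite -contract_pull2; apply: eq_bigr => a _; apply: eq_bigr => b _.
by rewrite raise_pull3.
Qed.

End tensor_pullback.

Section christoffel_change.
Context {R : realType} {n : nat}.
(* [h], [dg] belong to the metric [J g' J^T], [g'], [dg'] to the metric in the
   other chart, and [K a b be] is the second derivative of the transition. *)
Variables (h J : 'I_n -> 'I_n -> R) (dg : 'I_n -> 'I_n -> 'I_n -> R).
Variables (g' h' : 'I_n -> 'I_n -> R) (dg' K : 'I_n -> 'I_n -> 'I_n -> R).
Hypothesis h'E : forall al be, h' al be = pushed h J al be.
Hypothesis hg' : forall a c, \sum_b h' a b * g' b c = (a == c)%:R.
Hypothesis g'C : forall a b, g' a b = g' b a.
Hypothesis KC : forall a b be, K a b be = K b a be.
Hypothesis dgE : forall a b d, dg a b d =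
  \sum_be \sum_de (K a b be * g' be de * J d de + J b be * g' be de * K a d de)
  + pull3 J (fun al be de => dg' al be de) a b d.

Let KH a b d : R := \sum_be \sum_de K a b be * g' be de * J d de.

Let dgE' a b d : dg a b d = KH a b d + KH a d b + pull3 J dg' a b d.
Proof.
rewrite dgE; congr (_ + _); rewrite /KH [X in _ = _ + X]exchange_big/= -big_split/=.
apply: eq_bigr => be _; rewrite -big_split/=; apply: eq_bigr => de _.
by rewrite (g'C de be); ring.
Qed.

(** Six second-derivative terms [KH] occur on the left. By symmetry of [K] in its first two indices,
    four of them cancel in pairs and the other two coincide. *)
Let low a b d : dg a b d + dg b a d - dg d a b = 2 * KH a b d +
  pull3 J (fun al be de => dg' al be de + dg' be al de - dg' de al be) a b d.
Proof.
have KHC p q r : KH p q r = KH q p r.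
  by apply: eq_bigr => be _; apply: eq_bigr => de _; rewrite KC.
have E : pull3 J (fun al be de => dg' al be de + dg' be al de - dg' de al be) a b d =
   pull3 J dg' a b d + pull3 J dg' b a d - pull3 J dg' d a b.
  have -> : pull3 J dg' b a d = pull3 J (fun al be de => dg' be al de) a b d.
    rewrite /pull3 exchange_big/=; apply: eq_bigr => al _; apply: eq_bigr => be _.
    by apply: eq_bigr => de _; rewrite [J b be * _]mulrC.
  have -> : pull3 J dg' d a b = pull3 J (fun al be de => dg' de al be) a b d.
    rewrite /pull3 exchange_big/=; apply: eq_bigr => al _.
    rewrite exchange_big/=; apply: eq_bigr => be _.
    by apply: eq_bigr => de _; ring.
  rewrite /pull3 -big_split -sumrB/=; apply: eq_bigr => al _.
  rewrite -big_split -sumrB/=; apply: eq_bigr => be _.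
  rewrite -big_split -sumrB/=; apply: eq_bigr => de _; ring.
rewrite E !dgE' (KHC b a d) (KHC d a b) (KHC d b a); ring.
Qed.

(** The inhomogeneous term on the right is the one that the chain rule also produces in the trace of
    the second derivatives of a composite. The law is stated for the contracted symbols because the
    Laplacian contains the Christoffel symbols only in this form. *)
Lemma ctr_chr_change c :
  \sum_e J e c * ctr h (chr h dg) e =
  ctr h' (chr h' dg') c + \sum_a \sum_b h a b * K a b c.
Proof.
have -> : \sum_e J e c * ctr h (chr h dg) e = 2^-1 *
    \sum_a \sum_b h a b * (\sum_d semi_raise h J c d * (dg a b d + dg b a d - dg d a b)).
  rewrite /ctr.
  transitivity (\sum_a \sum_b h a b * (\sum_e J e c * chr h dg e a b)).
    under eq_bigr => e _ do rewrite big_distrr/=.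
    rewrite exchange_big/=; apply: eq_bigr => a _.
    under eq_bigr => e _ do rewrite big_distrr/=.
    rewrite exchange_big/=; apply: eq_bigr => b _.
    by rewrite big_distrr/=; apply: eq_bigr => e _; rewrite mulrCA.
  rewrite big_distrr/=; apply: eq_bigr => a _.
  rewrite big_distrr/=; apply: eq_bigr => b _.
  rewrite mulrCA; congr (_ * _); rewrite /chr /semi_raise.
  transitivity (\sum_d \sum_e 2^-1 * (J e c * h e d * (dg a b d + dg b a d - dg d a b))).
    rewrite exchange_big/=; apply: eq_bigr => e _.
    rewrite mulrCA !big_distrr/=; apply: eq_bigr => d _; by rewrite !mulrA.
  rewrite big_distrr/=; apply: eq_bigr => d _.
  by rewrite big_distrl big_distrr.
(* Raising with the inverse metric undoes the lowering by [g'] in [KH]. *)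
have KE a b : \sum_d semi_raise h J c d * KH a b d = K a b c.
  transitivity (\sum_be K a b be * \sum_de h' c de * g' de be).
    transitivity (\sum_be \sum_de K a b be * (g' be de * \sum_d semi_raise h J c d * J d de)).
      rewrite /KH; under eq_bigr => d _ do rewrite big_distrr/=.
      rewrite exchange_big/=; apply: eq_bigr => be _.
      under eq_bigr => d _ do rewrite big_distrr/=.
      rewrite exchange_big/=; apply: eq_bigr => de _.
      rewrite !big_distrr/=; apply: eq_bigr => d _; ring.
    apply: eq_bigr => be _; rewrite big_distrr/=; apply: eq_bigr => de _.
    by rewrite semi_raiseE -h'E g'C; congr (_ * _); rewrite mulrC.
  under eq_bigr => be _ do rewrite hg' mulrC.
  by rewrite sum_delta'.
under eq_bigr => a _ do under eq_bigr => b _ do (under eq_bigr => d _ do rewrite low mulrDr).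
transitivity (2^-1 * (\sum_a \sum_b h a b * (2 * K a b c) +
   \sum_a \sum_b h a b * (\sum_d semi_raise h J c d *
     pull3 J (fun al be de => dg' al be de + dg' be al de - dg' de al be) a b d))).
  congr (_ * _); rewrite -big_split/=; apply: eq_bigr => a _.
  rewrite -big_split/=; apply: eq_bigr => b _; rewrite -mulrDr; congr (_ * _).
  rewrite big_split/=; congr (_ + _); rewrite -KE big_distrr/=.
  by apply: eq_bigr => d _; rewrite mulrCA.
rewrite contract_pull3 mulrDr addrC; congr (_ + _).
  rewrite /ctr big_distrr/=; apply: eq_bigr => a _.
  rewrite big_distrr/=; apply: eq_bigr => b _; rewrite mulrCA -h'E; congr (_ * _).
  rewrite /chr; congr (_ * _); apply: eq_bigr => d _; by rewrite -h'E.
rewrite big_distrr/=; apply: eq_bigr => a _.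
rewrite big_distrr/=; apply: eq_bigr => b _; by field.
Qed.

End christoffel_change.

Section laplacian_change.
Context {R : realType} {n : nat}.
Variables (D E : set 'rV[R]_n) (G H : 'rV[R]_n -> 'M[R]_n).
Variables (T : 'rV[R]_n -> 'rV[R]_n) (f F : 'rV[R]_n -> R).
Hypotheses (HG : local_C2metric D G) (HH : local_C2metric E H).
Hypothesis TC : forall b, Ck 2 D (fun x => T x 0 b).
Hypothesis DE : forall x, D x -> E (T x).
Hypotheses (FC : Ck 2 E F) (fE : forall x, D x -> f x = F (T x)).

Let J x : 'M[R]_n := \matrix_(a, b) pderiv a (fun y => T y 0 b) x.

Hypothesis GE : forall x, D x -> G x = J x *m H (T x) *m (J x)^T.

Let oD : open D := lm_open HG.
Let oE : open E := lm_open HH.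

Let dT x a b : D x -> is_derive x (delta_mx 0 a) (fun y => T y 0 b) (J x a b).
Proof. by move=> Dx; rewrite mxE; exact: Ck_is_derive (TC b) Dx. Qed.

Let K x a b be : R := pderiv a (fun y => J y b be) x.

Let JE b be : (fun y => J y b be) = pderiv b (fun y => T y 0 be).
Proof. by apply/funext => y; rewrite mxE. Qed.

Let dJ x a b be : D x -> is_derive x (delta_mx 0 a) (fun y => J y b be) (K x a b be).
Proof.
move=> Dx; rewrite /K JE; apply: (Ck_is_derive (k := 0) a _ Dx).
exact: Ck_pderiv.
Qed.

Let KC x a b be : D x -> K x a b be = K x b a be.
Proof. by move=> Dx; rewrite /K !JE; exact: (Schwarz _ _ oD (TC be) Dx). Qed.

Let chain F' x a : Ck 1 E F' -> D x ->
  is_derive x (delta_mx 0 a) (fun y => F' (T y)) (\sum_b pderiv b F' (T x) * J x a b).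
Proof.
move=> F'C Dx; apply: (is_derive_chain oE F'C (DE Dx)) => b; exact: dT.
Qed.

Let invE x al be : D x -> inv_at H (T x) al be = pushed (inv_at G x) (fun a b => J x a b) al be.
Proof.
move=> Dx; have Gu := lm_unit HG Dx; have Hu := lm_unit HH (DE Dx).
(* The Jacobian is invertible because the determinant of [G x], which is nonzero, factors through
   that of [J x]. *)
have : J x \in unitmx /\ (J x)^T \in unitmx.
  move: Gu; rewrite GE// !unitmxE !det_mulmx det_tr !unitrM.
  by move=> /andP[/andP[-> _] _].
move=> [Ju JTu].
have -> : inv_at H (T x) al be = ((J x)^T *m invmx (G x) *m J x) al be.
  congr (fun_of_matrix _ _ _); set X := _ *m J x.
  have XH : X *m H (T x) = 1%:M.
    rewrite -[LHS]mulmx1 -(mulmxV JTu) mulmxA; congr (_ *m _).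
    by rewrite /X -!mulmxA [J x *m (H _ *m _)]mulmxA -GE// mulVmx// mulmx1.
  by rewrite -[RHS]mulmx1 -(mulmxV Hu) mulmxA XH mul1mx.
rewrite mxE /pushed exchange_big/=; apply: eq_bigr => b _.
rewrite mxE big_distrl/=; apply: eq_bigr => a _; rewrite mxE /inv_at; ring.
Qed.

Let f1 x b : D x -> pderiv b f x = \sum_be pderiv be F (T x) * J x b be.
Proof.
move=> Dx; rewrite (eq_open_pderiv b oD fE Dx); apply: pderivE.
by apply: chain => //; exact: CkW.
Qed.

Let f2 x a b : D x -> pderiv a (pderiv b f) x =
  \sum_be ((\sum_al pderiv al (pderiv be F) (T x) * J x a al) * J x b be
    + pderiv be F (T x) * K x a b be).
Proof.
move=> Dx; rewrite (eq_open_pderiv a oD (fun y => @f1 y b) Dx); apply: pderivE.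
apply: is_derive_sum_fun => be; apply: is_derive_mul; last exact: dJ.
by apply: chain => //; exact: Ck_pderiv.
Qed.

Let dGE x a b d : D x -> dmet G x a b d =
  \sum_be \sum_de (K x a b be * H (T x) be de * J x d de
     + J x b be * H (T x) be de * K x a d de)
  + pull3 (fun a b => J x a b) (fun al be de => dmet H (T x) al be de) a b d.
Proof.
move=> Dx; rewrite /dmet.
have Gbd y : D y -> G y b d = \sum_be \sum_de J y b be * H (T y) be de * J y d de.
  move=> Dy; rewrite GE// mxE exchange_big/=; apply: eq_bigr => de _.
  rewrite mxE big_distrl/=; apply: eq_bigr => be _; by rewrite [(J y)^T _ _]mxE.
rewrite (eq_open_pderiv a oD Gbd Dx).
have h : is_derive x (delta_mx 0 a)
   (fun y => \sum_be \sum_de J y b be * H (T y) be de * J y d de)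
   (\sum_be \sum_de ((K x a b be * H (T x) be de
      + J x b be * \sum_al pderiv al (fun z => H z be de) (T x) * J x a al) * J x d de
      + J x b be * H (T x) be de * K x a d de)).
  apply: is_derive_sum_fun => be; apply: is_derive_sum_fun => de.
  apply: is_derive_mul; last exact: dJ.
  apply: is_derive_mul; first exact: dJ.
  by apply: chain => //; exact: CkW (lm_C2 HH be de).
rewrite (pderivE h) /pull3 [X in _ + X]exchange_big/= -big_split/=.
apply: eq_bigr => be _; rewrite [X in _ + X]exchange_big/= -big_split/=.
apply: eq_bigr => de _; rewrite mulrDl addrAC; congr (_ + _ + _).
rewrite big_distrr big_distrl/=; apply: eq_bigr => al _; ring.
Qed.

(** Second derivatives of the transition map enter twice: through the chain rule in [H1], and
    through the Christoffel symbols in [ch]. The two contributions are equal, and the Laplacian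
    subtracts one from the other. *)
Lemma local_laplacian_change x : D x ->
  local_laplacian G f x = local_laplacian H F (T x).
Proof.
move=> Dx; rewrite !local_laplacianE.
pose h := inv_at G x; pose j a b := J x a b.
have ch c : \sum_e j e c * ctr_christoffel G x e =
    ctr_christoffel H (T x) c + \sum_a \sum_b h a b * K x a b c.
  apply: (@ctr_chr_change _ _ h j (dmet G x) (fun a b => H (T x) a b)).
  - by move=> al be; exact: invE.
  - by move=> a c'; exact: (inv_at_mul HH _ _ (DE Dx)).
  - by move=> a b; exact: (lm_symE HH _ _ (DE Dx)).
  - by move=> a b be; exact: KC.
  - by move=> a b d; exact: dGE.
have H1 : hess_tr G f x = hess_tr H F (T x) +
    \sum_be pderiv be F (T x) * \sum_a \sum_b h a b * K x a b be.
  transitivity (\sum_a \sum_b h a b * (\sum_al \sum_be j a al * j b be * pderiv al (pderiv be F) (T x))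
     + \sum_a \sum_b h a b * (\sum_be pderiv be F (T x) * K x a b be)).
    rewrite -big_split/=; apply: eq_bigr => a _.
    rewrite -big_split/=; apply: eq_bigr => b _; rewrite f2// -mulrDr; congr (_ * _).
    rewrite big_split/=; congr (_ + _); rewrite exchange_big/=; apply: eq_bigr => be _.
    by rewrite big_distrl/=; apply: eq_bigr => al _; rewrite /j; ring.
  rewrite contract_pull2; congr (_ + _).
    by apply: eq_bigr => al _; apply: eq_bigr => be _; rewrite invE.
  transitivity (\sum_a \sum_b \sum_be pderiv be F (T x) * (h a b * K x a b be)).
    apply: eq_bigr => a _; apply: eq_bigr => b _.
    by rewrite big_distrr/=; apply: eq_bigr => be _; rewrite mulrCA.
  under eq_bigr => a _ do rewrite exchange_big/=.
  rewrite exchange_big/=; apply: eq_bigr => be _.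
  by rewrite big_distrr/=; apply: eq_bigr => a _; rewrite big_distrr.
have H2 : \sum_m grad_at f x m * ctr_christoffel G x m =
    \sum_be pderiv be F (T x) * \sum_e j e be * ctr_christoffel G x e.
  transitivity (\sum_m \sum_be pderiv be F (T x) * (j m be * ctr_christoffel G x m)).
    apply: eq_bigr => m _; rewrite /grad_at f1// big_distrl/=.
    by apply: eq_bigr => be _; rewrite mulrA.
  by rewrite exchange_big/=; apply: eq_bigr => be _; rewrite big_distrr.
rewrite H1 H2.
under [X in _ - X]eq_bigr => be _ do rewrite ch mulrDr.
rewrite big_split/= opprD addrACA; rewrite subrr addr0 //.
Qed.

Lemma local_grad2_change x : D x -> local_grad2 G f x = local_grad2 H F (T x).
Proof.
move=> Dx; pose h := inv_at G x; pose j a b := J x a b.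
transitivity (\sum_a \sum_b h a b *
    (\sum_al \sum_be j a al * j b be * (pderiv al F (T x) * pderiv be F (T x)))).
  apply: eq_bigr => a _; apply: eq_bigr => b _; congr (_ * _); rewrite !f1//.
  rewrite big_distrl/=; apply: eq_bigr => al _.
  rewrite big_distrr/=; apply: eq_bigr => be _; rewrite /j; ring.
rewrite contract_pull2; apply: eq_bigr => al _; apply: eq_bigr => be _.
by rewrite -(invE al be Dx).
Qed.

End laplacian_change.

(** * Integration in charts *)

Section integral_density.
Local Open Scope ereal_scope.
Context d1 d2 (X : measurableType d1) (Y : measurableType d2) (R : realType).
Variables (mu : {measure set X -> \bar R}) (lam : {measure set Y -> \bar R}).
Variables (phi : Y -> X) (S : set Y) (B : set X) (rho : Y -> R).
Hypotheses (mS : measurable S) (mB : measurable B) (mphi : measurable_fun S phi).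
Hypotheses (mrho : measurable_fun S rho) (rho0 : forall t, S t -> (0 <= rho t)%R).
Hypothesis phiB : forall t, S t -> B (phi t).
Hypothesis muE : forall C, measurable C -> C `<=` B ->
  mu C = \int[lam]_(t in S `&` phi @^-1` C) (rho t)%:E.

Import HBNNSimple.

Let integral_density_nnsfun (h : {nnsfun X >-> R}) :
  \int[mu]_(p in B) (h p)%:E = \int[lam]_(t in S) ((h (phi t))%:E * (rho t)%:E).
Proof.
pose Z y := B `&` h @^-1` [set y].
have mZ y : measurable (Z y).
  by apply: measurableI => //; exact: measurable_sfunP.
have mZ' y : measurable (S `&` phi @^-1` Z y) by exact: mphi.
have E1 : \int[mu]_(p in B) (h p)%:E = \sum_(y \in range h) y%:E * mu (Z y).
  transitivity (\int[mu]_(p in B) (\sum_(y \in range h) (y * \1_(h @^-1` [set y]) p)%:E)).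
    by apply: eq_integral => t tE; rewrite fimfunE -fsumEFin.
  rewrite ge0_integral_fsum//; last 2 first.
    - move=> y; apply/measurable_EFinP; apply: measurable_funM => //.
    - by move=> m y Ey; exact: nnfun_muleindic_ge0.
  apply: eq_fsbigr => y /[!inE] -[p _ <-].
  under eq_integral do rewrite EFinM.
  rewrite ge0_integralZl//; last 2 first.
    - apply/measurable_EFinP; apply: measurable_indic; exact: measurable_sfunP.
    - by rewrite lee_fin.
  by rewrite integral_indic// setIC.
rewrite E1.
have E2 t : S t -> (h (phi t))%:E * (rho t)%:E =
    \sum_(y \in range h) (y%:E * ((\1_(S `&` phi @^-1` Z y) t)%:E * (rho t)%:E)).
  move=> St; rewrite -EFinM [in LHS]fimfunE.
  transitivity (\sum_(y \in range h)
      ((y * (\1_(S `&` phi @^-1` Z y) t * rho t))%R)%:E); last first.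
    by apply: eq_fsbigr => y _; rewrite !EFinM.
  rewrite fsumEFin//; congr (_%:E).
  rewrite mulr_fsuml//; apply: eq_fsbigr => y _.
  rewrite mulrA; congr (_ * _ * _)%R; rewrite !indicE; congr (_%:R).
  congr nat_of_bool.
  by apply/idP/idP; rewrite !inE/=; [move=> hy; split => //; split => //; exact: phiB|
    move=> [_ []]].
under [RHS]eq_integral => t /[!inE] St do rewrite E2//.
rewrite ge0_integral_fsum//; last 2 first.
  - move=> y; apply/measurable_EFinP; apply: measurable_funM => //.
    by apply: measurable_funM => //; exact: measurable_indic.
  (* Here [y] runs over all reals. For negative [y] the level set of the nonnegative function [h] is
     empty, so the indicator vanishes. *)
  - move=> y t St; have [y0|y0] := leP 0%R y.
      by rewrite -!EFinM lee_fin !mulr_ge0// rho0.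
    rewrite -!EFinM lee_fin indicE; case: (boolP (t \in _)) => [|_].
      by rewrite inE => -[_ [_ /= hy]]; move: y0; rewrite -hy ltNge fun_ge0.
    by rewrite /= mul0r mulr0.
apply: eq_fsbigr => y /[!inE] -[p _ <-].
rewrite ge0_integralZl//; last 3 first.
  - by apply/measurable_EFinP; apply: measurable_funM => //; exact: measurable_indic.
  - by move=> t St; rewrite -EFinM lee_fin mulr_ge0// rho0.
  - by rewrite lee_fin.
congr (_ * _); rewrite muE//; last by move=> q [].
rewrite [LHS]integral_mkcondr; apply: eq_integral => t /[!inE] St.
rewrite patchE indicE in_setI [t \in S]mem_set//=.
by case: ifP => _; rewrite ?mul1e ?mul0e.
Qed.

(** The hypothesis [muE] describes [mu] on subsets of [B] only. It extends to simple functions by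
    linearity and to nonnegative functions by monotone convergence. *)
Lemma ge0_integral_density (f : X -> \bar R) : measurable_fun B f ->
  (forall p, B p -> 0 <= f p) ->
  \int[mu]_(p in B) f p = \int[lam]_(t in S) (f (phi t) * (rho t)%:E).
Proof.
move=> mf f0; pose h := nnsfun_approx mB mf.
have fE p : B p -> f p = limn (EFin \o h ^~ p).
  by move=> Bp; apply/esym/cvg_lim => //; exact: cvg_nnsfun_approx.
have -> : \int[mu]_(p in B) f p = limn (fun n => \int[mu]_(p in B) (h n p)%:E).
  under eq_integral => p /[!inE] Bp do rewrite fE//.
  apply: monotone_convergence => //.
  - move=> n; apply/measurable_EFinP.
    by apply: (measurable_funS measurableT) => //; exact/measurable_funP.
  - by move=> n p Bp //=; rewrite lee_fin.
  - by move=> p Bp a b ab; rewrite lee_fin; exact/lefP/nd_nnsfun_approx.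
have -> : \int[lam]_(t in S) (f (phi t) * (rho t)%:E) =
    limn (fun n => \int[lam]_(t in S) ((h n (phi t))%:E * (rho t)%:E)).
  have fE' t : S t -> f (phi t) * (rho t)%:E = limn (fun n => (h n (phi t))%:E * (rho t)%:E).
    move=> St; apply/esym/cvg_lim => //; apply: cvgeZr => //.
    by apply: cvg_nnsfun_approx => //; exact: phiB.
  under eq_integral => t /[!inE] St do rewrite fE'//.
  apply: monotone_convergence => //.
  - move=> n; apply/measurable_EFinP; apply: measurable_funM => //.
    by apply: measurableT_comp => //; exact/measurable_funP.
  - by move=> n t St /=; rewrite -EFinM lee_fin mulr_ge0// rho0.
  - move=> t St a b ab/=; rewrite -!EFinM lee_fin ler_wpM2r// ?rho0//.
    exact/lefP/nd_nnsfun_approx.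
by congr (limn _); apply/funext => n; exact: integral_density_nnsfun.
Qed.

End integral_density.

(** * Lebesgue measure on tuples and integration on R^n *)

Section borel_tuple.
Context {R : realType}.
Local Notation mR := (measurableTypeR R).

Definition tuple_box n (c : 'I_n -> R) (r : R) : set (n.-tuple mR) :=
  [set t | forall i, `|tnth t i - c i| < r].

Lemma measurable_tuple_box n (c : 'I_n -> R) r : measurable (tuple_box c r).
Proof.
have -> : tuple_box c r = \bigcap_(i in [set: 'I_n])
    ((fun t : n.-tuple mR => tnth t i) @^-1` [set x | `|x - c i| < r]).
  by apply/seteqP; split=> t /= H; [move=> i _; exact: H|move=> i; exact: (H i I)].
apply: fin_bigcap_measurable; first exact: finite_finset.
move=> i _; rewrite -[X in measurable X]setTI; apply: measurable_tnth => //.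
have -> : [set x | `|x - c i| < r] = [set` `]c i - r, c i + r[].
  by apply/seteqP; split=> x /=; rewrite in_itv/= ltr_distl.
exact: measurable_itv.
Qed.

Lemma row_of_tuple_ball n (c : 'rV[R]_n) r (t : n.-tuple mR) : 0 < r ->
  tuple_box (fun i => c 0 i) r t <-> `|row_of_tuple t - c| < r.
Proof.
move=> r0; split=> H.
  rewrite /Num.Def.normr/= mx_normrE bigmax_lt// => -[i j] _ /=.
  by rewrite ord1 !mxE.
by move=> i; apply: le_lt_trans H; have := norm_row_ge (row_of_tuple t - c) i; rewrite !mxE.
Qed.

(** Tuples carry the product sigma-algebra and row vectors the topology of the maximum norm. The
    link between them is that an open set is a countable union of boxes with rational centres and
    radii [1 / (k + 1)]. *)
Lemma measurable_row_open n (U : set 'rV[R]_n) : open U ->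
  measurable [set t : n.-tuple mR | U (row_of_tuple t)].
Proof.
move=> oU.
pose c (q : n.-tuple rat) : 'rV[R]_n := \row_i ratr (tnth q i).
pose V (qk : n.-tuple rat * nat) : set (n.-tuple mR) :=
  if `[< forall x, `|x - c qk.1| < qk.2.+1%:R^-1 -> U x >]
  then tuple_box (fun i => c qk.1 0 i) qk.2.+1%:R^-1 else set0.
have -> : [set t : n.-tuple mR | U (row_of_tuple t)] = \bigcup_qk V qk.
  apply/seteqP; split=> t /=.
    move=> Ut; have /nbhs_ballP[e /= e0 He] : nbhs (row_of_tuple t) U.
      exact: open_nbhs_nbhs.
    (* The radius is used twice: from [t] to the rational centre, and from the centre to any other
       point of the box. *)
    have [k ke] : exists k : nat, 2 * k.+1%:R^-1 < e.
      exists (Num.truncn (2 / e)).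
      rewrite -ltr_pdivlMl// invf_plt ?posrE ?divr_gt0// ?mulr_gt0 ?invr_gt0//.
      by rewrite invfM invrK; exact: truncnS_gt.
    have k0 : 0 < k.+1%:R^-1 :> R by rewrite invr_gt0.
    have /choice[q qP] : forall i : 'I_n, exists q : rat, `|tnth t i - ratr q| < k.+1%:R^-1.
      move=> i; have [q /andP[q1 q2]] : exists q : rat, tnth t i - k.+1%:R^-1 < ratr q < tnth t i + k.+1%:R^-1.
        have tk : tnth t i - k.+1%:R^-1 < tnth t i + k.+1%:R^-1.
          by rewrite ltrD2l (lt_trans _ k0)// oppr_lt0.
        by have [q] := rat_in_itvoo tk; rewrite in_itv/=; exists q.
      by exists q; rewrite distrC ltr_distl q1 q2.
    have tq : `|row_of_tuple t - c [tuple q i | i < n]| < k.+1%:R^-1.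
      apply/row_of_tuple_ball => // i; rewrite mxE tnth_mktuple; exact: qP.
    exists ([tuple q i | i < n], k) => //; rewrite /V/=; case: asboolP => [_|].
      exact/row_of_tuple_ball.
    case=> x xq; apply: He; rewrite -ball_normE/=.
    rewrite -(subrKA (c [tuple q i | i < n])) (le_lt_trans (ler_normD _ _))//.
    rewrite (lt_trans _ ke)// mulr_natl mulr2n ltrD//; by rewrite distrC.
  move=> [[q k] _]; rewrite /V/=; case: asboolP => // H.
  have k0 : 0 < k.+1%:R^-1 :> R by rewrite invr_gt0.
  by move=> /(row_of_tuple_ball _ _ k0) /H.
apply: countable_bigcupT_measurable; first exact: countableP.
move=> qk; rewrite /V; case: asboolP => _ //; exact: measurable_tuple_box.
Qed.

Lemma lebesgue_tuple_box n (c : 'I_n -> R) (r : R) : 0 < r ->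
  lebesgue_tuple n (tuple_box c r) = ((2 * r) ^+ n)%:E.
Proof.
move=> r0; elim: n c => [|n IH] c.
  rewrite /= diracE expr0; rewrite mem_set//; by case.
have -> : lebesgue_tuple n.+1 (tuple_box c r) =
    (lebesgue_measure \x lebesgue_tuple n)%E
      ([set` `]c ord0 - r, c ord0 + r[] `*` tuple_box (fun i => c (lift ord0 i)) r).
  rewrite /= /cons_measure /pushforward; congr (_ _).
  apply/seteqP; split=> -[x t] /=.
    move=> H; split; first by have := H ord0; rewrite in_itv/= -ltr_distl.
    by move=> i; have := H (lift ord0 i); rewrite tnthS.
  move=> [xc H] i; have [->|] := eqVneq i ord0.
    by move: xc; rewrite in_itv/= -ltr_distl.
  move=> i0; have [j ->] : exists j, i = lift ord0 j.
    by case: (unliftP ord0 i) i0 => [j ->|->]; [exists j|rewrite eqxx].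
  by rewrite tnthS; exact: H.
rewrite product_measure1E//; last exact: measurable_tuple_box.
have E : @lebesgue_measure R [set` `]c ord0 - r, c ord0 + r[] = (2 * r)%:E.
  rewrite lebesgue_measure_itv/= lte_fin ifT; last by lra.
  by rewrite -EFinB; congr (_%:E); ring.
by rewrite IH [X in (X * _)%E](_ : _ = (2 * r)%:E)// -EFinM exprS.
Qed.

Lemma lebesgue_tuple_box_lty n (c : 'I_n -> R) (r : R) : 0 < r ->
  (lebesgue_tuple n (tuple_box c r) < +oo)%E.
Proof. by move=> r0; rewrite lebesgue_tuple_box// ltry. Qed.

End borel_tuple.

Section bounded_support.
Context d (X : measurableType d) (R : realType) (mu : {measure set X -> \bar R}).

Lemma bounded_support_integrable (A : set X) (f : X -> R) (C : R) :
  measurable A -> (mu A < +oo)%E -> measurable_fun setT f ->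
  (forall x, `|f x| <= C) -> (forall x, ~ A x -> f x = 0) ->
  mu.-integrable setT (EFin \o f).
Proof.
move=> mA Afin mf fC f0.
have iA : mu.-integrable A (EFin \o f).
  apply: measurable_bounded_integrable => //; first exact: measurable_funTS.
  exists C; split; first exact: num_real.
  by move=> M CM x _ /=; apply: le_trans (fC x) (ltW CM).
move/(integrable_mkcond _ mA).1 : iA; apply: eq_integrable => // x _.
rewrite patchE; case: ifPn => // /negP xA; rewrite /= f0// => Ax.
by apply: xA; rewrite inE.
Qed.

End bounded_support.

Section compactly_supported.
Context {R : realType} {n : nat}.
Implicit Types (phi psi : 'rV[R]_n -> R).

Definition ccont phi : Prop :=
  continuous phi /\ exists N : R, forall x, N <= `|x| -> phi x = 0.

Lemma ccont_bounded phi : ccont phi -> exists C, forall x, `|phi x| <= C.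
Proof.
move=> [cphi [N phi0]].
have cK : compact [set x : 'rV[R]_n | `|x| <= `|N|].
  apply: bounded_closed_compact.
    exists `|N|; split; first exact: num_real.
    by move=> M NM x /= xN; apply: le_trans xN (ltW NM).
  have -> : [set x : 'rV[R]_n | `|x| <= `|N|] = closed_ball_ (fun x => `|x|) 0 `|N|.
    by apply/seteqP; split=> x /=; rewrite /closed_ball_/= sub0r normrN.
  exact: closed_closed_ball_.
have : compact (phi @` [set x : 'rV[R]_n | `|x| <= `|N|]).
  by apply: continuous_compact => //; exact: continuous_subspaceT.
move=> /compact_bounded[C [_ HC]]; exists (`|C| + 1) => x.
have [xN|xN] := leP `|x| `|N|.
  by apply: HC; [rewrite ltr_pwDr// ler_norm|exists x].
rewrite phi0 ?normr0 ?addr_ge0//.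
by apply: le_trans (ltW xN); exact: ler_norm.
Qed.

Lemma open_measurable_fun d (X : measurableType d) (D : set X) (f : X -> R) :
  (forall U : set R, open U -> measurable (D `&` f @^-1` U)) -> measurable_fun D f.
Proof.
move=> H; apply: (measurability _ (RGenOpens.measurableE R)).
by move=> _ [U oU <-]; apply: H; move: oU => /= [a [b ->]]; exact: interval_open.
Qed.

Lemma measurable_continuous_row phi : continuous phi ->
  measurable_fun [set: n.-tuple (measurableTypeR R)] (phi \o @row_of_tuple R _).
Proof.
move=> /continuousP cphi; apply: open_measurable_fun => U oU; rewrite setTI.
exact: (measurable_row_open (cphi _ oU)).
Qed.

Lemma ccont_integrable phi : ccont phi ->
  (lebesgue_tuple n).-integrable setT (EFin \o (phi \o @row_of_tuple R _)).
Proof.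
move=> cphi; have [C phiC] := ccont_bounded cphi; have [cc [N phi0]] := cphi.
have N1 : 0 < `|N| + 1 by rewrite ltr_wpDl.
apply: (@bounded_support_integrable _ _ _ _
  (tuple_box (fun=> 0) (`|N| + 1)) _ C) => //.
- exact: measurable_tuple_box.
- exact: lebesgue_tuple_box_lty.
- exact: measurable_continuous_row.
- by move=> t; exact: phiC.
- move=> t /= Ht; apply: phi0; rewrite leNgt; apply/negP => tN; apply: Ht => i.
  rewrite subr0; have := norm_row_ge (row_of_tuple t) i; rewrite mxE => /le_lt_trans; apply.
  by rewrite (lt_trans tN)// ltr_pwDr// ler_norm.
Qed.

Definition Int phi : R := \int[lebesgue_tuple n]_t phi (row_of_tuple t).

Lemma ccontD phi psi : ccont phi -> ccont psi -> ccont (fun x => phi x + psi x).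
Proof.
move=> [c1 [N1 H1]] [c2 [N2 H2]]; split.
  by move=> x; apply: continuousD; [exact: c1|exact: c2].
exists (Num.max N1 N2) => x; rewrite ge_max => /andP[x1 x2].
by rewrite H1// H2// addr0.
Qed.

Lemma ccontM phi psi : continuous phi -> ccont psi -> ccont (fun x => phi x * psi x).
Proof.
move=> c1 [c2 [N2 H2]]; split.
  by move=> x; apply: continuousM; [exact: c1|exact: c2].
by exists N2 => x x2; rewrite H2// mulr0.
Qed.

Lemma ccontZ (c : R) phi : ccont phi -> ccont (fun x => c * phi x).
Proof. by apply: ccontM => x; exact: cst_continuous. Qed.

Lemma ccont0 : ccont (fun=> 0).
Proof. by split; [move=> x; exact: cst_continuous|exists 0]. Qed.

Lemma ccont_sum (I : Type) (r : seq I) (F : I -> 'rV[R]_n -> R) :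
  (forall i, ccont (F i)) -> ccont (fun x => \sum_(i <- r) F i x).
Proof.
move=> FC; elim: r => [|i r IH].
  rewrite (_ : (fun _ => _) = (fun=> 0)); first exact: ccont0.
  by apply/funext => x; rewrite big_nil.
rewrite (_ : (fun _ => _) = (fun x => F i x + \sum_(j <- r) F j x)).
  exact: ccontD.
by apply/funext => x; rewrite big_cons.
Qed.

Lemma IntD phi psi : ccont phi -> ccont psi ->
  Int (fun x => phi x + psi x) = Int phi + Int psi.
Proof. by move=> c1 c2; apply: RintegralD => //; exact: ccont_integrable. Qed.

Lemma IntZ (c : R) phi : ccont phi -> Int (fun x => c * phi x) = c * Int phi.
Proof. by move=> c1; apply: RintegralZl => //; exact: ccont_integrable. Qed.

Lemma IntB phi psi : ccont phi -> ccont psi ->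
  Int (fun x => phi x - psi x) = Int phi - Int psi.
Proof. by move=> c1 c2; apply: RintegralB => //; exact: ccont_integrable. Qed.

Lemma le_Int phi psi : ccont phi -> ccont psi -> (forall x, phi x <= psi x) ->
  Int phi <= Int psi.
Proof.
by move=> c1 c2 H; apply: le_Rintegral => //; exact: ccont_integrable.
Qed.

Lemma Int0 : Int (fun=> 0) = 0.
Proof. by rewrite /Int Rintegral_cst// mul0r. Qed.

Lemma Int_sum (I : Type) (r : seq I) (F : I -> 'rV[R]_n -> R) :
  (forall i, ccont (F i)) -> Int (fun x => \sum_(i <- r) F i x) = \sum_(i <- r) Int (F i).
Proof.
move=> FC; elim: r => [|i r IH].
  rewrite big_nil (_ : (fun _ => _) = (fun=> 0)); first exact: Int0.
  by apply/funext => x; rewrite big_nil.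
rewrite big_cons -IH -IntD//; last exact: ccont_sum.
by congr Int; apply/funext => x; rewrite big_cons.
Qed.

Lemma Int_gt0 phi x : ccont phi -> (forall y, 0 <= phi y) -> 0 < phi x -> 0 < Int phi.
Proof.
move=> cphi phi0 phix; have [cc [N phiN]] := cphi.
have [r r0 Hr] : exists2 r : R, 0 < r & forall y, `|y - x| < r -> phi x / 2 <= phi y.
  have /cvgrPdist_le/(_ (phi x / 2)) := cc x; rewrite divr_gt0// => /(_ isT).
  move=> /nbhs_ballP[r /= r0 H]; exists r => // y yr.
  have := H y; rewrite /= -ball_normE/= distrC => /(_ yr).
  rewrite ler_distl => /andP[_]; lra.
pose A := @tuple_box R n (fun i => x 0 i) r.
have mA : measurable A by exact: measurable_tuple_box.
have -> : 0 = Int (fun=> 0) by rewrite Int0.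
have i1 : (lebesgue_tuple n).-integrable setT (EFin \o (fun t => phi x / 2 * \1_A t)).
  apply: (@bounded_support_integrable _ _ _ _ A _ (`|phi x / 2|)) => //.
  - exact: lebesgue_tuple_box_lty.
  - by apply: measurable_funM => //; exact: measurable_indic.
  - by move=> t; rewrite normrM ler_piMr// indicE; case: (t \in A); rewrite ?normr1 ?normr0.
  - by move=> t At; rewrite indicE memNset// mulr0.
rewrite Int0; apply: lt_le_trans (le_Rintegral _ i1 (ccont_integrable cphi) _) => //.
  have -> : \int[lebesgue_tuple n]_t (phi x / 2 * \1_A t) =
      phi x / 2 * fine (lebesgue_tuple n A).
    rewrite RintegralZl//; last first.
      apply: (@bounded_support_integrable _ _ _ _ A _ 1) => //.
      - exact: lebesgue_tuple_box_lty.
      - by move=> t; rewrite indicE; case: (t \in A); rewrite ?normr1 ?normr0.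
      - by move=> t At; rewrite indicE memNset.
    by congr (_ * _); rewrite /Rintegral integral_indic// setIT.
  by rewrite (lebesgue_tuple_box _ r0)/= mulr_gt0 ?divr_gt0// exprn_gt0// mulr_gt0.
move=> t _ /=; rewrite indicE; case: (boolP (t \in A)) => [|_].
  rewrite inE => /(row_of_tuple_ball _ _ r0) tr; rewrite mulr1; exact: Hr.
by rewrite mulr0.
Qed.

End compactly_supported.

(** * Integrals of partial derivatives *)

Section integral_of_derivative.
Context {R : realType}.

Definition row_cons n (x : R) (y : 'rV[R]_n) : 'rV[R]_n.+1 :=
  \row_i (if unlift ord0 i is Some j then y 0 j else x).

Lemma row_cons0 n x (y : 'rV[R]_n) : row_cons x y 0 ord0 = x.
Proof. by rewrite mxE unlift_none. Qed.

Lemma row_consS n x (y : 'rV[R]_n) j : row_cons x y 0 (lift ord0 j) = y 0 j.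
Proof. by rewrite mxE liftK. Qed.

Lemma row_consP n (z z' : 'rV[R]_n.+1) : z 0 ord0 = z' 0 ord0 ->
  (forall j, z 0 (lift ord0 j) = z' 0 (lift ord0 j)) -> z = z'.
Proof.
by move=> z0 zS; apply/rowP => i; case: (unliftP ord0 i) => [j|] ->.
Qed.

Lemma row_of_tuple_cons n (x : R) (t : n.-tuple (measurableTypeR R)) :
  row_of_tuple (cons_pair (x, t)) = row_cons x (row_of_tuple t).
Proof.
apply: row_consP => [|j]; first by rewrite row_cons0 mxE.
by rewrite row_consS !mxE tnthS.
Qed.

Lemma row_cons_norm_ge n x (y : 'rV[R]_n) : `|y| <= `|row_cons x y|.
Proof.
by apply: norm_row_le => // j; rewrite -(row_consS x); exact: norm_row_ge.
Qed.

Lemma row_cons_norm_ge0 n x (y : 'rV[R]_n) : `|x| <= `|row_cons x y|.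
Proof. by rewrite -[in leLHS](row_cons0 x y); exact: norm_row_ge. Qed.

Lemma row_cons_sub n x x' (y y' : 'rV[R]_n) :
  `|row_cons x y - row_cons x' y'| <= Num.max `|x - x'| `|y - y'|.
Proof.
apply: norm_row_le => [|i]; first by rewrite le_max normr_ge0.
case: (unliftP ord0 i) => [j|] ->.
  rewrite !mxE !liftK le_max; have := norm_row_ge (y - y') j.
  by rewrite !mxE => ->; rewrite orbT.
by rewrite !mxE !unlift_none le_max lexx.
Qed.

Lemma continuous_row_consr n x : continuous (row_cons (n := n) x).
Proof.
move=> y; apply/(@cvgrPdist_lt _ _ _ (nbhs y)) => e e0.
apply/nbhs_ballP; exists e => // z; rewrite -ball_normE/= => yz.
by rewrite (le_lt_trans (row_cons_sub _ _ _ _))// gt_max subrr normr0 e0.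
Qed.

Lemma continuous_row_consl n (y : 'rV[R]_n) : continuous (fun x : R => row_cons x y).
Proof.
move=> x; apply/(@cvgrPdist_lt _ _ _ (nbhs x)) => e e0.
apply/nbhs_ballP; exists e => // z; rewrite /ball/= => xz.
by rewrite (le_lt_trans (row_cons_sub _ _ _ _))// gt_max subrr normr0 e0 andbT.
Qed.

Lemma ccont_row_cons n x (phi : 'rV[R]_n.+1 -> R) : ccont phi ->
  ccont (fun y => phi (row_cons x y)).
Proof.
move=> [cphi [N H]]; split.
  by move=> y; apply: continuous_comp; [exact: continuous_row_consr|exact: cphi].
by exists N => y Ny; rewrite H// (le_trans Ny)// row_cons_norm_ge.
Qed.

(** Both orders of integration are recorded, so that the direction of a partial derivative can
    always be put into the inner integral. *)
Lemma integral_row_cons n (phi : 'rV[R]_n.+1 -> R) : ccont phi ->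
  (\int[lebesgue_tuple n.+1]_t (phi (row_of_tuple t))%:E =
   \int[lebesgue_measure]_x \int[lebesgue_tuple n]_t
      (phi (row_cons x (row_of_tuple t)))%:E)%E /\
  (\int[lebesgue_tuple n.+1]_t (phi (row_of_tuple t))%:E =
   \int[lebesgue_tuple n]_t \int[lebesgue_measure]_x
      (phi (row_cons x (row_of_tuple t)))%:E)%E.
Proof.
move=> cphi; have [C phiC] := ccont_bounded cphi; have [cc [N phi0]] := cphi.
have N1 : 0 < `|N| + 1 by rewrite ltr_wpDl.
pose B := tuple_box (fun _ : 'I_n.+1 => 0 : R) (`|N| + 1).
have mB : measurable B by exact: measurable_tuple_box.
pose f (p : measurableTypeR R * n.-tuple (measurableTypeR R)) := phi (row_of_tuple (cons_pair p)).
have mf : measurable_fun setT f.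
  apply: (measurableT_comp (measurable_continuous_row cc)).
  exact: measurable_cons_pair.
have fI : ((lebesgue_measure \x lebesgue_tuple n)%E).-integrable setT (EFin \o f).
  pose A : set (measurableTypeR R * n.-tuple (measurableTypeR R)) := @cons_pair R n @^-1` B.
  apply: (@bounded_support_integrable _ _ _ _ A f C) => //.
  - by rewrite -[X in measurable X]setTI; exact: measurable_cons_pair.
  (* [lebesgue_tuple n.+1] is the pushforward of the product measure under [cons_pair], so the
     measure of this preimage is that of the box by definition. *)
  - change (lebesgue_tuple n.+1 B < +oo)%E.
    exact: lebesgue_tuple_box_lty.
  - by move=> p; exact: phiC.
  - move=> p /= Bp; apply: phi0; rewrite leNgt; apply/negP => tN; apply: Bp => i.
    rewrite subr0; have := norm_row_ge (row_of_tuple (cons_pair p)) i.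
    rewrite mxE => /le_lt_trans; apply.
    by rewrite (lt_trans tN)// ltr_pwDr// ler_norm.
have E : (\int[lebesgue_tuple n.+1]_t (phi (row_of_tuple t))%:E =
    \int[lebesgue_measure \x lebesgue_tuple n]_p (f p)%:E)%E.
  rewrite /= /cons_measure.
  rewrite (@integral_pushforward _ _ _ _ R _ (@measurable_cons_pair R n) _ setT
    (EFin \o (phi \o @row_of_tuple R _)))//.
  by apply/measurable_EFinP; exact: measurable_continuous_row.
rewrite E; split.
  rewrite -(integral12_prod_meas1 fI).
  by apply: eq_integral => x _; apply: eq_integral => t _; rewrite /f -row_of_tuple_cons.
rewrite -(integral21_prod_meas1 fI).
by apply: eq_integral => x _; apply: eq_integral => t _; rewrite /f -row_of_tuple_cons.
Qed.

Lemma integral_derive1_eq0 (F f : R -> R) (N : R) :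
  (forall x : R, is_derive x 1 F (f x)) -> continuous f ->
  (forall x, N <= `|x| -> F x = 0 /\ f x = 0) ->
  (\int[lebesgue_measure]_x (f x)%:E = 0)%E.
Proof.
move=> dF cf F0; pose M : R := `|N| + 1.
have M0 : 0 < M by rewrite ltr_wpDl.
have NM : N <= M by rewrite (le_trans (ler_norm _))// lerDl.
have cF : continuous F by move=> x; exact: is_derive1_continuous (dF x).
have -> : (\int[lebesgue_measure]_x (f x)%:E = \int[lebesgue_measure]_(x in [set` `[- M, M]%R]) (f x)%:E)%E.
  rewrite [RHS]integral_mkcond; apply: eq_integral => x _.
  rewrite patchE; case: ifPn => // /negP xM; rewrite (F0 x _).2//.
  rewrite leNgt; apply/negP => xN; apply: xM; rewrite inE/= in_itv/= -ler_norml.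
  by rewrite (le_trans (ltW xN)).
rewrite (@continuous_FTC2 _ f F).
- by rewrite (F0 M _).1 ?(F0 (- M) _).1 ?subee// ?normrN ger0_norm// ltW.
- by rewrite gtrN.
- exact: continuous_subspaceT.
- split.
  + by move=> x _; have [] := dF x.
  + by apply: cvg_at_right_filter; exact: cF.
  + by apply: cvg_at_left_filter; exact: cF.
- by move=> x _; rewrite derive1E; have [] := dF x.
Qed.

Lemma row_cons_derivS n x (y : 'rV[R]_n) (h : R) j :
  h *: delta_mx 0 (lift ord0 j) + row_cons x y = row_cons x (h *: delta_mx 0 j + y).
Proof.
apply: row_consP => [|k].
  rewrite mxE [X in X + _]mxE [delta_mx _ _ _ _]mxE !row_cons0 andbC.
  by rewrite (negbTE (neq_lift _ _)) mulr0 add0r.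
  rewrite mxE [X in X + _]mxE [delta_mx _ _ _ _]mxE !row_consS (inj_eq lift_inj).
  by rewrite !mxE.
Qed.

Lemma row_cons_deriv0 n x (y : 'rV[R]_n) :
  row_cons x y = x *: delta_mx 0 ord0 + row_cons 0 y.
Proof.
apply: row_consP => [|k].
  rewrite [RHS]mxE [X in X + _]mxE [delta_mx _ _ _ _]mxE !row_cons0 !eqxx.
  by rewrite mulr1 addr0.
rewrite [RHS]mxE [X in X + _]mxE [delta_mx _ _ _ _]mxE !row_consS andbC.
by rewrite eq_sym (negbTE (neq_lift _ _)) mulr0 add0r.
Qed.

(** Induction on the dimension. When [a] is one of the later coordinates, the inner integral over
    these vanishes by induction; when [a] is the first, the inner integral over it vanishes by the
    fundamental theorem of calculus. *)
Lemma integral_pderiv_eq0 n (a : 'I_n) (psi dpsi : 'rV[R]_n -> R) :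
  ccont psi -> ccont dpsi -> (forall x, is_derive x (delta_mx 0 a) psi (dpsi x)) ->
  (\int[lebesgue_tuple n]_t (dpsi (row_of_tuple t))%:E = 0)%E.
Proof.
elim: n a psi dpsi => [[]//|n IH] a psi dpsi cpsi cdpsi psiE.
case: (unliftP ord0 a) => [b aE|aE].
  rewrite (integral_row_cons cdpsi).1; apply: integral0_eq => x _.
  apply: (IH b (fun y => psi (row_cons x y)) (fun y => dpsi (row_cons x y))).
  - exact: ccont_row_cons.
  - exact: ccont_row_cons.
  move=> y; apply/is_derive_line.
  have /is_derive_line := psiE (row_cons x y); rewrite aE.
  congr (is_derive _ _ _ _); apply/funext => h; by rewrite row_cons_derivS.
rewrite (integral_row_cons cdpsi).2; apply: integral0_eq => t _.
have [N1 H1] := cpsi.2; have [N2 H2] := cdpsi.2.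
apply: (@integral_derive1_eq0 (fun x => psi (row_cons x (row_of_tuple t))) _ (Num.max N1 N2)).
- move=> x; have := psiE (row_cons x (row_of_tuple t)).
  rewrite aE {1}row_cons_deriv0 => /is_derive_along.
  congr (is_derive _ _ _ _); apply/funext => s; by rewrite -row_cons_deriv0.
- move=> x; apply: continuous_comp; last exact: cdpsi.1.
  exact: continuous_row_consl.
- move=> x; rewrite ge_max => /andP[x1 x2].
  by split; [apply: H1|apply: H2]; apply: le_trans (row_cons_norm_ge0 _ _).
Qed.

Lemma Int_pderiv n (a : 'I_n) (psi dpsi : 'rV[R]_n -> R) :
  ccont psi -> ccont dpsi -> (forall x, is_derive x (delta_mx 0 a) psi (dpsi x)) ->
  Int dpsi = 0.
Proof. by move=> c1 c2 H; rewrite /Int /Rintegral (integral_pderiv_eq0 c1 c2 H). Qed.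

End integral_of_derivative.

(** * Extension by zero of functions defined in a chart *)

Section extension_by_zero.
Context {R : realType} {n : nat}.
Implicit Types (D K : set 'rV[R]_n) (phi psi : 'rV[R]_n -> R).

(** Expressions in coordinates are total functions with arbitrary values outside the chart. Setting
    those values to 0 makes it possible to integrate over all of R^n. *)
Definition ext0 D phi : 'rV[R]_n -> R := fun x => if `[< D x >] then phi x else 0.

Definition suppin D K phi : Prop := forall x, D x -> ~ K x -> phi x = 0.

Lemma ext0E D phi x : D x -> ext0 D phi x = phi x.
Proof. by move=> Dx; rewrite /ext0; case: asboolP. Qed.

Lemma ext0_out D K phi x : suppin D K phi -> ~ K x -> ext0 D phi x = 0.
Proof. by move=> H Kx; rewrite /ext0; case: asboolP => // Dx; exact: H. Qed.

Lemma eq_ext0 D phi psi : (forall x, D x -> phi x = psi x) -> ext0 D phi = ext0 D psi.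
Proof.
by move=> H; apply/funext => x; rewrite /ext0; case: asboolP => // /H.
Qed.

Lemma le_ext0 D phi psi : (forall x, D x -> phi x <= psi x) ->
  forall x, ext0 D phi x <= ext0 D psi x.
Proof. by move=> H x; rewrite /ext0; case: asboolP => // /H. Qed.

Lemma ext0_ge0 D phi : (forall x, D x -> 0 <= phi x) -> forall x, 0 <= ext0 D phi x.
Proof. by move=> H x; rewrite /ext0; case: asboolP => // /H. Qed.

Lemma ext0B D phi psi : ext0 D (fun x => phi x - psi x) =
  (fun x => ext0 D phi x - ext0 D psi x).
Proof. by apply/funext => x; rewrite /ext0; case: asboolP; rewrite ?subr0. Qed.

Lemma ext0Z D (c : R) phi : ext0 D (fun x => c * phi x) = (fun x => c * ext0 D phi x).
Proof. by apply/funext => x; rewrite /ext0; case: asboolP; rewrite ?mulr0. Qed.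

Lemma ext0_sum D (I : Type) (r : seq I) (F : I -> 'rV[R]_n -> R) :
  ext0 D (fun x => \sum_(i <- r) F i x) = (fun x => \sum_(i <- r) ext0 D (F i) x).
Proof.
by apply/funext => x; rewrite /ext0; case: asboolP => // _; rewrite big1.
Qed.

Section fixed_domain.
Variables (D K : set 'rV[R]_n).
Hypotheses (oD : open D) (cK : compact K) (KD : K `<=` D).

Let open_notK : open (~` K).
Proof. by rewrite openC; apply: compact_closed => //; exact: norm_hausdorff. Qed.

Lemma ext0_near_in phi x : D x -> {near x, phi =1 ext0 D phi}.
Proof.
by move=> Dx; apply: (open_near_eq oD) Dx => y Dy; rewrite ext0E.
Qed.

Lemma ext0_near_out phi x : suppin D K phi -> ~ K x -> {near x, (fun=> 0) =1 ext0 D phi}.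
Proof.
move=> sp Kx; apply: (open_near_eq open_notK) Kx => y Ky.
by rewrite (ext0_out sp).
Qed.

Lemma suppin_pderiv phi a : suppin D K phi -> suppin D K (pderiv a phi).
Proof.
move=> sp x Dx Kx.
have oDK : open (D `&` ~` K) by exact: openI.
have <- : 'D_(delta_mx 0 a) (fun=> 0) x = 0 :> R by rewrite derive_cst.
apply: (eq_open_pderiv a oDK) => // y [Dy Ky]; exact: sp.
Qed.

Lemma suppinMr phi psi : suppin D K psi -> suppin D K (fun x => phi x * psi x).
Proof. by move=> sp x Dx Kx; rewrite sp// mulr0. Qed.

Lemma suppinMl phi psi : suppin D K phi -> suppin D K (fun x => phi x * psi x).
Proof. by move=> sp x Dx Kx; rewrite sp// mul0r. Qed.

(** The open sets [D] and the complement of [K] cover the space because [K] lies in [D]. The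
    extension is [phi] on the first and 0 on the second. *)
Lemma ccont_ext0 phi : suppin D K phi ->
  (forall x, D x -> {for x, continuous phi}) -> ccont (ext0 D phi).
Proof.
move=> sp cphi; split.
  move=> x; have [Kx|Kx] := pselect (K x).
    apply: (eq_open_continuous oD (f := phi)); [by move=> y Dy; rewrite ext0E|exact: KD|].
    by apply: cphi; exact: KD.
  apply: (eq_open_continuous open_notK (f := fun=> 0)) => //.
    by move=> y Ky; rewrite (ext0_out sp).
  exact: cst_continuous.
have /compact_bounded[N [_ HN]] := cK; exists (`|N| + 1 + 1) => x xN.
apply: (ext0_out sp) => Kx.
have := HN (`|N| + 1); rewrite ltr_pwDr ?ler_norm// => /(_ isT x Kx).
by move=> /(le_trans xN); rewrite gerDl ler10.
Qed.

Lemma Int_ext0_pderiv phi a : Ck 1 D phi -> suppin D K phi ->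
  Int (ext0 D (pderiv a phi)) = 0.
Proof.
move=> phiC sp; have sp' := suppin_pderiv a sp.
apply: (@Int_pderiv _ _ a (ext0 D phi)).
- by apply: ccont_ext0 => // x Dx; exact: Ck_continuous phiC Dx.
- by apply: ccont_ext0 => // x Dx; exact: Ck_continuous (Ck_pderiv a phiC) Dx.
- move=> x; have [Kx|Kx] := pselect (K x).
    apply: is_derive_near (ext0_near_in phi (KD Kx)) _.
    by rewrite ext0E; [exact: Ck_is_derive phiC (KD Kx)|exact: KD].
  apply: is_derive_near (ext0_near_out sp Kx) _.
  by rewrite (ext0_out sp')//; exact: is_derive_cst.
Qed.

End fixed_domain.
End extension_by_zero.

Lemma sum_add_sub_add (V : zmodType) (I : finType) (F1 F2 F3 F4 : I -> V) :
  \sum_i (F1 i + F2 i - (F3 i + F4 i)) =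
  \sum_i F1 i + \sum_i F2 i - (\sum_i F3 i + \sum_i F4 i).
Proof. by rewrite sumrB !big_split. Qed.

(** * Green's formula in a chart *)

Section green.
Context {R : realType} {n : nat}.
Variables (D K : set 'rV[R]_n) (G : 'rV[R]_n -> 'M[R]_n).
Hypotheses (HG : local_C2metric D G) (cK : compact K) (KD : K `<=` D).
Let oD : open D := lm_open HG.

Definition density (H : 'rV[R]_n -> 'M[R]_n) x : R := Num.sqrt (\det (H x)).

Lemma density_gt0 x : D x -> 0 < density G x.
Proof. by move=> Dx; rewrite sqrtr_gt0 (lm_det_gt0 HG Dx). Qed.

Lemma Ck_density k : (k <= 2)%N -> Ck k D (density G).
Proof.
move=> k2; apply: Ck_sqrt => //; first exact: (lm_det_gt0 HG).
by apply: Ck_det => // i j; apply: Ck_leq (lm_C2 HG i j).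
Qed.

Lemma Ck_local_laplacian f : Ck 2 D f -> Ck 0 D (local_laplacian G f).
Proof.
move=> fC; apply: Ck_sum => // a; apply: Ck_sum => // b.
apply: CkM => //; first exact: (Ck_inv_at HG).
apply: CkB => //; first exact/Ck_pderiv/Ck_pderiv.
apply: Ck_sum => // c; apply: CkM => //; first exact: (Ck_christoffel HG).
exact/CkW/Ck_pderiv.
Qed.

Lemma Ck_local_scalar : Ck 0 D (local_scalar G).
Proof.
apply: Ck_sum => // b; apply: Ck_sum => // c.
apply: CkM => //; first exact: (Ck_inv_at HG).
apply: Ck_sum => // a; apply: CkD => //.
  by apply: CkB => //; apply: Ck_pderiv; exact: (Ck_christoffel HG).
by apply: Ck_sum => // m; apply: CkB => //; apply: CkM => //;
  exact: (Ck_christoffel HG).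
Qed.

Lemma suppin_laplacian f : suppin D K f -> suppin D K (local_laplacian G f).
Proof.
move=> sp x Dx Kx; rewrite /local_laplacian big1// => a _; rewrite big1// => b _.
rewrite (suppin_pderiv oD cK a (suppin_pderiv oD cK b sp))//.
rewrite big1 ?subr0 ?mulr0// => c _; by rewrite (suppin_pderiv oD cK c sp)// mulr0.
Qed.

(** The field [X], the density times [chi grad P - P grad chi], is supported in [K] since [chi] is,
    so its divergence integrates to 0. In the divergence the products of gradients cancel by
    symmetry of the inverse metric, and the two Laplacian terms remain. *)
Lemma Green_ext0 chi P : Ck 2 D chi -> suppin D K chi -> Ck 2 D P ->
  Int (ext0 D (fun x => density G x * chi x * local_laplacian G P x)) =
  Int (ext0 D (fun x => density G x * P x * local_laplacian G chi x)).
Proof.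
move=> chiC sp PC.
pose X a x := chi x * (density G x * up G P x a) - P x * (density G x * up G chi x a).
have sC f a : Ck 2 D f -> Ck 1 D (fun x => density G x * up G f x a).
  by move=> fC; exact: (CkM oD (@Ck_density 1 isT) (@Ck_up _ _ _ _ HG _ fC 1 a isT)).
have XC a : Ck 1 D (X a).
  exact: (CkB oD (CkM oD (CkW chiC) (sC _ a PC)) (CkM oD (CkW PC) (sC _ a chiC))).
have Xs a : suppin D K (X a).
  move=> x Dx Kx; rewrite /X sp// mul0r sub0r /up /raise big1 ?mulr0 ?oppr0// => d _.
  by rewrite /grad_at (suppin_pderiv oD cK d sp)// mulr0.
have div x : D x -> \sum_a pderiv a (X a) x =
    density G x * chi x * local_laplacian G P x - density G x * P x * local_laplacian G chi x.
  move=> Dx.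
  have dX a : pderiv a (X a) x =
      pderiv a chi x * (density G x * up G P x a)
      + chi x * pderiv a (fun y => density G y * up G P y a) x
      - (pderiv a P x * (density G x * up G chi x a)
      + P x * pderiv a (fun y => density G y * up G chi y a) x).
    apply: pderivE; apply: is_deriveB; apply: is_derive_mul.
    - exact: Ck_is_derive chiC Dx.
    - exact: Ck_is_derive (sC _ _ PC) Dx.
    - exact: Ck_is_derive PC Dx.
    - exact: Ck_is_derive (sC _ _ chiC) Dx.
  rewrite (eq_bigr _ (fun a _ => dX a)) sum_add_sub_add.
  have E f u : Ck 2 D f -> \sum_a u x * pderiv a (fun y => density G y * up G f y a) x =
      u x * (density G x * local_laplacian G f x).
    by move=> fC; rewrite -big_distrr/= (laplacian_divergence HG fC Dx).
  have sym : \sum_a pderiv a chi x * (density G x * up G P x a) =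
      \sum_a pderiv a P x * (density G x * up G chi x a).
    rewrite /up /raise /grad_at.
    under eq_bigr => a _ do rewrite !big_distrr/=.
    under [RHS]eq_bigr => a _ do rewrite !big_distrr/=.
    rewrite exchange_big/=; apply: eq_bigr => b _; apply: eq_bigr => a _.
    by rewrite (inv_at_sym HG a b Dx); ring.
  have alg (s1 s2 s3 s4 d c p l1 l2 : R) : s1 = s3 -> s2 = c * (d * l1) ->
    s4 = p * (d * l2) -> s1 + s2 - (s3 + s4) = d * c * l1 - d * p * l2.
    by move=> -> -> ->; ring.
  exact: (alg _ _ _ _ _ _ _ _ _ sym (E P chi PC) (E chi P chiC)).
apply/eqP; rewrite -subr_eq0 -IntB; last 2 first.
- apply: (ccont_ext0 oD cK KD).
    by apply: suppinMl; exact: suppinMr.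
  exact: (Ck_continuous_on (CkM oD (CkM oD (@Ck_density 0 isT) (@Ck_leq _ _ 0 2 _ _ isT chiC))
    (Ck_local_laplacian PC))).
- apply: (ccont_ext0 oD cK KD).
    by apply: suppinMr; exact: suppin_laplacian.
  exact: (Ck_continuous_on (CkM oD (CkM oD (@Ck_density 0 isT) (@Ck_leq _ _ 0 2 _ _ isT PC))
    (Ck_local_laplacian chiC))).
rewrite -ext0B -(eq_ext0 div) ext0_sum Int_sum.
  by rewrite big1// => a _; exact: (Int_ext0_pderiv oD cK KD).
move=> a; apply: (ccont_ext0 oD cK KD); first exact: suppin_pderiv.
exact: (Ck_continuous_on (Ck_pderiv a (XC a))).
Qed.

End green.

(** * Scalar curvature inequalities in a chart *)

Section chart_inequalities.
Context {R : realType} {n : nat}.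
Variables (D K : set 'rV[R]_n) (G : 'rV[R]_n -> 'M[R]_n) (chi : 'rV[R]_n -> R).
Hypotheses (HG : local_C2metric D G) (cK : compact K) (KD : K `<=` D).
Hypotheses (chiC : Ck 2 D chi) (chis : suppin D K chi) (chi0 : forall x, D x -> 0 <= chi x).
Hypothesis n2 : (2 <= n)%N.
Let oD : open D := lm_open HG.

(** Positivity is assumed for [G], whereas the definition contracts with its inverse. Raising the
    index of [df] rewrites the expression as [G] evaluated on the gradient. *)
Lemma local_grad2_ge0 f x : D x -> 0 <= local_grad2 G f x.
Proof.
move=> Dx; have Gu := lm_unit HG Dx.
pose v : 'rV[R]_n := \row_a pderiv a f x; pose y := v *m invmx (G x).
have -> : local_grad2 G f x = (y *m G x *m y^T) 0 0.
  rewrite /y trmx_mul trmx_inv (lm_sym HG Dx) mulmxKV// mulmxA.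
  rewrite mxE /local_grad2 exchange_big/=; apply: eq_bigr => b _.
  rewrite mxE big_distrl/=; apply: eq_bigr => a _; rewrite !mxE.
  by rewrite mulrCA mulrA.
have [->|y0] := eqVneq y 0; first by rewrite !mul0mx mxE.
exact/ltW/(lm_pos HG).
Qed.

Lemma Ck_local_grad2 f : Ck 2 D f -> Ck 0 D (local_grad2 G f).
Proof.
move=> fC; apply: Ck_sum => // a; apply: Ck_sum => // b.
have fC1 i : Ck 0 D (pderiv i f) := CkW (Ck_pderiv i fC).
exact: (CkM oD (@Ck_inv_at _ _ _ _ HG 0 a b isT) (CkM oD (fC1 a) (fC1 b))).
Qed.

(* [expint k] is the primitive of [exp (k s)] vanishing at 0. *)
Definition expint (k : nat) (s : R) : R :=
  if k == 0%N then s else (expR (k%:R * s) - 1) / k%:R.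

Lemma is_derive_expRM (k : nat) (s : R) :
  is_derive s 1 (fun s : R => expR (k%:R * s)) (k%:R * expR (k%:R * s)).
Proof.
have h : is_derive s (1 : R) (fun s : R => k%:R * s) k%:R.
  have := @is_deriveZ _ _ _ (fun s : R => s) k%:R s 1 1 (is_derive_id _ _).
  by rewrite /GRing.scale/= mulr1.
by have := is_derive1_comp (is_derive_expR (k%:R * s)) h; rewrite mulrC.
Qed.

Lemma is_derive_expint k (s : R) : is_derive s 1 (expint k) (expR (k%:R * s)).
Proof.
rewrite /expint; case: eqP => [->|/eqP k0].
  by rewrite mul0r expR0; exact: is_derive_id.
have := is_deriveB (is_derive_expRM k s) (is_derive_cst (1 : R) s (1 : R)).
move=> /(@is_deriveZ _ _ _ _ k%:R^-1) h.
have -> : (fun s0 : R => (expR (k%:R * s0) - 1) / k%:R) =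
    k%:R^-1 *: ((fun s : R => expR (k%:R * s)) - cst 1).
  by apply/funext => t; rewrite mulrC.
apply: is_derive_eq h _.
by rewrite subr0 /GRing.scale/= mulrA mulVf ?mul1r// pnatr_eq0.
Qed.

Section factor.
Variable w : 'rV[R]_n -> R.
Hypothesis wC : Ck 2 D w.

Lemma Ck_expRM j k : (j <= 2)%N -> Ck j D (fun x => expR (k%:R * w x)).
Proof.
by move=> j2; apply: Ck_expR => //; apply: CkZ => //; exact: Ck_leq wC.
Qed.

Lemma Ck_expint k : Ck 2 D (fun x => expint k (w x)).
Proof.
rewrite /expint; case: eqP => [_|_]; first exact: wC.
exact: (CkM oD (CkB oD (@Ck_expRM 2 k isT) (Ck_cst _ 1 oD)) (Ck_cst _ k%:R^-1 oD)).
Qed.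

(** The derivative of [expint k] is [e^{ks}], with derivative [k e^{ks}]; the second factor produces
    the gradient term. The case [k = 0] is included, as [expint 0] is the identity. *)
Lemma laplacian_expint k x : D x ->
  local_laplacian G (fun y => expint k (w y)) x =
  expR (k%:R * w x) * (local_laplacian G w x + k%:R * local_grad2 G w x).
Proof.
move=> Dx.
have d1 b y : D y -> pderiv b (fun y => expint k (w y)) y =
    expR (k%:R * w y) * pderiv b w y.
  move=> Dy; apply: pderivE; apply: is_derive_comp1; last exact: is_derive_expint.
  exact: Ck_is_derive wC Dy.
have d2 a b : pderiv a (pderiv b (fun y => expint k (w y))) x =
    expR (k%:R * w x) * (pderiv a (pderiv b w) x + k%:R * (pderiv a w x * pderiv b w x)).
  rewrite (eq_open_pderiv a oD (fun y Dy => d1 b y Dy) Dx).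
  have h := is_derive_mul (is_derive_comp1 (Ck_is_derive a wC Dx) (is_derive_expRM k (w x)))
    (Ck_is_derive a (Ck_pderiv b wC) Dx).
  by rewrite (pderivE h); ring.
rewrite /local_laplacian /local_grad2 [X in _ * (_ + X)]big_distrr/= -big_split/=.
rewrite big_distrr/=; apply: eq_bigr => a _.
rewrite [X in _ * (_ + X)]big_distrr/= -big_split/= big_distrr/=; apply: eq_bigr => b _.
rewrite d2; under eq_bigr => c _ do rewrite d1// mulrCA.
rewrite -big_distrr/=; ring.
Qed.

Variable G' : 'rV[R]_n -> 'M[R]_n.
Hypothesis G'E : forall y, D y -> G' y = expR (2 * w y) *: G y.

Lemma density_conformal x : D x -> density G' x = expR (n%:R * w x) * density G x.
Proof.
move=> Dx; rewrite /density G'E// detZ sqrtrM ?exprn_ge0 ?expR_ge0//.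
congr (_ * _); rewrite expRM_natl exprAC sqrtr_sqr ger0_norm ?exprn_ge0 ?expR_ge0//.
by rewrite -expRM_natl.
Qed.

(** The right side exceeds the left by the density times [(n - 1) (n - 2) e^{(n - 2) w} |dw|^2]: the
    conformal law contributes this gradient term with a minus sign, and passing from [Delta w] to
    the Laplacian of [expint] adds it twice. *)
Lemma scalar_density_ge x : D x ->
  density G x * (expR ((n - 2)%:R * w x) * local_scalar G x
    - 2 * (n%:R - 1) * local_laplacian G (fun y => expint (n - 2) (w y)) x)
  <= density G' x * local_scalar G' x.
Proof.
move=> Dx; rewrite density_conformal// (local_scalar_conformal HG wC G'E Dx).
rewrite laplacian_expint//.
have nE : n%:R = (n - 2)%:R + 2 :> R by rewrite -natrD subnK.
have -> : expR (n%:R * w x) = expR ((n - 2)%:R * w x) * expR (2 * w x).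
  by rewrite nE mulrDl expRD.
have e2 : expR (2 * w x) * expR (- (2 * w x)) = 1 by rewrite -expRD subrr expR0.
have g0 := local_grad2_ge0 w Dx.
have d0 := density_gt0 HG Dx.
have e0 := expR_gt0 ((n - 2)%:R * w x).
have m0 : 0 <= (n - 2)%:R :> R by [].
rewrite nE.
have alg (m e d a b r l g : R) : 0 <= m -> 0 < e -> 0 < d -> 0 <= g -> a * b = 1 ->
    d * (e * r - 2 * (m + 2 - 1) * (e * (l + m * g))) <=
    e * a * d * (b * (r - 2 * (m + 2 - 1) * l - (m + 2 - 1) * (m + 2 - 2) * g)).
  move=> m0' e0' d0' g0' ab.
  have -> : e * a * d * (b * (r - 2 * (m + 2 - 1) * l - (m + 2 - 1) * (m + 2 - 2) * g))
    = a * b * (e * d * (r - 2 * (m + 2 - 1) * l - (m + 2 - 1) * (m + 2 - 2) * g)) by ring.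
  rewrite ab mul1r -subr_ge0.
  have -> : e * d * (r - 2 * (m + 2 - 1) * l - (m + 2 - 1) * (m + 2 - 2) * g) -
     d * (e * r - 2 * (m + 2 - 1) * (e * (l + m * g))) =
     (m + 1) * (m * (e * d * g)) by ring.
  by rewrite !mulr_ge0 ?addr_ge0// ltW.
exact: alg.
Qed.

(** Multiplication by [e^{2w}] removes the exponential of the conformal law. The gradient term that
    is then dropped is nonpositive because [n] is at least 2. *)
Lemma scalar_bound_laplacian s x : D x -> s <= local_scalar G' x ->
  expR (2 * w x) * s <= local_scalar G x - 2 * (n%:R - 1) * local_laplacian G w x.
Proof.
move=> Dx; rewrite (local_scalar_conformal HG wC G'E Dx) => sR.
have e2 : expR (2 * w x) * expR (- (2 * w x)) = 1 by rewrite -expRD subrr expR0.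
have := ler_wpM2l (expR_ge0 (2 * w x)) sR.
rewrite mulrA e2 mul1r => /le_trans; apply.
rewrite gerBl !mulr_ge0 ?local_grad2_ge0// subr_ge0.
  by rewrite ler1n ltnW.
by rewrite ler_nat.
Qed.

End factor.

Opaque local_scalar local_laplacian local_grad2 density Int ext0 expint.

Let dC := Ck_density HG.

Let cc f : Ck 0 D f -> ccont (ext0 D (fun x => density G x * chi x * f x)).
Proof.
move=> fC; apply: (ccont_ext0 oD cK KD); first by apply: suppinMl; exact: suppinMr.
exact: (Ck_continuous_on (CkM oD (CkM oD (@dC 0 isT) (@Ck_leq _ _ 0 2 _ _ isT chiC)) fC)).
Qed.

Let ccl f : Ck 0 D f -> ccont (ext0 D (fun x => density G x * f x * local_laplacian G chi x)).
Proof.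
move=> fC; apply: (ccont_ext0 oD cK KD).
  by apply: suppinMr; exact: (suppin_laplacian HG cK).
exact: (Ck_continuous_on (CkM oD (CkM oD (@dC 0 isT) fC) (Ck_local_laplacian HG chiC))).
Qed.

Let Ck0_abs f : Ck 0 D f -> Ck 0 D (fun x => `|f x|).
Proof.
move=> /Ck0P fC; apply/Ck0P => x Dx.
by apply: (@continuous_comp _ _ _ f (fun y : R => `|y|)); [exact: fC|exact: norm_continuous].
Qed.

Let ccla : ccont (ext0 D (fun x => density G x * `|local_laplacian G chi x|)).
Proof.
apply: (ccont_ext0 oD cK KD).
  apply: suppinMr => x Dx Kx; by rewrite (suppin_laplacian HG cK chis)// normr0.
exact: (Ck_continuous_on (CkM oD (@dC 0 isT) (Ck0_abs (Ck_local_laplacian HG chiC)))).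
Qed.

(** Green's formula moves the Laplacian onto [chi], after which only the uniform size of [w]
    matters. *)
Let Int_lap_ge (w : 'rV[R]_n -> R) (eta : R) : Ck 2 D w -> (forall x, D x -> `|w x| <= eta) ->
  Int (ext0 D (fun x => density G x * chi x * local_laplacian G w x)) <=
  eta * Int (ext0 D (fun x => density G x * `|local_laplacian G chi x|)) /\
  - (eta * Int (ext0 D (fun x => density G x * `|local_laplacian G chi x|))) <=
  Int (ext0 D (fun x => density G x * chi x * local_laplacian G w x)).
Proof.
move=> wC weta; rewrite (Green_ext0 HG cK KD chiC chis wC).
have w0 : Ck 0 D w by exact: Ck_leq wC.
have H x : D x -> `|density G x * w x * local_laplacian G chi x| <=
    eta * (density G x * `|local_laplacian G chi x|).
  move=> Dx; rewrite !normrM (gtr0_norm (density_gt0 HG Dx)) mulrAC mulrC.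
  by rewrite ler_wpM2r ?weta// mulr_ge0// ltW// (density_gt0 HG Dx).
rewrite -mulNr -!IntZ// -!ext0Z; split; apply: le_Int.
- exact: ccl.
- by rewrite ext0Z; exact: ccontZ.
- by apply: le_ext0 => x Dx; apply: le_trans (ler_norm _) (H x Dx).
- by rewrite ext0Z; exact: ccontZ.
- exact: ccl.
- by apply: le_ext0 => x Dx; rewrite mulNr lerNl (le_trans (ler_norm _))// normrN H.
Qed.

(** Lower semicontinuity in one chart, in quantitative form. The constant is chosen before [w], so
    the error [C * eta] can be made arbitrarily small although the derivatives of [w] are not
    controlled. *)
Lemma Int_scalar_lsc : exists C : R, 0 <= C /\
  forall (w : 'rV[R]_n -> R) G' (eta : R), Ck 2 D w ->
  (forall y, D y -> G' y = expR (2 * w y) *: G y) ->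
  (forall y, D y -> `|expR ((n - 2)%:R * w y) - 1| <= eta) ->
  (forall y, D y -> `|expint (n - 2) (w y)| <= eta) -> 0 <= eta ->
  Int (ext0 D (fun x => density G x * chi x * local_scalar G x)) - C * eta <=
  Int (ext0 D (fun x => density G' x * chi x * local_scalar G' x)).
Proof.
pose A := Int (ext0 D (fun x => density G x * chi x * `|local_scalar G x|)).
pose B := Int (ext0 D (fun x => density G x * `|local_laplacian G chi x|)).
have RC := Ck_local_scalar HG.
have A0 : 0 <= A.
  rewrite -(@Int0 R n); apply: le_Int; [exact: ccont0|by apply: cc; exact: Ck0_abs|].
  apply: ext0_ge0 => x Dx.
  by rewrite !mulr_ge0// ?chi0// ltW// (density_gt0 HG Dx).
have B0 : 0 <= B.
  rewrite -(@Int0 R n); apply: le_Int; [exact: ccont0|exact: ccla|].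
  apply: ext0_ge0 => x Dx.
  by rewrite !mulr_ge0// ltW// (density_gt0 HG Dx).
have n1 : 0 <= 2 * (n%:R - 1) :> R by rewrite mulr_ge0// subr_ge0 ler1n ltnW.
(* [A] pays for replacing [e^{(n - 2) w}] by 1 in front of the curvature of [G] ([step2]), and [B]
   for the Laplacian of [expint] ([Int_lap_ge]). *)
exists (A + 2 * (n%:R - 1) * B); split; first by rewrite addr_ge0// mulr_ge0.
move=> w G' eta wC G'E we wp eta0.
have eC : Ck 0 D (fun x => expR ((n - 2)%:R * w x)) by exact: Ck_expRM.
have [HL _] := Int_lap_ge (Ck_expint wC (n - 2)) wp.
have step1 : Int (ext0 D (fun x => density G x * chi x * (expR ((n - 2)%:R * w x) * local_scalar G x)))
   - 2 * (n%:R - 1) * Int (ext0 D (fun x => density G x * chi x *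
        local_laplacian G (fun y => expint (n - 2) (w y)) x)) <=
   Int (ext0 D (fun x => density G' x * chi x * local_scalar G' x)).
  have cL : ccont (ext0 D (fun x => density G x * chi x *
        local_laplacian G (fun y => expint (n - 2) (w y)) x)).
    by apply: cc; apply: (Ck_local_laplacian HG); exact: Ck_expint.
  have cR : ccont (ext0 D (fun x => density G x * chi x * (expR ((n - 2)%:R * w x) * local_scalar G x))).
    exact: (cc (CkM oD eC RC)).
  rewrite -IntZ// -ext0Z -IntB//; last by rewrite ext0Z; exact: ccontZ.
  rewrite -ext0B; apply: le_Int.
  - rewrite ext0B; apply: ccontD => //; rewrite ext0Z.
    rewrite (_ : (fun _ => - _) = (fun x => (- (2 * (n%:R - 1))) * ext0 D (fun x => density G x * chi x *
        local_laplacian G (fun y => expint (n - 2) (w y)) x) x)); first exact: ccontZ.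
    by apply/funext => x; rewrite mulNr.
  (* [G'] is known only through its conformal relation to [G] on [D], so continuity of its integrand
     is read off from the conformal law. *)
  - rewrite (@eq_ext0 _ _ _ _ (fun x => density G x * chi x * (expR (n%:R * w x) *
       (expR (- (2 * w x)) * (local_scalar G x - 2 * (n%:R - 1) * local_laplacian G w x
        - (n%:R - 1) * (n%:R - 2) * local_grad2 G w x))))).
      have eC' : Ck 0 D (fun x => expR (n%:R * w x)) by exact: Ck_expRM.
      apply: cc; apply: (CkM oD eC').
      apply: (CkM oD (Ck_expR oD (CkN oD (CkZ 2 oD (@Ck_leq _ _ 0 2 _ _ isT wC))))).
      exact: (CkB oD (CkB oD RC (CkZ _ oD (Ck_local_laplacian HG wC)))
        (CkZ _ oD (Ck_local_grad2 wC))).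
    move=> x Dx; rewrite (density_conformal G'E)// (local_scalar_conformal HG wC G'E Dx).
    have alg (a b c d : R) : a * b * c * d = b * c * (a * d) by ring.
    exact: alg.
  - apply: le_ext0 => x Dx.
    have := ler_wpM2r (chi0 Dx) (scalar_density_ge wC G'E Dx).
    have alg (d c r l k d' r' : R) : d * (r - k * l) * c <= d' * r' * c ->
      d * c * r - k * (d * c * l) <= d' * c * r'.
      have -> : d * c * r - k * (d * c * l) = d * (r - k * l) * c by ring.
      by rewrite [d' * c * r']mulrAC.
    exact: alg.
have step2 : Int (ext0 D (fun x => density G x * chi x * local_scalar G x)) - A * eta <=
    Int (ext0 D (fun x => density G x * chi x * (expR ((n - 2)%:R * w x) * local_scalar G x))).
  have cA : ccont (ext0 D (fun x => density G x * chi x * `|local_scalar G x|)).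
    by apply: cc; exact: Ck0_abs.
  rewrite /A [_ * eta]mulrC -IntZ// -ext0Z -IntB; [|exact: cc|by rewrite ext0Z; exact: ccontZ].
  rewrite -ext0B; apply: le_Int.
  - rewrite ext0B; apply: ccontD; first exact: cc; rewrite ext0Z.
    rewrite (_ : (fun _ => - _) = (fun x => (- eta) * ext0 D (fun x => density G x * chi x *
        `|local_scalar G x|) x)); first exact: ccontZ.
    by apply/funext => x; rewrite mulNr.
  - exact: (cc (CkM oD eC RC)).
  - apply: le_ext0 => x Dx.
    have dc : 0 <= density G x * chi x.
      by rewrite mulr_ge0 ?chi0// ltW// (density_gt0 HG Dx).
    have := we x Dx.
    have alg (dc' r e : R) : 0 <= dc' -> `|e - 1| <= eta ->
        dc' * r - eta * (dc' * `|r|) <= dc' * (e * r).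
      move=> dc0 He; rewrite mulrCA -mulrBr ler_wpM2l// lerBlDr -lerBlDl.
      rewrite -[X in X - _]mul1r -mulrBl (le_trans (ler_norm _))// normrM distrC.
      by rewrite ler_wpM2r.
    exact: alg.
apply: le_trans step1; rewrite mulrDl opprD addrA lerB//.
have -> : 2 * (n%:R - 1) * B * eta = 2 * (n%:R - 1) * (eta * B) by ring.
by rewrite ler_wpM2l.
Qed.

(** The inequality [scalar_bound_laplacian] tested against [chi]. The pointwise bound is used
    without the volume factor of [G'], so the Laplacian of [w] itself appears, and the exponential
    multiplies the fixed function [s]. *)
Lemma Int_scalar_bound (s : 'rV[R]_n -> R) : Ck 0 D s -> exists C : R, 0 <= C /\
  forall (w : 'rV[R]_n -> R) G' (eta : R), Ck 2 D w ->
  (forall y, D y -> G' y = expR (2 * w y) *: G y) ->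
  (forall y, D y -> s y <= local_scalar G' y) ->
  (forall y, D y -> `|expR (2 * w y) - 1| <= eta) ->
  (forall y, D y -> `|w y| <= eta) -> 0 <= eta ->
  - (C * eta) <= Int (ext0 D (fun x => density G x * chi x * (local_scalar G x - s x))).
Proof.
move=> sC.
pose A := Int (ext0 D (fun x => density G x * chi x * `|s x|)).
pose B := Int (ext0 D (fun x => density G x * `|local_laplacian G chi x|)).
have RC := Ck_local_scalar HG.
have A0 : 0 <= A.
  rewrite -(@Int0 R n); apply: le_Int; [exact: ccont0|by apply: cc; exact: Ck0_abs|].
  apply: ext0_ge0 => x Dx.
  by rewrite !mulr_ge0// ?chi0// ltW// (density_gt0 HG Dx).
have B0 : 0 <= B.
  rewrite -(@Int0 R n); apply: le_Int; [exact: ccont0|exact: ccla|].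
  apply: ext0_ge0 => x Dx.
  by rewrite !mulr_ge0// ltW// (density_gt0 HG Dx).
have n1 : 0 <= 2 * (n%:R - 1) :> R by rewrite mulr_ge0// subr_ge0 ler1n ltnW.
exists (2 * (n%:R - 1) * B + A); split; first by rewrite addr_ge0// mulr_ge0.
move=> w G' eta wC G'E sG we wp eta0.
have [_ HL] := Int_lap_ge wC wp.
have cL : ccont (ext0 D (fun x => density G x * chi x * local_laplacian G w x)).
  by apply: cc; exact: (Ck_local_laplacian HG).
have cA : ccont (ext0 D (fun x => density G x * chi x * `|s x|)).
  by apply: cc; exact: Ck0_abs.
apply: (@le_trans _ _ (2 * (n%:R - 1) * Int (ext0 D (fun x => density G x * chi x * local_laplacian G w x))
   - eta * A)).
  rewrite mulrDl opprD [A * eta]mulrC lerB//.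
  have -> : 2 * (n%:R - 1) * B * eta = 2 * (n%:R - 1) * (eta * B) by ring.
  by rewrite -mulrN ler_wpM2l.
rewrite /A -!IntZ// -!ext0Z -IntB; [|by rewrite ext0Z; exact: ccontZ..].
rewrite -ext0B; apply: le_Int.
- rewrite ext0B; apply: ccontD; first by rewrite ext0Z; exact: ccontZ.
  rewrite ext0Z (_ : (fun _ => - _) = (fun x => (- eta) * ext0 D (fun x => density G x * chi x *
        `|s x|) x)); first exact: ccontZ.
  by apply/funext => x; rewrite mulNr.
- exact: (cc (CkB oD RC sC)).
apply: le_ext0 => x Dx.
have dc : 0 <= density G x * chi x.
  by rewrite mulr_ge0 ?chi0// ltW// (density_gt0 HG Dx).
have := scalar_bound_laplacian wC G'E Dx (sG x Dx).
have := we x Dx.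
have alg (dc' r e k l t : R) : 0 <= dc' -> `|e - 1| <= eta -> e * t <= r - k * l ->
    k * (dc' * l) - eta * (dc' * `|t|) <= dc' * (r - t).
  move=> dc0 He H.
  have -> : k * (dc' * l) - eta * (dc' * `|t|) = dc' * (k * l - eta * `|t|) by ring.
  rewrite ler_wpM2l//.
  have : `|(1 - e) * t| <= eta * `|t| by rewrite normrM ler_wpM2r// distrC.
  rewrite ler_norml => /andP[_]; rewrite mulrBl mul1r; lra.
exact: alg.
Qed.

End chart_inequalities.

(** * Partitions of unity *)

Section bump_functions.
Context {R : realType}.

Definition pospart (s : R) : R := Num.max 0 s.

Lemma pospart_ge0 s : 0 <= pospart s.
Proof. by rewrite /pospart le_max lexx. Qed.

Lemma pospart_gt0 s : 0 < s -> pospart s = s.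
Proof. by move=> s0; rewrite /pospart; apply/max_idPr/ltW. Qed.

Lemma pospart_le0 s : s <= 0 -> pospart s = 0.
Proof. by move=> s0; rewrite /pospart; apply/max_idPl. Qed.

Lemma is_derive1_expn (m : nat) (t : R) :
  is_derive t 1 (fun s => s ^+ m.+1) (m.+1%:R * t ^+ m).
Proof.
elim: m => [|m IH].
  rewrite expr0 mulr1; exact: is_derive_id.
have := @is_deriveM R _ (fun s : R => s) _ t 1 1 _ (is_derive_id _ _) IH.
rewrite /GRing.scale/= mulr1 => h.
have -> : (fun s : R => s ^+ m.+2) = (fun s : R => s) * (fun s : R => s ^+ m.+1).
  by apply/funext => s; rewrite exprS.
apply: is_derive_eq h _; rewrite -[m.+2]addn1 natrD exprS; ring.
Qed.

(** At 0 the difference quotient is at most [|h| ^+ m.+1] in absolute value, so the power glues to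
    the zero function with derivative 0. *)
Lemma is_derive_pospartX (m : nat) (t : R) :
  is_derive t 1 (fun s => pospart s ^+ m.+2) (m.+2%:R * pospart t ^+ m.+1).
Proof.
have [t0|t0|<-] := ltrgtP 0 t.
- have h : is_derive t (1 : R) (fun s : R => s ^+ m.+2) (m.+2%:R * t ^+ m.+1).
    exact: is_derive1_expn.
  rewrite pospart_gt0//; apply: near_eq_is_derive h.
  have : nbhs t [set s : R | 0 < s] by apply: open_nbhs_nbhs; split => //; exact: open_gt.
  by apply: filterS => s /= s0; rewrite pospart_gt0.
- rewrite pospart_le0 ?ltW// exprS mul0r mulr0.
  have h : is_derive t (1 : R) (fun s : R => 0 : R) 0 by exact: is_derive_cst.
  apply: near_eq_is_derive h.
  have : nbhs t [set s : R | s < 0] by apply: open_nbhs_nbhs; split => //; exact: open_lt.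
  by apply: filterS => s /= s0; rewrite pospart_le0 ?ltW// exprS mul0r.
rewrite pospart_le0// exprS mul0r mulr0.
have H : h^-1 *: (pospart (h *: 1 + 0) ^+ m.+2 - pospart 0 ^+ m.+2) @[h --> (0 : R)^'] --> (0 : R).
  have hm : `|h| ^+ m.+1 @[h --> (0 : R)^'] --> (0 : R).
    have c : continuous (fun h : R => `|h| ^+ m.+1).
      move=> x; apply: (@continuous_comp _ _ _ (fun h : R => `|h|) (fun y => y ^+ m.+1)).
        exact: norm_continuous.
      exact: exprn_continuous.
    by have := c 0; rewrite /prop_for /continuous_at normr0 exprS mul0r => /cvg_within_filter; exact.
  apply: (@norm_cvg0 _ _ _ _ _ _).
  apply: (squeeze_cvgr _ (cvg_cst 0) hm); near=> h.
  rewrite normr_ge0/= addr0 [_ *: 1]mulr1 [pospart 0]pospart_le0// expr0n/= subr0.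
  rewrite normrM normfV normrX (ger0_norm (pospart_ge0 _)).
  have h0 : h != 0 by near: h; exact: nbhs_dnbhs_neq.
  rewrite ler_pdivrMl ?normr_gt0// -exprS lerXn2r ?nnegrE ?pospart_ge0//.
  by rewrite /pospart ge_max normr_ge0 ler_norm.
apply: DeriveDef; first by apply/cvg_ex; exists 0.
by apply: cvg_lim => //; exact: Rhausdorff.
Unshelve. all: by end_near. Qed.

Lemma continuous_pospart : continuous pospart.
Proof. by move=> x; apply: continuous_max; [exact: cst_continuous|exact: cvg_id]. Qed.

Lemma Ck_pospartX n (D : set 'rV[R]_n) (f : 'rV[R]_n -> R) k : open D -> Ck k D f ->
  Ck k D (fun x => pospart (f x) ^+ k.+1).
Proof.
move=> oD; elim: k f => [|k IH] f fC.
  apply/Ck0P => x Dx.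
  apply: (@continuous_comp _ _ _ f pospart); last exact: continuous_pospart.
  exact: Ck_continuous fC Dx.
apply: (@Ck_is_deriveS _ _ _ _ _ (fun a x => k.+2%:R * pospart (f x) ^+ k.+1 * pderiv a f x)) => //.
- move=> x Dx; apply: (@continuous_comp _ _ _ f (fun s => pospart s ^+ k.+2)).
    exact: Ck_continuous fC Dx.
  exact: is_derive1_continuous (is_derive_pospartX _ _).
- move=> a x Dx.
  exact: (is_derive_comp1 (Ck_is_derive a fC Dx) (is_derive_pospartX k (f x))).
- by move=> a; exact: (CkM oD (CkZ _ oD (IH _ (CkW fC))) (Ck_pderiv a fC)).
Qed.

(** The cube of a positive part is of class C^2, which is the regularity of the metrics. The set
    where it is positive is a Euclidean ball, contained in the ball [cball c r] of the maximum
    norm. *)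
Definition bump n (c : 'rV[R]_n) (r : R) (x : 'rV[R]_n) : R :=
  pospart (r ^+ 2 - \sum_b (x 0 b - c 0 b) ^+ 2) ^+ 3.

Lemma bump_ge0 n (c : 'rV[R]_n) r x : 0 <= bump c r x.
Proof. by rewrite exprn_ge0// pospart_ge0. Qed.

Lemma bump_center n (c : 'rV[R]_n) r : 0 < r -> 0 < bump c r c.
Proof.
move=> r0; rewrite exprn_gt0// big1 ?subr0 => [|b _].
  by rewrite pospart_gt0 exprn_gt0.
by rewrite subrr expr0n.
Qed.

Lemma bump_out n (c : 'rV[R]_n) r x : 0 < r -> r < `|x - c| -> bump c r x = 0.
Proof.
move=> r0 xr; rewrite /bump pospart_le0 ?expr0n//.
have [b br] : exists b, r < `|(x - c) 0 b|.
  apply: contrapT => /forallNP H; move: xr; apply/negP; rewrite -leNgt.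
  apply: norm_row_le => [|b]; first exact: ltW.
  by rewrite leNgt; apply/negP; exact: H.
rewrite subr_le0 (bigD1 b)//= -[leLHS]addr0 lerD//; last first.
  by apply: sumr_ge0 => i _; exact: sqr_ge0.
move: br; rewrite !mxE => br.
by rewrite -[leRHS]real_normK ?num_real// lerXn2r ?nnegrE// ltW.
Qed.

Lemma Ck_bump m n (D : set 'rV[R]_m) (T : 'rV[R]_m -> 'rV[R]_n) c r : open D ->
  (forall b, Ck 2 D (fun x => T x 0 b)) -> Ck 2 D (fun x => bump c r (T x)).
Proof.
move=> oD TC; apply: (Ck_pospartX oD).
apply: (CkB oD); first exact: (Ck_cst _ (r ^+ 2) oD).
apply: (Ck_sum _ _ oD) => b; apply: (CkX _ oD).
exact: (CkB oD (TC b) (Ck_cst _ (c 0 b) oD)).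
Qed.

Definition cball n (c : 'rV[R]_n) (r : R) : set 'rV[R]_n := [set x | `|x - c| <= r].

Lemma compact_cball n (c : 'rV[R]_n) r : compact (cball c r).
Proof.
apply: bounded_closed_compact.
  exists (`|c| + r); split; first exact: num_real.
  move=> N rN x /= xr; apply: le_trans (ltW rN).
  by rewrite -[x](subrK c) (le_trans (ler_normD _ _))// addrC lerD2l.
have -> : cball c r = closed_ball_ (fun x => `|x|) c r.
  by apply/seteqP; split=> x; rewrite /cball /closed_ball_/= distrC.
exact: closed_closed_ball_.
Qed.

Lemma cball_sub_open n (D : set 'rV[R]_n) x : open D -> D x ->
  exists2 r : R, 0 < r & cball x r `<=` D.
Proof.
move=> oD Dx; have /nbhs_ballP[e /= e0 eD] : nbhs x D by exact: open_nbhs_nbhs.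
exists (e / 2); first by rewrite divr_gt0.
move=> y /= yx; apply: eD; rewrite -ball_normE/= distrC (le_lt_trans yx)//.
by rewrite ltr_pdivrMr// ltr_pMr// ltr1n.
Qed.

(** [Ck] is a conjunction of conditions at the individual points of the set, stated with globally
    defined partial derivatives, so it can be checked at each point with a set of its own. *)
Lemma Ck_pointwise n k (D : set 'rV[R]_n) (f : 'rV[R]_n -> R) :
  (forall x, D x -> exists2 U : set 'rV[R]_n, U x & Ck k U f) -> Ck k D f.
Proof.
Transparent Ck.
elim: k f => [|k IH] f H; (split; first by move=> x /H[U Ux /Ck_continuous]; exact) => //.
move=> a; split; first by move=> x /H[U Ux [_ /(_ a)[+ _]]]; exact.
by apply: IH => x /H[U Ux [_ /(_ a)[_ ?]]]; exists U.
Opaque Ck.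
Qed.

End bump_functions.

(* [vector.coord] would shadow the field of [chart]. *)
Local Notation coord := Defs.coord.

Section manifold_functions.
Context {R : realType} {n : nat} {M : ptopologicalType} (A : smooth_atlas R n M).
Implicit Types (f : M -> R) (i j : chart_index A) (p : M).

Lemma open_param i (O : set M) : open O -> open [set x | cod (A i) x /\ O (param (A i) x)].
Proof.
move=> oO; rewrite openE => x [cx Ox].
apply: filterI.
  by apply: open_nbhs_nbhs; split => //; exact: cod_open.
by apply: (param_continuous cx); apply: open_nbhs_nbhs.
Qed.

Lemma open_overlap i j : open (overlap (A i) (A j)).
Proof. by apply: open_param; exact: dom_open. Qed.

Lemma continuous_charts f :
  (forall i x, cod (A i) x -> {for x, continuous (f \o param (A i))}) -> continuous f.
Proof.
move=> H p; have [i dp] := atlas_cover A p.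
have cp := coord_cod dp.
have fE : {near p, (f \o param (A i)) \o coord (A i) =1 f}.
  have : nbhs p (dom (A i)) by apply: open_nbhs_nbhs; split => //; exact: dom_open.
  by apply: filterS => q dq /=; rewrite coordK.
have h : {for p, continuous ((f \o param (A i)) \o coord (A i))}.
  by apply: continuous_comp; [exact: Defs.coord_continuous|exact: H].
move: h; rewrite /prop_for /continuous_at /= coordK// => h.
by apply: cvg_trans h; apply: (@near_eq_cvg _ _ (nbhs p)).
Qed.

Lemma Ck_fun_continuous k f : Ck_fun A k f -> continuous f.
Proof. by move=> fC; apply: continuous_charts => i; exact: Ck_continuous_on (fC i). Qed.

Lemma continuous_param_comp i f x : continuous f -> cod (A i) x ->
  {for x, continuous (f \o param (A i))}.
Proof. by move=> cf cx; apply: continuous_comp; [exact: param_continuous|exact: cf]. Qed.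

Definition mbump i (c : 'rV[R]_n) (r : R) : M -> R :=
  fun p => if `[< dom (A i) p >] then bump c r (coord (A i) p) else 0.

Hypothesis hM : hausdorff_space M.

Lemma closed_param_compact i (K : set 'rV[R]_n) : compact K -> K `<=` cod (A i) ->
  closed (param (A i) @` K).
Proof.
move=> cK Kc; apply: compact_closed => //; apply: continuous_compact => //.
apply: continuous_in_subspaceT => x /[!inE] Kx; apply: param_continuous; exact: Kc.
Qed.

(** At a point of the chart [A i] this is the regularity of the transition map. At any other point,
    the image of the closed ball is compact, hence closed as [M] is Hausdorff, and the function
    vanishes on the open complement. *)
Lemma Ck_mbump i c r : 0 < r -> cball c r `<=` cod (A i) -> Ck_fun A 2 (mbump i c r).
Proof.
move=> r0 Kc j; apply: Ck_pointwise => x cx.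
have [dx|dx] := pselect (dom (A i) (param (A j) x)).
  exists (overlap (A j) (A i)) => //.
  apply: (@Ck_eq _ _ _ _ (fun x => bump c r (coord (A i) (param (A j) x)))).
  - exact: open_overlap.
  - by move=> y [_ dy]; rewrite /= /mbump; case: asboolP.
  - apply: Ck_bump; first exact: open_overlap.
    by move=> b; exact: (atlas_smooth (s := A)).
have oU : open [set x | cod (A j) x /\ (~` (param (A i) @` cball c r)) (param (A j) x)].
  apply: open_param; rewrite openC; apply: closed_param_compact => //.
  exact: compact_cball.
exists [set x | cod (A j) x /\ (~` (param (A i) @` cball c r)) (param (A j) x)].
  by split => // -[y yK yx]; apply: dx; rewrite -yx; apply: param_dom; exact: Kc.
apply: Ck_eq (Ck_cst _ 0 oU) => // y [cy Ky].
rewrite /= /mbump; case: asboolP => // dy; rewrite bump_out//.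
rewrite ltNge; apply/negP => yK; apply: Ky.
by exists (coord (A i) (param (A j) y)) => //; rewrite coordK.
Qed.

Lemma Ck_funM k f h : Ck_fun A k f -> Ck_fun A k h -> Ck_fun A k (fun p => f p * h p).
Proof. move=> fC hC i; exact: (CkM (@cod_open _ _ _ (A i)) (fC i) (hC i)). Qed.

Lemma Ck_funV k f : (forall p, f p != 0) -> Ck_fun A k f -> Ck_fun A k (fun p => (f p)^-1).
Proof.
move=> f0 fC i; exact: (CkV (@cod_open _ _ _ (A i)) (fun x _ => f0 (param (A i) x)) (fC i)).
Qed.

Lemma Ck_fun_sum k (I : Type) (s : seq I) (F : I -> M -> R) :
  (forall q, Ck_fun A k (F q)) -> Ck_fun A k (fun p => \sum_(q <- s) F q p).
Proof.
move=> FC i; exact: (Ck_sum s xpredT (@cod_open _ _ _ (A i)) (fun q => FC q i)).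
Qed.

(** Each point [q] carries a chart and a bump centred at it, so points of [M] serve as indices.
    Compactness selects finitely many bumps with positive sum [Psi], and dividing by [Psi]
    normalizes them. *)
Lemma partition_of_unity : compact [set: M] ->
  exists (s : seq M) (idx : M -> chart_index A) (K : M -> set 'rV[R]_n) (chi : M -> M -> R),
  (forall q, [/\ compact (K q), K q `<=` cod (A (idx q)), Ck_fun A 2 (chi q) &
     forall p, 0 <= chi q p /\
       (chi q p != 0 -> dom (A (idx q)) p /\ K q (coord (A (idx q)) p))]) /\
  (forall p, \sum_(q <- s) chi q p = 1).
Proof.
move=> cM.
have /choice[ir irP] : forall q : M, exists ir : chart_index A * R,
    [/\ dom (A ir.1) q, 0 < ir.2 & cball (coord (A ir.1) q) ir.2 `<=` cod (A ir.1)].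
  move=> q; have [i dq] := atlas_cover A q.
  have [r r0 rD] := cball_sub_open (@cod_open _ _ _ (A i)) (coord_cod dq).
  by exists (i, r).
pose i q := (ir q).1; pose r q := (ir q).2; pose c q := coord (A (i q)) q.
pose b q := mbump (i q) (c q) (r q).
have bC q : Ck_fun A 2 (b q) by have [_ r0 rD] := irP q; exact: Ck_mbump.
have b0 q p : 0 <= b q p by rewrite /b /mbump; case: asboolP => // _; exact: bump_ge0.
have bq q : 0 < b q q.
  have [dq r0 _] := irP q; rewrite /b /mbump; case: asboolP => // _.
  exact: bump_center.
have bs q p : b q p != 0 -> dom (A (i q)) p /\ cball (c q) (r q) (coord (A (i q)) p).
  have [_ r0 _] := irP q; rewrite /b /mbump; case: asboolP => [dp|_]; last by rewrite eqxx.
  move=> H; split => //; rewrite /cball/= leNgt; apply/negP => /(bump_out r0) E.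
  by move: H; rewrite E eqxx.
have oV q : open [set p | 0 < b q p].
  have /continuousP cb := Ck_fun_continuous (bC q).
  exact: (cb _ (@open_gt R 0)).
have := cM; rewrite compact_cover => /(_ M setT (fun q => [set p | 0 < b q p])).
case=> [q _|p _|s' _ s'P]; [exact: oV|by exists p => //; exact: bq|].
pose s := finmap.enum_fset s'.
pose Psi p := \sum_(q <- s) b q p.
have Psi0 p : 0 < Psi p.
  have [q qs bqp] := s'P p I.
  have qs' : q \in s by [].
  rewrite /Psi (big_rem q)//= ltr_wpDr//.
  by rewrite big_seq; apply: sumr_ge0.
exists s, i, (fun q => cball (c q) (r q)), (fun q p => b q p / Psi p); split; last first.
  by move=> p; rewrite -big_distrl/= -/(Psi p) divff// gt_eqF.
move=> q; have [_ r0 rD] := irP q; split => //.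
- exact: compact_cball.
- apply: Ck_funM => //; apply: Ck_funV; last exact: Ck_fun_sum.
  by move=> p; rewrite gt_eqF// Psi0.
- move=> p; split; first by rewrite divr_ge0// ltW.
  by move=> H; apply: bs; apply: contraNneq H => ->; rewrite mul0r.
Qed.

Lemma local_C2metric_chart (g : C2metric A) i :
  local_C2metric (cod (A i)) (local_metric g i).
Proof.
split.
- exact: cod_open.
- by move=> x _; exact: gram_sym.
- by move=> x cx v v0; apply: gram_pos => //; exact: param_dom.
- by move=> a b; exact: gram_C2.
Qed.

End manifold_functions.

(** * Riemannian volume *)

Section weighted_measure.
Context d (X : measurableType d) (R : realType).
Variables (mu : {measure set X -> \bar R}) (f : X -> R).
Hypotheses (mf : measurable_fun setT f) (f0 : forall x, 0 <= f x).

(** The measure with density [f]. With [f = e^{nw}] it produces the volume of [e^{2w} g] from that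
    of [g]. *)
Definition weighted (B : set X) : \bar R := (\int[mu]_(x in B) (f x)%:E)%E.

Let weighted0 : weighted set0 = 0%E.
Proof. exact: integral_set0. Qed.

Let weighted_ge0 B : (0 <= weighted B)%E.
Proof. by apply: integral_ge0 => x _; rewrite lee_fin. Qed.

Let weighted_sigma_additive : semi_sigma_additive weighted.
Proof.
move=> F mF tF mUF; rewrite /weighted ge0_integral_bigcup//.
- by apply: is_cvg_ereal_nneg_natsum_cond => n _ _; exact: weighted_ge0.
- by apply/measurable_EFinP; exact: measurable_funTS.
- by move=> x _; rewrite lee_fin.
Qed.

HB.instance Definition _ := isMeasure.Build _ _ _ weighted
  weighted0 weighted_ge0 weighted_sigma_additive.

Definition weighted_meas : {measure set X -> \bar R} := weighted.

End weighted_measure.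

Section riemannian_integral.
Context {R : realType} {n : nat} {M : ptopologicalType} (A : smooth_atlas R n M).
Local Notation mR := (measurableTypeR R).
Implicit Types (g : C2metric A) (i : chart_index A).

Lemma borel_open (O : set M) : open O -> measurable (O : set (@borel M)).
Proof. by move=> oO; exact: sub_sigma_algebra. Qed.

Lemma borel_continuous (f : M -> R) : continuous f ->
  measurable_fun [set: @borel M] (f : @borel M -> R).
Proof.
move=> /continuousP cf; apply: open_measurable_fun => U oU; rewrite setTI.
by apply: borel_open; exact: cf.
Qed.

Definition chart_tuples i : set (n.-tuple mR) := [set t | cod (A i) (row_of_tuple t)].

Definition param_tuple i (t : n.-tuple mR) : @borel M := param (A i) (row_of_tuple t).

Lemma measurable_chart_tuples i : measurable (chart_tuples i).
Proof. by apply: measurable_row_open; exact: cod_open. Qed.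

Lemma measurable_param_tuple i : measurable_fun (chart_tuples i) (param_tuple i).
Proof.
apply: (@measurability _ _ _ (@borel M) _ _ (@open M)) => //.
move=> _ [V oV <-].
have -> : chart_tuples i `&` param_tuple i @^-1` V =
   [set t | [set x | cod (A i) x /\ V (param (A i) x)] (row_of_tuple t)] by [].
by apply: measurable_row_open; exact: open_param.
Qed.

Lemma measurable_row_on (D : set 'rV[R]_n) (f : 'rV[R]_n -> R) : open D ->
  (forall x, D x -> {for x, continuous f}) ->
  measurable_fun [set t : n.-tuple mR | D (row_of_tuple t)]
    (fun t : n.-tuple mR => f (row_of_tuple t)).
Proof.
move=> oD cf; apply: open_measurable_fun => U oU.
have -> : [set t : n.-tuple mR | D (row_of_tuple t)] `&`
    (fun t : n.-tuple mR => f (row_of_tuple t)) @^-1` U =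
    [set t | (D `&` f @^-1` U) (row_of_tuple t)] by [].
apply: measurable_row_open; rewrite openE => x [Dx Ux].
apply: filterI; first by apply: open_nbhs_nbhs.
by apply: (cf x Dx); apply: open_nbhs_nbhs.
Qed.

(** [is_riemannian_volume] integrates over an image under [coord]; as a preimage under the
    parametrization, this set is visibly measurable. *)
Lemma chart_image i (B : set M) : B `<=` dom (A i) ->
  [set t : n.-tuple mR | (coord (A i) @` B) (row_of_tuple t)] =
  chart_tuples i `&` param_tuple i @^-1` B.
Proof.
move=> Bd; apply/seteqP; split=> t /=.
  move=> [p Bp pt]; have dp := Bd _ Bp; split.
    by rewrite /chart_tuples/= -pt; exact: coord_cod.
  by rewrite /= /param_tuple -pt coordK.
move=> [ct Bt]; exists (param_tuple i t) => //.
by rewrite /param_tuple paramK.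
Qed.

Definition chart_integrand g i (f : M -> R) : 'rV[R]_n -> R :=
  ext0 (cod (A i)) (fun x => density (local_metric g i) x * f (param (A i) x)).

Definition supported_in i (K : set 'rV[R]_n) (f : M -> R) : Prop :=
  [/\ compact K, K `<=` cod (A i), continuous f &
      forall p, f p != 0 -> dom (A i) p /\ K (coord (A i) p)].

Lemma ccont_chart_integrand g i K f : supported_in i K f -> ccont (chart_integrand g i f).
Proof.
move=> [cK Kc cf fK]; apply: (ccont_ext0 (@cod_open _ _ _ (A i)) cK Kc).
  move=> x cx Kx; have [->|/fK[_]] := eqVneq (f (param (A i) x)) 0; first by rewrite mulr0.
  by rewrite paramK.
have d0 := Ck_density (local_C2metric_chart g i) (isT : (0 <= 2)%N).
have f0 : Ck 0 (cod (A i)) (f \o param (A i)).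
  by apply/Ck0P => x cx; exact: continuous_param_comp.
exact: (Ck_continuous_on (CkM (@cod_open _ _ _ (A i)) d0 f0)).
Qed.

Section fixed_volume.
Variables (g : C2metric A) (mu : {measure set (@borel M) -> \bar R}).
Hypothesis mu_vol : is_riemannian_volume g mu.

Lemma integral_chart i (B : set M) (f : @borel M -> \bar R) :
  measurable (B : set (@borel M)) -> B `<=` dom (A i) ->
  measurable_fun (B : set (@borel M)) f ->
  (forall p, B p -> (0 <= f p)%E) ->
  (\int[mu]_(p in B) f p = \int[lebesgue_tuple n]_(t in chart_tuples i `&` param_tuple i @^-1` B)
     (f (param_tuple i t) * (density (local_metric g i) (row_of_tuple t))%:E))%E.
Proof.
move=> mB Bd mf f0.
have mS : measurable (chart_tuples i `&` param_tuple i @^-1` B).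
  by apply: measurable_param_tuple => //; exact: measurable_chart_tuples.
apply: (@ge0_integral_density _ _ _ _ _ mu (lebesgue_tuple n) (param_tuple i) _ B
  (fun t => density (local_metric g i) (row_of_tuple t))) => //.
- move=> _ C mC; rewrite -setIA -preimage_setI.
  apply: measurable_param_tuple; first exact: measurable_chart_tuples.
  exact: measurableI.
- have h := measurable_row_on (@cod_open _ _ _ (A i)) (Ck_continuous_on
    (Ck_density (local_C2metric_chart g i) (isT : (0 <= 2)%N))).
  by apply: (measurable_funS (measurable_chart_tuples i) _ h) => t [].
- by move=> t _; rewrite /density sqrtr_ge0.
- by move=> t [].
move=> C mC CB; rewrite (@mu_vol i C mC (subset_trans CB Bd)).
congr (integral _ _ _); rewrite chart_image//; last exact: subset_trans Bd.
apply/seteqP; split=> t /=.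
  by move=> [ct Ct]; split => //; split => //; exact: CB.
by move=> [[ct _] Ct].
Qed.

Lemma ge0_integral_supported i K f : supported_in i K f -> (forall p, 0 <= f p) ->
  (\int[mu]_p (f p)%:E =
   \int[lebesgue_tuple n]_t (chart_integrand g i f (row_of_tuple t))%:E)%E.
Proof.
move=> [cK Kc cf fK] f0.
have od : measurable (dom (A i) : set (@borel M)) by apply: borel_open; exact: dom_open.
have mf := borel_continuous cf.
have -> : (\int[mu]_p (f p)%:E = \int[mu]_(p in (dom (A i) : set (@borel M))) (f p)%:E)%E.
  rewrite [RHS]integral_mkcond; apply: eq_integral => p _; rewrite patchE.
  case: ifPn => // /negP dp; congr (_%:E); apply/eqP/negPn/negP => /fK[d _].
  by apply: dp; rewrite inE.
rewrite (@integral_chart i)//; last 2 first.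
- by apply/measurable_EFinP; exact: measurable_funTS.
- by move=> p _; rewrite lee_fin.
rewrite integral_mkcond; apply: eq_integral => t _; rewrite patchE /chart_integrand.
case: ifPn => [|/negP ct].
  by rewrite inE => -[ct _]; rewrite ext0E// -EFinM mulrC.
rewrite /ext0; case: asboolP => // cx; exfalso; apply: ct; rewrite inE; split => //.
exact: param_dom.
Qed.

Lemma integral_supported i K f : supported_in i K f ->
  mu.-integrable setT (EFin \o (f : @borel M -> R)) /\
  \int[mu]_p f p = Int (chart_integrand g i f).
Proof.
have ge0 h : supported_in i K h -> (forall p, 0 <= h p) ->
    mu.-integrable setT (EFin \o (h : @borel M -> R)) /\
    \int[mu]_p h p = Int (chart_integrand g i h).
  move=> hs h0; have E := ge0_integral_supported hs h0; split.
    apply/integrableP; split.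
      by apply/measurable_EFinP; apply: borel_continuous; case: hs.
    have -> : (\int[mu]_x `|(EFin \o (h : @borel M -> R)) x| = \int[mu]_p (h p)%:E)%E.
      by apply: eq_integral => p _; rewrite /= ger0_norm.
    rewrite E; have := ccont_integrable (ccont_chart_integrand g hs).
    by move=> /integrable_lty; apply.
  by rewrite /Rintegral E.
move=> fs; have [cK Kc cf fK] := fs.
have cabs : continuous (fun p => `|f p|).
  by move=> p; apply: (@continuous_comp _ _ _ f (fun y : R => `|y|)); [exact: cf|exact: norm_continuous].
(* [f = h2 - h1] with both functions nonnegative, continuous and supported where [f] is, so the
   nonnegative case applies to each. *)
pose h1 p := `|f p|; pose h2 p := `|f p| + f p.
have s1 : supported_in i K h1.
  by split => // p; rewrite normr_eq0; exact: fK.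
have s2 : supported_in i K h2.
  split => //; first by move=> p; apply: (@continuousD _ _ _ h1 f); [exact: cabs|exact: cf].
  by move=> p H; apply: fK; apply: contraNneq H => E; rewrite /h2 E normr0 addr0.
have [i1 e1] := ge0 _ s1 (fun p => normr_ge0 _).
have [i2 e2] : mu.-integrable setT (EFin \o (h2 : @borel M -> R)) /\
    \int[mu]_p h2 p = Int (chart_integrand g i h2).
  apply: ge0 => // p; rewrite /h2 -lerBlDr sub0r -normrN; exact: ler_norm.
have fE : f = (fun p => h2 p - h1 p) by apply/funext => p; rewrite /h2 /h1 addrAC subrr add0r.
split.
  have := integrableB measurableT i2 i1.
  apply: eq_integrable => // p _ /=; by rewrite -EFinB [in RHS]fE.
have -> : \int[mu]_p f p = \int[mu]_p (h2 p - h1 p) by rewrite {1}fE.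
rewrite RintegralB// e1 e2 -IntB; [|exact: ccont_chart_integrand s2|exact: ccont_chart_integrand s1].
congr Int; rewrite /chart_integrand -ext0B; apply: eq_ext0 => x cx.
by rewrite [in RHS]fE mulrBr.
Qed.

(** A Riemannian volume is prescribed inside single charts only, so an integral over [M] is computed
    by cutting the integrand into pieces that each live in one chart. *)
Lemma integral_partition (s : seq M) (idx : M -> chart_index A)
    (K : M -> set 'rV[R]_n) (chi : M -> M -> R) (f : M -> R) :
  (forall q, supported_in (idx q) (K q) (fun p => chi q p * f p)) ->
  (forall p, \sum_(q <- s) chi q p = 1) ->
  \int[mu]_p f p = \sum_(q <- s) Int (chart_integrand g (idx q) (fun p => chi q p * f p)).
Proof.
move=> H chi1.
have -> : \int[mu]_p f p = \int[mu]_p (\sum_(q <- s) chi q p * f p).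
  by apply: eq_Rintegral => p _; rewrite -big_distrl/= chi1 mul1r.
have : mu.-integrable setT (EFin \o (fun p : @borel M => \sum_(q <- s) chi q p * f p)) /\
   \int[mu]_p (\sum_(q <- s) chi q p * f p) =
   \sum_(q <- s) Int (chart_integrand g (idx q) (fun p => chi q p * f p)); last by case.
elim: s {chi1} => [|q s [IH1 IH2]].
  have E : (fun p : @borel M => \sum_(q <- [::]) chi q p * f p) = cst 0.
    by apply/funext => p; rewrite big_nil.
  rewrite E big_nil; split; first exact: integrable0.
  by rewrite /Rintegral integral0_eq.
have [iq eq] := integral_supported (H q).
have E : (fun p : @borel M => \sum_(q <- q :: s) chi q p * f p) =
    (fun p => chi q p * f p + \sum_(q <- s) chi q p * f p).
  by apply/funext => p; rewrite big_cons.
split.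
  rewrite E; have := integrableD measurableT iq IH1.
  by apply: eq_integrable => // p _.
have -> : \int[mu]_p (\sum_(q <- q :: s) chi q p * f p) =
    \int[mu]_p (chi q p * f p + \sum_(q <- s) chi q p * f p).
  by apply: eq_Rintegral => p _; rewrite big_cons.
by rewrite RintegralD// big_cons eq IH2.
Qed.

End fixed_volume.

Definition conformal_exp (w : M -> R) g g' : Prop :=
  forall i p, g' i p = expR (2 * w p) *: g i p.

Lemma local_conformal_exp w g g' i : conformal_exp w g g' -> forall x,
  local_metric g' i x = expR (2 * (w \o param (A i)) x) *: local_metric g i x.
Proof. by move=> H x; exact: H. Qed.

(** The weight [e^{nw}] is the ratio of the two densities in every chart. Used in both directions,
    by [conformal_exp_sym], this shows that the two metrics either both have a volume or both lack
    one. *)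
Lemma volume_conformal w g g' : continuous w -> conformal_exp w g g' ->
  (exists mu, is_riemannian_volume g mu) -> exists mu, is_riemannian_volume g' mu.
Proof.
move=> cw H [mu mu_vol].
pose f p := expR (n%:R * w p).
have cf : continuous f.
  move=> p; apply: (@continuous_comp _ _ _ (fun p => n%:R * w p) expR).
    by apply: continuousM; [exact: cst_continuous|exact: cw].
  exact: continuous_expR.
have mf := borel_continuous cf.
have f0 p : 0 <= f p by exact: expR_ge0.
exists (weighted_meas mu mf f0) => i B mB Bd.
have -> : weighted_meas mu mf f0 B = (\int[mu]_(p in B) (f p)%:E)%E by [].
rewrite (integral_chart mu_vol mB Bd); last 2 first.
- by apply/measurable_EFinP; exact: measurable_funTS.
- by move=> p _; rewrite lee_fin.
rewrite -chart_image//; apply: eq_integral => t _; rewrite -EFinM; congr (_%:E).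
exact/esym/(density_conformal (D := setT) (w := w \o param (A i)) (fun x _ => local_conformal_exp i H x)).
Qed.

End riemannian_integral.

(** * Scalar curvature on the manifold *)

Section scalar_curvature.
Context {R : realType} {n : nat} {M : ptopologicalType} (A : smooth_atlas R n M).
Implicit Types (g : C2metric A) (i j : chart_index A).

(** The condition under which the set in [scalar_curvature] is inhabited. If it fails, [get] returns
    the zero function. *)
Definition scalar_consistent g : Prop := forall i j p, dom (A i) p -> dom (A j) p ->
  local_scalar (local_metric g i) (coord (A i) p) =
  local_scalar (local_metric g j) (coord (A j) p).

Lemma scalar_curvatureE g i p : scalar_consistent g -> dom (A i) p ->
  scalar_curvature g p = local_scalar (local_metric g i) (coord (A i) p).
Proof.
move=> cg; have /choice[c cP] := atlas_cover A.
have : exists f : M -> R, forall i p, dom (A i) p ->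
    f p = local_scalar (local_metric g i) (coord (A i) p).
  by exists (fun p => local_scalar (local_metric g (c p)) (coord (A (c p)) p)) => j q dq; exact: cg.
by move=> /getPex; apply.
Qed.

Lemma scalar_curvature_default g : ~ scalar_consistent g -> scalar_curvature g = fun=> 0.
Proof.
move=> cg; rewrite /scalar_curvature getPN// => f fP; apply: cg => i j p di dj.
by rewrite -(fP i p di) -(fP j p dj).
Qed.

Lemma scalar_curvature_continuous g : continuous (scalar_curvature g).
Proof.
have [cg|/scalar_curvature_default ->] := pselect (scalar_consistent g); last first.
  by move=> p; exact: cst_continuous.
apply: continuous_charts => i; apply/Ck0P.
apply: Ck_eq (Ck_local_scalar (local_C2metric_chart g i)); first exact: cod_open.
by move=> x cx; rewrite /= (scalar_curvatureE cg (param_dom cx)) paramK.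
Qed.

Lemma local_C2metric_subset (D E : set 'rV[R]_n) G : open E -> E `<=` D ->
  local_C2metric D G -> local_C2metric E G.
Proof.
move=> oE ED [oD s p C2]; split => //.
- by move=> x /ED/s.
- by move=> x /ED/p.
- by move=> a b; exact: Ck_subset ED (C2 a b).
Qed.

Section two_charts.
Variables (g : C2metric A) (i j : chart_index A) (f : M -> R).
Hypothesis fC : Ck_fun A 2 f.

Let T x := coord (A j) (param (A i) x).

Let HG : local_C2metric (overlap (A i) (A j)) (local_metric g i).
Proof.
apply: local_C2metric_subset (local_C2metric_chart g i); first exact: open_overlap.
by move=> x [].
Qed.

Let TC b : Ck 2 (overlap (A i) (A j)) (fun x => T x 0 b).
Proof. exact: (atlas_smooth (s := A)). Qed.

Let TE x : overlap (A i) (A j) x -> cod (A j) (T x).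
Proof. by move=> [cx dx]; exact: coord_cod. Qed.

Let fE x : overlap (A i) (A j) x -> (f \o param (A i)) x = (f \o param (A j)) (T x).
Proof. by move=> [cx dx]; rewrite /= /T coordK. Qed.

Let GE x : overlap (A i) (A j) x -> local_metric g i x =
  (\matrix_(a, b) pderiv a (fun y => T y 0 b) x) *m local_metric g j (T x) *m
  (\matrix_(a, b) pderiv a (fun y => T y 0 b) x)^T.
Proof.
move=> [cx dx]; rewrite /local_metric /T coordK//.
by rewrite (gram_change g (param_dom cx) dx) /= paramK.
Qed.

Lemma laplacian_charts p : dom (A i) p -> dom (A j) p ->
  local_laplacian (local_metric g i) (f \o param (A i)) (coord (A i) p) =
  local_laplacian (local_metric g j) (f \o param (A j)) (coord (A j) p).
Proof.
move=> di dj; have ox : overlap (A i) (A j) (coord (A i) p).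
  by split; [exact: coord_cod|rewrite coordK].
rewrite (local_laplacian_change HG (local_C2metric_chart g j) TC TE (fC j) fE GE ox).
by rewrite /T coordK.
Qed.

Lemma grad2_charts p : dom (A i) p -> dom (A j) p ->
  local_grad2 (local_metric g i) (f \o param (A i)) (coord (A i) p) =
  local_grad2 (local_metric g j) (f \o param (A j)) (coord (A j) p).
Proof.
move=> di dj; have ox : overlap (A i) (A j) (coord (A i) p).
  by split; [exact: coord_cod|rewrite coordK].
rewrite (local_grad2_change HG (local_C2metric_chart g j) TC TE (fC j) fE GE ox).
by rewrite /T coordK.
Qed.

End two_charts.

Lemma conformal_exp_sym (w : M -> R) g g' : conformal_exp w g g' ->
  conformal_exp (fun p => - w p) g' g.
Proof.
by move=> H i p; rewrite H scalerA -expRD mulrN addNr expR0 scale1r.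
Qed.

Lemma Ck_funN k (w : M -> R) : Ck_fun A k w -> Ck_fun A k (fun p => - w p).
Proof. by move=> wC i; exact: (CkN (@cod_open _ _ _ (A i)) (wC i)). Qed.

(** In each chart the conformal law writes the new curvature in terms of the old one, [Delta w] and
    [|dw|^2]. The last two are coordinate invariant, so agreement of the old curvatures carries over
    to the new ones. *)
Lemma scalar_consistent_conformal (w : M -> R) g g' : Ck_fun A 2 w ->
  conformal_exp w g g' -> scalar_consistent g -> scalar_consistent g'.
Proof.
move=> wC H cg i j p di dj.
have E k : dom (A k) p -> local_scalar (local_metric g' k) (coord (A k) p) =
    expR (- (2 * w p)) * (local_scalar (local_metric g k) (coord (A k) p)
    - 2 * (n%:R - 1) * local_laplacian (local_metric g k) (w \o param (A k)) (coord (A k) p)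
    - (n%:R - 1) * (n%:R - 2) * local_grad2 (local_metric g k) (w \o param (A k)) (coord (A k) p)).
  move=> dk; rewrite (local_scalar_conformal (local_C2metric_chart g k) (wC k)
    (fun x _ => local_conformal_exp k H x) (coord_cod dk)).
  by rewrite /= coordK.
by rewrite (E i di) (E j dj) (cg i j p di dj) (laplacian_charts g wC di dj) (grad2_charts g wC di dj).
Qed.

Hypotheses (hM : hausdorff_space M) (cM : compact [set: M]) (n2 : (2 <= n)%N).

Lemma riemannian_volumeP g : (exists mu, is_riemannian_volume g mu) ->
  is_riemannian_volume g (riemannian_volume g).
Proof.
by rewrite /riemannian_volume; case: pselect => // h _; exact: (projT2 (cid h)).
Qed.

Lemma total_scalar_no_volume g : ~ (exists mu, is_riemannian_volume g mu) ->
  total_scalar_curvature g = 0.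
Proof.
rewrite /total_scalar_curvature /riemannian_volume; case: pselect => // _ _.
by rewrite /Rintegral integral_measure_zero.
Qed.

Lemma total_scalar_inconsistent g : ~ scalar_consistent g -> total_scalar_curvature g = 0.
Proof.
move=> /scalar_curvature_default E; rewrite /total_scalar_curvature E.
by rewrite /Rintegral integral0_eq.
Qed.

Lemma total_scalar_lsc g : exists C : R, 0 <= C /\
  forall (w : M -> R) g' (eta : R), Ck_fun A 2 w -> conformal_exp w g g' ->
  (forall p, `|expR ((n - 2)%:R * w p) - 1| <= eta) ->
  (forall p, `|expint (n - 2) (w p)| <= eta) -> 0 <= eta ->
  total_scalar_curvature g - C * eta <= total_scalar_curvature g'.
Proof.
(* Both defects pass from [g] to [g']: if [g] has no volume or inconsistent local curvatures, so
   does [g']. Both totals are then 0 and [C = 0] works. *)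
have [vg|vg] := pselect (exists mu, is_riemannian_volume g mu); last first.
  exists 0; split=> // w g' eta wC H _ _ _; rewrite mul0r subr0.
  rewrite !total_scalar_no_volume// => vg'; apply: vg.
  exact: (volume_conformal (Ck_fun_continuous (Ck_funN wC)) (conformal_exp_sym H) vg').
have [cg|cg] := pselect (scalar_consistent g); last first.
  exists 0; split=> // w g' eta wC H _ _ _; rewrite mul0r subr0.
  rewrite !total_scalar_inconsistent// => cg'; apply: cg.
  exact: (scalar_consistent_conformal (Ck_funN wC) (conformal_exp_sym H) cg').
have [s [idx [K [chi [Hq chi1]]]]] := partition_of_unity A hM cM.
pose X q := chi q \o param (A (idx q)).
have /choice[C CP] : forall q, exists C : R, 0 <= C /\
    forall (w : 'rV[R]_n -> R) G' (eta : R), Ck 2 (cod (A (idx q))) w ->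
    (forall y, cod (A (idx q)) y -> G' y = expR (2 * w y) *: local_metric g (idx q) y) ->
    (forall y, cod (A (idx q)) y -> `|expR ((n - 2)%:R * w y) - 1| <= eta) ->
    (forall y, cod (A (idx q)) y -> `|expint (n - 2) (w y)| <= eta) -> 0 <= eta ->
    Int (ext0 (cod (A (idx q))) (fun x => density (local_metric g (idx q)) x * X q x *
       local_scalar (local_metric g (idx q)) x)) - C * eta <=
    Int (ext0 (cod (A (idx q))) (fun x => density G' x * X q x * local_scalar G' x)).
  move=> q; have [cK Kc chiC chiP] := Hq q.
  apply: (Int_scalar_lsc (local_C2metric_chart g (idx q)) cK Kc (chiC (idx q))) => //.
    move=> x cx Kx; apply/eqP/negPn/negP => /(chiP _).2[_].
    by rewrite paramK.
  by move=> x _; exact: (chiP _).1.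
exists (\sum_(q <- s) C q); split.
  by apply: sumr_ge0 => q _; have [] := CP q.
move=> w g' eta wC H we wp eta0.
have vg' := volume_conformal (Ck_fun_continuous wC) H vg.
have cg' := scalar_consistent_conformal wC H cg.
have sup g1 q : supported_in (A := A) (idx q) (K q) (fun p => chi q p * scalar_curvature g1 p).
  have [cK Kc chiC chiP] := Hq q; split => //.
    move=> p; apply: (@continuousM _ _ (chi q) (scalar_curvature g1)).
      exact: (Ck_fun_continuous chiC).
    exact: scalar_curvature_continuous.
  by move=> p H0; apply: (chiP p).2; apply: contraNneq H0 => ->; rewrite mul0r.
have E g1 : scalar_consistent g1 -> (exists mu, is_riemannian_volume g1 mu) ->
    total_scalar_curvature g1 = \sum_(q <- s) Int (ext0 (cod (A (idx q)))
      (fun x => density (local_metric g1 (idx q)) x * X q x *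
       local_scalar (local_metric g1 (idx q)) x)).
  move=> c1 v1; rewrite /total_scalar_curvature.
  rewrite (integral_partition (riemannian_volumeP v1) (sup g1) chi1).
  apply: eq_bigr => q _; congr Int; apply: eq_ext0 => x cx.
  by rewrite (scalar_curvatureE c1 (param_dom cx)) paramK// mulrA.
rewrite (E g cg vg) (E g' cg' vg') big_distrl/= -sumrB; apply: ler_sum => q _.
have [_ CQ] := CP q.
apply: (CQ (w \o param (A (idx q))) (local_metric g' (idx q)) eta (wC (idx q))) => //.
- by move=> y _; exact: local_conformal_exp.
- by move=> y _; exact: we.
- by move=> y _; exact: wp.
Qed.

(** If the bound failed at [p0], continuity would make [sigma] exceed the curvature on a coordinate
    ball. Testing against a bump in that ball gives a fixed positive number [I0], while
    [Int_scalar_bound] gives [I0 <= C * eta] for every positive [eta]. *)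
Lemma scalar_lower_bound_limit g (sigma : M -> R) : continuous sigma ->
  (forall eta : R, 0 < eta -> exists (w : M -> R) g', [/\ Ck_fun A 2 w,
     conformal_exp w g g', (forall p, sigma p <= scalar_curvature g' p),
     (forall p, `|expR (2 * w p) - 1| <= eta) & (forall p, `|w p| <= eta)]) ->
  forall p, sigma p <= scalar_curvature g p.
Proof.
move=> cs Hs p0.
have [cg|cg] := pselect (scalar_consistent g); last first.
  have [w [g' [wC H sR _ _]]] := Hs 1 ltr01.
  have cg' : ~ scalar_consistent g'.
    move=> cg'; apply: cg.
    exact: (scalar_consistent_conformal (Ck_funN wC) (conformal_exp_sym H) cg').
  by have := sR p0; rewrite (scalar_curvature_default cg) (scalar_curvature_default cg').
rewrite leNgt; apply/negP => lt0.
have [i di] := atlas_cover A p0.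
pose D := cod (A i); pose G := local_metric g i; pose x0 := coord (A i) p0.
have HG : local_C2metric D G by exact: local_C2metric_chart.
have oD : open D by exact: cod_open.
have Dx0 : D x0 by exact: coord_cod.
have sC : Ck 0 D (sigma \o param (A i)).
  by apply/Ck0P => x cx; exact: continuous_param_comp.
pose h x := (sigma \o param (A i)) x - local_scalar G x.
have hC : Ck 0 D h by exact: (CkB oD sC (Ck_local_scalar HG)).
have oh : open (D `&` [set x | 0 < h x]).
  rewrite openE => x [Dx hx]; apply: filterI; first exact: open_nbhs_nbhs.
  have ch : {for x, continuous h} := Ck_continuous hC Dx.
  by apply: (ch [set s : R | 0 < s]); apply: open_nbhs_nbhs; split; [exact: open_gt|].
have hx0 : (D `&` [set x | 0 < h x]) x0.
  split => //; rewrite /h/= subr_gt0 coordK// -(scalar_curvatureE cg di); exact: lt0.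
have [r r0 rD] := cball_sub_open oh hx0.
pose chi := bump x0 r.
have chiC : Ck 2 D chi by apply: (Ck_bump _ _ oD) => b; exact: Ck_coord.
have chis : suppin D (cball x0 r) chi.
  by move=> x _ Kx; apply: bump_out => //; rewrite ltNge; apply/negP.
have KD : cball x0 r `<=` D by move=> x /rD[].
have [C [C0 HC]] := Int_scalar_bound HG (@compact_cball _ _ x0 r) KD chiC chis
  (fun x _ => bump_ge0 x0 r x) n2 sC.
pose I0 := Int (ext0 D (fun x => density G x * chi x * h x)).
have cc0 : ccont (ext0 D (fun x => density G x * chi x * h x)).
  apply: (ccont_ext0 oD (@compact_cball _ _ x0 r) KD); first by apply: suppinMl; exact: suppinMr.
  exact: (Ck_continuous_on (CkM oD (CkM oD (Ck_density HG (isT : (0 <= 2)%N))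
    (Ck_leq (isT : (0 <= 2)%N) chiC)) hC)).
have I0gt : 0 < I0.
  apply: (Int_gt0 (x := x0)) => //.
    apply: ext0_ge0 => x Dx; have [Kx|Kx] := pselect (cball x0 r x).
      have [_ hx] := rD _ Kx.
      apply: mulr_ge0; last exact: ltW.
      by apply: mulr_ge0; [exact: ltW (density_gt0 HG Dx)|exact: bump_ge0].
    by rewrite (chis x Dx Kx) mulr0 mul0r.
  rewrite ext0E//; apply: mulr_gt0; last by case: hx0.
  by apply: mulr_gt0; [exact: (density_gt0 HG Dx0)|exact: bump_center].
have key eta : 0 < eta -> I0 <= C * eta.
  move=> eta0; have [w [g' [wC H sR we wp]]] := Hs eta eta0.
  have cg' := scalar_consistent_conformal wC H cg.
  have := HC (w \o param (A i)) (local_metric g' i) eta (wC i).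
  have -> : Int (ext0 D (fun x => density G x * chi x *
      (local_scalar G x - (sigma \o param (A i)) x))) = - I0.
    rewrite -mulN1r -IntZ//; congr Int; rewrite -ext0Z; apply: eq_ext0 => x Dx.
    by rewrite /h; ring.
  rewrite lerN2; apply.
  - by move=> y _; exact: local_conformal_exp.
  - by move=> y cy; rewrite /= (le_trans (sR _))// (scalar_curvatureE cg' (param_dom cy)) paramK.
  - by move=> y _; exact: we.
  - by move=> y _; exact: wp.
  - exact: ltW.
have C1 : 0 < C + 1 by rewrite ltr_wpDl.
(* For this [eta], [C * eta] is [I0] times [C / (2 * (C + 1))], which is less than 1. The summand 1
   guards against [C = 0]. *)
have := key (I0 / (2 * (C + 1))); rewrite divr_gt0 ?mulr_gt0// => /(_ isT).
apply/negP; rewrite -ltNge.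
have -> : C * (I0 / (2 * (C + 1))) = I0 * (C / (2 * (C + 1))) by ring.
rewrite gtr_pMr// ltr_pdivrMr ?mulr_gt0// mul1r; lra.
Qed.

End scalar_curvature.

(** * Limits in the C^0-topology *)

Section conformal_limits.
Context {R : realType} {n : nat} {M : ptopologicalType} (A : smooth_atlas R n M).
Implicit Types (g : C2metric A) (i : chart_index A).

Lemma closure_C0_metrics (g0 g : C2metric A) (S : set (C0_metrics g0)) (e : R) :
  closure S g -> 0 < e -> exists2 g' : C2metric A, S g' &
    forall i p (v w : 'rV[R]_n), unit_pairs g0 (i, p, (v, w)) ->
    `|(v *m g i p *m w^T) 0 0 - (v *m g' i p *m w^T) 0 0| < e.
Proof.
move=> Sg e0.
pose N : set {uniform` unit_pairs g0 -> R} := [set h | forall x, unit_pairs g0 x ->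
  `|metric_eval g0 g x - h x| < e].
have Nn : nbhs (metric_eval g0 g) N.
  apply/uniform_nbhs; exists [set xy : R * R | `|xy.1 - xy.2| < e]; split => //.
  exact: (entourage_ball _ (PosNum e0)).
have : nbhs (g : C0_metrics g0) (metric_eval g0 @^-1` N).
  exact: (@initial_continuous _ _ (metric_eval g0) g N Nn).
move=> /Sg[g' [Sg' Ng']]; exists g' => // i p v w H.
exact: (Ng' (i, p, (v, w)) H).
Qed.

Lemma formZZ (B : 'M[R]_n) (a b : R) (v w : 'rV[R]_n) :
  ((a *: v) *m B *m (b *: w)^T) 0 0 = a * b * (v *m B *m w^T) 0 0.
Proof.
by rewrite linearZ/= -scalemxAr mxE -!scalemxAl mxE; ring.
Qed.

Lemma form_scale (B : 'M[R]_n) (a : R) (v w : 'rV[R]_n) :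
  (v *m (a *: B) *m w^T) 0 0 = a * (v *m B *m w^T) 0 0.
Proof. by rewrite -scalemxAr -scalemxAl mxE. Qed.

Lemma unit_vector g i p (v : 'rV[R]_n) : dom (A i) p -> v != 0 ->
  exists c : R, exists2 u : 'rV[R]_n, v = c *: u & (u *m g i p *m u^T) 0 0 = 1.
Proof.
move=> dp v0; have q0 := gram_pos g dp v0.
set q := (v *m g i p *m v^T) 0 0 in q0.
have s0 : Num.sqrt q != 0 by rewrite gt_eqF// sqrtr_gt0.
exists (Num.sqrt q), ((Num.sqrt q)^-1 *: v).
  by rewrite scalerA divff// scale1r.
by rewrite formZZ -/q -{3}[q](sqr_sqrtr (ltW q0)) expr2; field.
Qed.

Lemma delta_neq0 (a : 'I_n) : delta_mx 0 a != 0 :> 'rV[R]_n.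
Proof.
apply/eqP => /rowP/(_ a); rewrite !mxE !eqxx => /eqP; by rewrite oner_eq0.
Qed.

Lemma delta_form (B : 'M[R]_n) (a b : 'I_n) :
  ((delta_mx 0 a : 'rV[R]_n) *m B *m (delta_mx 0 b : 'rV[R]_n)^T) 0 0 = B a b.
Proof. by rewrite trmx_delta -rowE -colE !mxE. Qed.

Lemma eq_of_close (x y k : R) : 0 <= k -> (forall e, 0 < e -> `|x - y| <= e * k) -> x = y.
Proof.
move=> k0 H; apply/eqP; rewrite -subr_eq0 -normr_le0.
apply/ler_addgt0Pr => e e0; rewrite add0r.
have k1 : 0 < k + 1 by rewrite ltr_wpDl.
apply: le_trans (H (e / (k + 1)) _) _; first by rewrite divr_gt0.
by rewrite -mulrA ler_piMr ?(ltW e0)// ler_pdivrMl// mulr1 lerDl.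
Qed.

(** The variable [t] is the ratio of two conformal factors, so [w] is chosen with [e^{2w} = t]. The
    four quantities are continuous in [t] near 1 and vanish at [t = 1]. *)
Lemma conformal_factor_near (m : nat) (eta : R) : 0 < eta -> exists2 d : R, 0 < d &
  forall t : R, `|t - 1| < d -> let w := 2^-1 * ln t in
  [/\ `|w| <= eta, `|t - 1| <= eta, `|expR (m%:R * w) - 1| <= eta & `|expint m w| <= eta].
Proof.
move=> eta0.
have cw : {for (1 : R), continuous (fun t : R => 2^-1 * ln t)}.
  apply: continuousM; first exact: cst_continuous.
  exact: is_derive1_continuous (is_derive1_ln ltr01).
have w1 : 2^-1 * ln 1 = 0 :> R by rewrite ln1 mulr0.
have near1 (f : R -> R) : {for (0 : R), continuous f} ->
    \forall t \near (1 : R), `|f (2^-1 * ln t) - f 0| <= eta.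
  move=> cf.
  have : {for (1 : R), continuous (fun t : R => f (2^-1 * ln t))}.
    by apply: (@continuous_comp _ _ _ (fun t : R => 2^-1 * ln t) f) => //; rewrite w1.
  move=> /cvgrPdist_le/(_ eta eta0); rewrite w1.
  by apply: filterS => t; rewrite distrC.
have h1 := near1 id (@cvg_id _ _).
have h2 := near1 _ (is_derive1_continuous (is_derive_expRM m 0)).
have h3 := near1 _ (is_derive1_continuous (is_derive_expint m 0)).
have h4 : \forall t \near (1 : R), `|t - 1| <= eta.
  have /cvgrPdist_le/(_ eta eta0) := @cvg_id R (nbhs (1 : R)).
  by apply: filterS => t; rewrite distrC.
have [d /= d0 H] : exists2 d : R, 0 < d & forall t, `|t - 1| < d ->
    [/\ `|2^-1 * ln t - 0| <= eta, `|t - 1| <= eta,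
       `|expR (m%:R * (2^-1 * ln t)) - expR (m%:R * 0)| <= eta &
       `|expint m (2^-1 * ln t) - expint m 0| <= eta].
  have : nbhs (1 : R) [set t | [/\ `|2^-1 * ln t - 0| <= eta, `|t - 1| <= eta,
       `|expR (m%:R * (2^-1 * ln t)) - expR (m%:R * 0)| <= eta &
       `|expint m (2^-1 * ln t) - expint m 0| <= eta]].
    apply: filterS (filterI (filterI h1 h2) (filterI h3 h4)).
    by move=> t [[a b] [c e]]; split; [exact: a|exact: e|exact: b|exact: c].
  move=> /nbhs_ballP[d /= d0 Hd]; exists d => // t td; apply: Hd.
  by rewrite /ball/= distrC.
exists d => // t td; have [a b c e] := H t td.
split => //; first by rewrite subr0 in a.
  by rewrite mulr0 expR0 in c.
move: e; have -> : expint m 0 = 0 :> R.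
  by rewrite /expint; case: eqP => // _; rewrite mulr0 expR0 subrr mul0r.
by rewrite subr0.
Qed.

Hypotheses (hM : hausdorff_space M) (cM : compact [set: M]) (n2 : (2 <= n)%N).

(** Evaluating on [g0]-unit vectors turns closeness of metrics into closeness of conformal factors.
    The conclusion changes the reference metric from [g0] to the limit [g], whose ratio to nearby
    metrics of [S] is uniformly close to 1. *)
Lemma conformal_limit (g0 g : C2metric A) (S : set (C0_metrics g0)) :
  (forall g', S g' -> conformal_class g0 g') -> closure S g ->
  conformal_class g0 g /\
  forall (m : nat) (eta : R), 0 < eta -> exists (w : M -> R) (g' : C2metric A),
   [/\ S g', Ck_fun A 2 w, conformal_exp w g g' & forall p,
     [/\ `|w p| <= eta, `|expR (2 * w p) - 1| <= eta,
      `|expR (m%:R * w p) - 1| <= eta & `|expint m (w p)| <= eta]].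
Proof.
move=> Sc Sg.
pose a0 : 'I_n := Ordinal (ltnW n2).
have /choice[c cP] := atlas_cover A.
have /choice[e eP] : forall p : M, exists u : 'rV[R]_n,
    (u *m g0 (c p) p *m u^T) 0 0 = 1.
  by move=> p; have [_ [u _ uE]] := unit_vector g0 (cP p) (delta_neq0 a0); exists u.
(* The candidate factor, read off on one [g0]-unit vector per point before [g] is known to be
   conformal to [g0]. It is positive because the limit [g] is itself a metric. *)
pose u p := (e p *m g (c p) p *m (e p)^T) 0 0.
have e0 p : e p != 0.
  apply/eqP => E; have := eP p; rewrite E !mul0mx mxE => /eqP.
  by rewrite eq_sym oner_eq0.
have u0 p : 0 < u p by apply: gram_pos; [exact: cP|exact: e0].
have close (eps : R) : 0 < eps -> exists g' u', [/\ S g', Ck_fun A 2 u',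
    forall p, 0 < u' p, conformal_by u' g0 g' & (forall p, `|u p - u' p| < eps) /\
    forall i p (v w : 'rV[R]_n), unit_pairs g0 (i, p, (v, w)) ->
    `|(v *m g i p *m w^T) 0 0 - (v *m g' i p *m w^T) 0 0| < eps].
  move=> eps0; have [g' Sg' H] := closure_C0_metrics Sg eps0.
  have [u' [u'C u'0 u'E]] := Sc _ Sg'.
  exists g', u'; split => //; split => // p.
  have := H (c p) p (e p) (e p); rewrite u'E form_scale eP mulr1; apply.
  by split; [exact: cP|exact: eP|exact: eP].
have gE i p : g i p = u p *: g0 i p.
  have [dp|dp] := pselect (dom (A i) p); last by rewrite !gram_out// scaler0.
  have unitE v w : unit_pairs g0 (i, p, (v, w)) ->
      (v *m g i p *m w^T) 0 0 = u p * (v *m g0 i p *m w^T) 0 0.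
    move=> vw; apply: (@eq_of_close _ _ (1 + `|(v *m g0 i p *m w^T) 0 0|)).
      by rewrite addr_ge0.
    move=> eps eps0; have [g' [u' [_ _ _ u'E [uu' H]]]] := close eps eps0.
    have := H i p v w vw; rewrite u'E form_scale => H1.
    set q := (v *m g0 i p *m w^T) 0 0 in H1 *.
    rewrite -(subrKA (u' p * q)) (le_trans (ler_normD _ _))// mulrDr mulr1.
    rewrite lerD//; first exact: ltW.
    by rewrite -mulrBl normrM ler_wpM2r// distrC ltW.
  apply/matrixP => a b; rewrite -delta_form -[RHS]delta_form form_scale.
  have [ca [va -> va1]] := unit_vector g0 dp (delta_neq0 a).
  have [cb [vb -> vb1]] := unit_vector g0 dp (delta_neq0 b).
  by rewrite !formZZ unitE//; ring.
(* Uniform limits do not preserve class C^2. The regularity of [u] comes instead from writing it as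
   a quotient of diagonal Gram entries of the two C^2 metrics. *)
have uC : Ck_fun A 2 u.
  move=> i; have d0 (g1 : C2metric A) p : dom (A i) p -> 0 < g1 i p a0 a0.
    by move=> dp; rewrite -delta_form; apply: gram_pos => //; exact: delta_neq0.
  have ogi := @cod_open _ _ _ (A i).
  have h : Ck 2 (cod (A i)) (fun x => g i (param (A i) x) a0 a0 * (g0 i (param (A i) x) a0 a0)^-1).
    apply: (CkM ogi (gram_C2 g i a0 a0)); apply: (CkV ogi _ (gram_C2 g0 i a0 a0)).
    by move=> x cx; rewrite gt_eqF// d0//; exact: param_dom.
  apply: Ck_eq h => // x cx; rewrite gE mxE mulfK// gt_eqF// d0//; exact: param_dom.
split; first by exists u; split.
move=> m eta eta0.
have [d d0 Hd] := conformal_factor_near m eta0.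
(* By compactness the limit factor has a positive lower bound [um], so factors that are [d * um]
   close have a ratio that is [d] close to 1. *)
have [um um0 umP] : exists2 um : R, 0 < um & forall p, um <= u p.
  have [||p _ pP] := @compact_EVT_min M R u setT _ cM.
    by exists point.
  - exact/continuous_subspaceT/(Ck_fun_continuous uC).
  - by exists (u p) => // q; apply: pP; rewrite inE.
have [g' [u' [Sg' u'C u'0 u'E [uu' _]]]] := close (d * um) (mulr_gt0 d0 um0).
have t0 p : 0 < u' p / u p by rewrite divr_gt0.
exists (fun p => 2^-1 * ln (u' p / u p)), g'; split; first exact: Sg'.
- move=> i; have oi := @cod_open _ _ _ (A i).
  have tC : Ck 2 (cod (A i)) (fun x => u' (param (A i) x) * (u (param (A i) x))^-1).
    apply: (CkM oi (u'C i)); apply: (CkV oi _ (uC i)) => x _.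
    exact: lt0r_neq0 (u0 _).
  exact: (CkZ 2^-1 oi (Ck_ln oi (fun x _ => t0 (param (A i) x)) tC)).
- move=> i p; rewrite mulrA divff ?pnatr_eq0// mul1r lnK ?posrE// u'E gE scalerA.
  by rewrite divfK// gt_eqF.
move=> p; have td : `|u' p / u p - 1| < d.
  have -> : u' p / u p - 1 = (u' p - u p) / u p by rewrite mulrBl divff// gt_eqF.
  rewrite normrM normfV (gtr0_norm (u0 p)) ltr_pdivrMr//.
  by rewrite distrC (lt_le_trans (uu' p))// ler_pM2l.
have [h1 h2 h3 h4] := Hd _ td; split => //.
by rewrite mulrA divff ?pnatr_eq0// mul1r lnK ?posrE.
Qed.

(** By [total_scalar_lsc] the limit can exceed [kappa] by at most [C * eta], with [C] independent of
    the approximating metric. *)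
Lemma total_scalar_limit (g : C2metric A) (kappa : R) :
  (forall eta : R, 0 < eta -> exists (w : M -> R) (g' : C2metric A),
   [/\ total_scalar_curvature g' <= kappa, Ck_fun A 2 w, conformal_exp w g g' & forall p,
     `|expR ((n - 2)%:R * w p) - 1| <= eta /\ `|expint (n - 2) (w p)| <= eta]) ->
  total_scalar_curvature g <= kappa.
Proof.
move=> H; have [C [C0 HC]] := total_scalar_lsc hM cM n2 g.
apply/ler_addgt0Pr => eps eps0.
have C1 : 0 < C + 1 by rewrite ltr_wpDl.
pose eta := eps / (C + 1).
have eta0 : 0 < eta by rewrite divr_gt0.
have [w [g' [kg' wC wE we]]] := H eta eta0.
have := HC w g' eta wC wE (fun p => (we p).1) (fun p => (we p).2) (ltW eta0).
rewrite lerBlDr => /le_trans; apply; rewrite lerD// /eta mulrCA.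
by rewrite ler_piMr ?(ltW eps0)// ler_pdivrMr// mul1r lerDl.
Qed.

End conformal_limits.

Theorem corollary1p1 (R : realType) (n : nat) (M : ptopologicalType)
    (A : smooth_atlas R n M) (g0 : C2metric A) (sigma : M -> R) (kappa : R) :
  (2 <= n)%N -> hausdorff_space M -> compact [set: M] -> continuous sigma ->
  ((0 < yamabe_constant g0)%E ->
    closed ([set g | [/\ conformal_class g0 g,
                         total_scalar_curvature g <= kappa &
                         forall p, sigma p <= scalar_curvature g p]]
            : set (C0_metrics g0))) /\
  ((yamabe_constant g0 <= 0)%E ->
    closed ([set g | conformal_class g0 g /\
                     total_scalar_curvature g <= kappa]
            : set (C0_metrics g0))).
Proof.
move=> n2 hM cM cs; split=> _ g /= gS.
  have [gc glim] := conformal_limit cM n2 (fun g' (H : [/\ _, _ & _]) =>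
    let: And3 H1 _ _ := H in H1) gS.
  split => //.
    apply: (total_scalar_limit hM cM n2) => eta eta0.
    have [w [g' [[_ kg' _] wC wE wb]]] := glim (n - 2)%N eta eta0.
    by exists w, g'; split => // p; have [_ _ ? ?] := wb p.
  apply: (scalar_lower_bound_limit n2 cs) => eta eta0.
  have [w [g' [[_ _ sg'] wC wE wb]]] := glim 0%N eta eta0.
  by exists w, g'; split => // p; have [? ? _ _] := wb p.
have [gc glim] := conformal_limit cM n2 (fun g' (H : _ /\ _) => H.1) gS.
split => //; apply: (total_scalar_limit hM cM n2) => eta eta0.
have [w [g' [[_ kg'] wC wE wb]]] := glim (n - 2)%N eta eta0.
by exists w, g'; split => // p; have [_ _ ? ?] := wb p.
Qed.
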